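(* Let $(X,d)$ be a Polish metric space (complete and separable), let $P:B_b(X)\to B_b(X)$ be a Markov operator with transition probability function $\{\mathbf P_x: x\in X\}$, and let $\{\mathbf Q_{x,y}: x,y\in X\}$ be a family of subprobability measures on $X^2$ such that $(x,y)\mapsto \mathbf Q_{x,y}(B)$ is measurable for every Borel $B\subset X^2$ and $$\mathbf Q_{x,y}(A\times X)\le \mathbf P_x(A),\qquad \mathbf Q_{x,y}(X\times A)\le \mathbf P_y(A)$$ for all $x,y\in X$ and Borel $A\subset X$. Let $\{\mathbf B_{x,y}\}$ be the associated coupling $\mathbf B_{x,y}=\mathbf Q_{x,y}+\mathbf R_{x,y}$ (defined in the context). Assume: (A0) $P$ is a Feller operator, i.e. $P(C_b(X))\subset C_b(X)$. (A1) There is a continuous function $L:X\to[0,\infty)$ which is bounded on bounded sets, satisfies $\lim_{x\to\infty}L(x)=+\infty$ (this condition being omitted if $X$ is bounded), and for some $\lambda\in(0,1)$, $c>0$ satisfies $PL(x)\le\lambda L(x)+c$ for all $x\in X$. (A2) There exist a Borel set $F\subset X^2$ and $\alpha\in(0,1)$ such that $\operatorname{supp}\mathbf Q_{x,y}\subset F$ and $$\int_{X^2}d(u,v)\,\mathbf Q_{x,y}(du,dv)\le\alpha\, d(x,y)\qquad\text{for }(x,y)\in F.$$ (A3) There exist $\delta>0$, $l>0$ and $\nu\in(0,1]$ such that for all $(x,y)\in F$ $$1-\mathbf Q_{x,y}(X^2)\le l\,d(x,y)^{\nu}\qquad\text{and}\qquad \mathbf Q_{x,y}\big(\{(u,v)\in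 X^2: d(u,v)\le\alpha\, d(x,y)\}\big)\ge\delta .$$ (A4) There exist $\beta\in(0,1)$, $\tilde C>0$ and $R>0$ such that for $$\kappa((x_n,y_n)_{n\in\mathbb N_0})=\inf\{n\in\mathbb N_0: (x_n,y_n)\in F\ \text{and}\ L(x_n)+L(y_n)<R\}$$ we have $\mathbb E_{x,y}\,\beta^{-\kappa}\le\tilde C$ whenever $L(x)+L(y)<\frac{4c}{1-\lambda}$, where $\mathbb E_{x,y}$ is the expectation with respect to the Markov chain on $X^2$ starting from $(x,y)$ with transition function $\{\mathbf B_{x,y}: x,y\in X\}$. Then $P$ possesses a unique invariant measure $\mu_*\in\mathcal M_1^L(X)$, which is attractive, i.e. $$\lim_{n\to\infty}\int_X P^nf(x)\,\mu(dx)=\int_X f(x)\,\mu_*(dx)\qquad\text{for } f\in C_b(X),\ \mu\in\mathcal M_1(X).$$ Moreover, there exist $q\in(0,1)$ and $C>0$ such that $$\|P^{*n}\mu-\mu_*\|_{FM}\le q^n C\Big(1+\int_X L(x)\,\mu(dx)\Big)\qquad\text{for }\mu\in\mathcal M_1^L(X),\ n\in\mathbb N.$$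
   Context: $B_b(X)$ is the space of bounded Borel measurable real functions on $X$; $C_b(X)$ is its subspace of bounded continuous functions. $\mathcal M_{fin}(X)$ is the set of finite (nonnegative) Borel measures on $X$, $\mathcal M_1(X)$ the set of Borel probability measures; a subprobability measure is a measure of total mass at most $1$. $\mathcal M_1^L(X)=\{\mu\in\mathcal M_1(X):\int_X L\,d\mu<\infty\}$. A Markov operator is a linear operator $P:B_b(X)\to B_b(X)$ with $P\mathbf 1_X=\mathbf 1_X$ and $Pf\ge0$ for $f\ge0$. A transition probability function for $P$ is a family $\mathbf P_x\in\mathcal M_1(X)$, $x\in X$, with $x\mapsto\mathbf P_x(A)$ measurable for every Borel $A$ and $Pf(x)=\int_X f(y)\,\mathbf P_x(dy)$ for $f\in B_b(X)$; for the (possibly unbounded) function $L\ge 0$ we put $PL(x)=\int_X L(y)\,\mathbf P_x(dy)$. The dual operator is $P^*\mu(A)=\int_X\mathbf P_x(A)\,\mu(dx)$, $\mu\in\mathcal M_{fin}(X)$. A measure $\mu_*\in\mathcal M_1(X)$ is invariant for $P$ if $P^*\mu_*=\mu_*$. Fortet–Mourier metric: $\|\mu_1-\mu_2\|_{FM}=\sup\{|\int_X f\,d(\mu_1-\mu_2)|: f\in\mathcal F\}$, where $\mathcal F=\{f\in C_b(X): |f(x)-f(y)|\le d(x,y)\text{ and }|f(x)|\le1\text{ for all }x,y\in X\}$. Coupling: $\mathbf R_{x,y}$ is the measure on $X^2$ given on rectangles by $$\mathbf R_{x,y}(A\times B)=\frac{1}{1-\mathbf Q_{x,y}(X^2)}\big(\mathbf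 P_x(A)-\mathbf Q_{x,y}(A\times X)\big)\big(\mathbf P_y(B)-\mathbf Q_{x,y}(X\times B)\big)$$ when $\mathbf Q_{x,y}(X^2)<1$, and $\mathbf R_{x,y}=0$ otherwise. Then $\mathbf B_{x,y}=\mathbf Q_{x,y}+\mathbf R_{x,y}$ is a probability measure on $X^2$ with marginals $\mathbf P_x$ and $\mathbf P_y$. The symbol $\lim_{x\to\infty}L(x)=+\infty$ means $L(x)\to\infty$ as $d(x,\bar x)\to\infty$ for a fixed $\bar x\in X$. Conventions: $\inf\emptyset=\infty$ and $\beta^{-\infty}=\infty$. *)

(* Defs.v *)
From HB Require Import structures.
From mathcomp Require Import all_boot all_order all_algebra.
From mathcomp Require Import all_classical all_reals all_analysis.
From mathcomp Require Import measurable_realfun lra.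

Set Implicit Arguments.
Unset Strict Implicit.
Unset Printing Implicit Defensive.

Import Order.TTheory GRing.Theory Num.Theory.
Import numFieldNormedType.Exports.

Local Open Scope classical_set_scope.
Local Open Scope ring_scope.
Local Open Scope ereal_scope.

(* Completeness in the library comes with a base point, so [X] is nonempty. *)
#[short(type="completeMetricType")]
HB.structure Definition CompleteMetric (R : numDomainType) :=
  {T of Complete T & Metric R T}.

Definition separable (X : topologicalType) :=
  exists2 D : set X, countable D & dense D.

(* [borel X] is the metric space [X] itself, equipped moreover with its Borel
   sigma-algebra. Its square carries the product sigma-algebra, which is the
   Borel sigma-algebra of the product topology when [X] is separable: see
   [measurable_borel_square]. *)
Definition borel {R : realType} (X : completeMetricType R) : Type :=
  g_sigma_algebraType (@open X).

HB.instance Definition _ {R : realType} (X : completeMetricType R) :=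
  CompleteMetric.copy (borel X) X.
HB.instance Definition _ {R : realType} (X : completeMetricType R) :=
  Measurable.copy (borel X) (g_sigma_algebraType (@open X)).

Section borel_square.
Context {R : realType} (X : completeMetricType R).
Local Notation T := (borel X).

Lemma measurable_borel_square : separable X ->
  @measurable _ (T * T)%type = <<s @open (T * T)%type >>.
Proof.
case=> D cD dD.
pose S := g_sigma_algebraType (@open (T * T)%type).
apply/seteqP; split.
  have mpre (g : T * T -> T) : continuous g ->
      forall A : set T, measurable A -> @measurable _ S (g @^-1` A).
    move=> cg A mA; rewrite -[_ @^-1` _]setTI.
    have mg : @measurable_fun _ _ S T setT g.
      apply: (@measurability _ _ S T setT g (@open T)) => //.
      move=> _ [U oU <-]; rewrite setTI; apply: sub_sigma_algebra.
      by apply: open_comp => // z _; exact: cg.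
    exact: mg.
  rewrite measurable_prod_measurableType.
  apply: smallest_sub; first exact: smallest_sigma_algebra.
  move=> _ [A mA] [B mB] <-.
  rewrite (_ : A `*` B = fst @^-1` A `&` snd @^-1` B); last by [].
  apply: (@measurableI _ S); apply: mpre => //.
  - by move=> z; exact: cvg_fst.
  - by move=> z; exact: cvg_snd.
apply: smallest_sub; first exact: sigma_algebra_measurable.
move=> O oO.
pose e (n : nat) : R := (n.+1%:R^-1)%R.
pose ib (i : {d : T | D d} * {d : T | D d} * nat) : set (T * T) :=
  (ball (sval i.1.1) (e i.2))° `*` (ball (sval i.1.2) (e i.2))°.
pose I := {i | ib i `<=` O}.
have -> : O = \bigcup_(i : I) ib (sval i).
  apply/seteqP; split => [[u v] Ouv|]; last by move=> z [[i iO] _] /iO.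
  have [[U V] /= [nU nV] UVO] := oO _ Ouv.
  have /nbhs_ballP[r1 /= r1_gt0 rU] := nU.
  have /nbhs_ballP[r2 /= r2_gt0 rV] := nV.
  have r_gt0 : (0 < Num.min r1 r2 / 4)%R by rewrite divr_gt0// lt_min r1_gt0.
  have [n _ /(_ n (leqnn _)) /= nr] := near_infty_natSinv_lt (PosNum r_gt0).
  have e_gt0 : (0 < e n / 2)%R by rewrite divr_gt0// invr_gt0.
  have pick (w : T) : exists2 d : T, D d & ball w (e n / 2)%R d.
    have [d [/interior_subset wd Dd]] :=
      dD (ball (w : X) (e n / 2)%R)°
         (ex_intro _ w (nbhsx_ballx (w : X) _ e_gt0))
         (open_interior _).
    by exists d.
  have inball (w d : T) : ball w (e n / 2)%R d -> (ball d (e n))° w.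
    move=> wd; apply/nbhs_ballP; exists (e n / 2)%R => //= t wt.
    by rewrite [e n]splitr; apply: ball_triangle wt; exact: ball_sym.
  have sub (w d : T) r : (e n + e n / 2 <= r)%R -> ball w (e n / 2)%R d ->
      (ball d (e n))° `<=` ball w r.
    move=> ler wd t /interior_subset dt; apply: le_ball ler _ _.
    by rewrite addrC; exact: ball_triangle dt.
  have [a Da ua] := pick u.
  have [b Db vb] := pick v.
  have le_e r : (Num.min r1 r2 <= r)%R -> (e n + e n / 2 <= r)%R.
    move=> mr; move: nr; rewrite -/(e n); lra.
  have iO : ib (exist _ a Da, exist _ b Db, n) `<=` O.
    move=> [s t] [/= as' bt]; apply: UVO; split => /=.
      by apply: rU; apply: (sub u a) as' => //; apply: le_e; rewrite ge_min lexx.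
    apply: rV; apply: (sub v b) bt => //.
    by apply: le_e; rewrite ge_min lexx orbT.
  by exists (exist (fun i => ib i `<=` O) _ iO) => //; split; exact: inball.
apply: countable_bigcupT_measurable.
  have [f finj] := countable_injP _ cD.
  apply/countable_injP.
  exists (fun i : I => pickle (f (sval (sval i).1.1), f (sval (sval i).1.2), (sval i).2)).
  move=> [[[[a Da] [b Db]] n] ?] [[[[a' Da'] [b' Db']] n'] ?] _ _ /=.
  move=> /(pcan_inj pickleK)[] /finj aa' /finj bb' nn'.
  have {}aa' : a = a' by apply: aa'; exact/mem_set.
  have {}bb' : b = b' by apply: bb'; exact/mem_set.
  by subst; apply: eq_exist; congr (_, _, _); exact: eq_exist.
move=> i; apply: measurableX; apply: sub_sigma_algebra; exact: open_interior.
Qed.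

End borel_square.

Section markov.
Context {R : realType} (X : completeMetricType R).
Local Notation T := (borel X).
Implicit Types (P : (T -> R) -> (T -> R)) (f g L : T -> R) (A B : set T).

Definition Bb f := measurable_fun [set: T] f /\ bounded_fun f.

Definition Cb f := continuous f /\ bounded_fun f.

(* Only the restriction of [P] to bounded Borel functions is meaningful. *)
Record markov_operator P : Prop := MarkovOperator {
  markov_Bb : forall f, Bb f -> Bb (P f) ;
  markov_linear : forall (a : R) f g, Bb f -> Bb g ->
    P (fun x => a * f x + g x)%R = (fun x => a * P f x + P g x)%R ;
  markov_cst1 : P (cst 1%R) = cst 1%R ;
  markov_ge0 : forall f, Bb f ->
    (forall x, 0 <= f x)%R -> forall x, (0 <= P f x)%R
}.

Definition transition_function P (p : R.-pker T ~> T) :=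
  forall f, Bb f -> forall x, (P f x)%:E = \int[p x]_y (f y)%:E.

Definition feller P := forall f, Cb f -> Cb (P f).

Section dual.
Context (p : R.-pker T ~> T) (mu : {measure set T -> \bar R}).

Definition dual_fun A : \bar R := \int[mu]_x p x A.

Let dual0 : dual_fun set0 = 0.
Proof. by apply: integral0_eq => x _; rewrite measure0. Qed.

Let dual_ge0 A : 0 <= dual_fun A.
Proof. by apply: integral_ge0 => x _; exact: measure_ge0. Qed.

Let dual_sigma_additive : semi_sigma_additive dual_fun.
Proof.
move=> F mF tF mUF.
rewrite [X in _ --> X](_ : _ = \int[mu]_x (\sum_(i <oo) p x (F i))); last first.
  by apply: eq_integral => x _; rewrite measure_semi_bigcup.
rewrite integral_nneseries//; last first.
  by move=> n; exact: measurable_kernel.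
by apply: is_cvg_nneseries => n _ _; exact: integral_ge0.
Qed.

HB.instance Definition _ := isMeasure.Build _ _ _ dual_fun
  dual0 dual_ge0 dual_sigma_additive.

Definition dual_measure : {measure set T -> \bar R} := dual_fun.

End dual.

Definition invariant_measure (p : R.-pker T ~> T) (mu : {measure set T -> \bar R}) :=
  forall A, measurable A -> dual_measure p mu A = mu A.

Definition fortet_mourier (mu1 mu2 : {measure set T -> \bar R}) : \bar R :=
  ereal_sup [set `|\int[mu1]_x (f x)%:E - \int[mu2]_x (f x)%:E| |
    f in [set f | [/\ Cb f,
                      forall x y, (`|f x - f y| <= mdist x y)%R &
                      forall x, (`|f x| <= 1)%R]]].

Definition metric_bounded A :=
  exists M : R, forall x y, A x -> A y -> (mdist x y <= M)%R.

Definition tends_to_infinity L :=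
  forall (x0 : T) (M : R), exists r : R,
    forall x, (r < mdist x0 x)%R -> (M < L x)%R.

End markov.

Definition measure_support {R : realType} {S : topologicalType} (mu : set S -> \bar R) :
  set S := [set z | forall U, open U -> U z -> 0 < mu U].

Section measure_difference.
Context {R : realType} d (T : measurableType d).
Implicit Types p q : {measure set T -> \bar R}.

Lemma measure_difference p q :
  (forall A, measurable A -> q A <= p A) -> p setT < +oo ->
  exists m : {measure set T -> \bar R},
    forall A, measurable A -> m A = p A - q A.
Proof.
move=> qp pT.
have pfin A : measurable A -> p A \is a fin_num.
  move=> mA; rewrite ge0_fin_numE//; apply: le_lt_trans pT.
  by apply: le_measure; rewrite ?inE.
have qfin A : measurable A -> q A \is a fin_num.
  move=> mA; rewrite ge0_fin_numE//; apply: le_lt_trans (qp _ mA) _.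
  by rewrite -ge0_fin_numE// pfin.
pose m A := maxe 0 (p A - q A).
have mE A : measurable A -> m A = p A - q A.
  by move=> mA; apply/max_idPr; rewrite sube_ge0 ?qp// qfin.
have m0 : m set0 = 0 by rewrite mE// !measure0 sube0.
have m_ge0 A : 0 <= m A by rewrite le_max lexx.
have m_add : semi_sigma_additive m.
  move=> F mF tF mUF; rewrite mE//.
  rewrite [X in X @ _ --> _](_ : _ = (fun n =>
     \sum_(0 <= i < n) p (F i) - \sum_(0 <= i < n) q (F i))); last first.
    apply/funext => n; rewrite -fin_num_sumeN; last by move=> *; exact: qfin.
    by rewrite -big_split; apply: eq_bigr => i _; exact: mE.
  apply: cvgeB.
  - by rewrite fin_num_adde_defr// pfin//; exact: bigcup_measurable.
  - exact: measure_semi_sigma_additive.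
  - exact: measure_semi_sigma_additive.
pose mm : {measure set T -> \bar R} := HB.pack m
  (isMeasure.Build _ _ _ m m0 m_ge0 m_add).
by exists mm.
Qed.

Import HBNNSimple.

Lemma eq_integral_set_fun (m1 m2 : set T -> \bar R) (f : T -> \bar R) :
  (forall A, measurable A -> m1 A = m2 A) ->
  \int[m1]_x f x = \int[m2]_x f x.
Proof.
move=> m12; have sE (h : {nnsfun T >-> R}) : sintegral m1 h = sintegral m2 h.
  by apply: eq_fsbigr => x _; rewrite m12.
rewrite /integral; congr (ereal_sup _ - ereal_sup _).
  by apply/seteqP; split => _ [h hf <-]; exists h.
by apply/seteqP; split => _ [h hf <-]; exists h.
Qed.

End measure_difference.

Section coupling.
Context {R : realType} (X : completeMetricType R).
Local Notation T := (borel X).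
Context (p : R.-pker T ~> T) (Q : R.-spker (T * T)%type ~> (T * T)%type).

(* The residuals are plain set functions; they agree on measurable sets with
   measures as soon as the marginals of [Q z] are dominated by [p z.1] and
   [p z.2], so [\x] is then their product measure: see
   [residual_coupling_rectangle]. *)
Definition residual1 (z : T * T) (A : set T) := p z.1 A - Q z (A `*` setT).

Definition residual2 (z : T * T) (B : set T) := p z.2 B - Q z (setT `*` B).

Definition residual_coupling (z : T * T) (C : set (T * T)) : \bar R :=
  if Q z setT < 1 then
    ((1 - fine (Q z setT))^-1)%:E * (residual1 z \x residual2 z) C
  else 0.


Definition coupling (z : T * T) (C : set (T * T)) : \bar R :=
  Q z C + residual_coupling z C.

Lemma residual_coupling_rectangle z A B :
  (forall A, measurable A -> Q z (A `*` setT) <= p z.1 A) ->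
  (forall B, measurable B -> Q z (setT `*` B) <= p z.2 B) ->
  measurable A -> measurable B -> Q z setT < 1 ->
  residual_coupling z (A `*` B) = ((1 - fine (Q z setT))^-1)%:E *
    ((p z.1 A - Q z (A `*` setT)) * (p z.2 B - Q z (setT `*` B))).
Proof.
move=> Qp Qp2 mA mB Q1; rewrite /residual_coupling Q1; congr (_ * _).
have mfst : measurable_fun [set: T * T] (fst : T * T -> T) by [].
have [q qE] : exists q : {measure set T -> \bar R},
    forall C, q C = Q z (C `*` setT).
  unshelve eexists (pushforward (Q z) (fst : T * T -> T)) => //.
  move=> C; congr (Q z _); apply/seteqP.
  by split => [[u v] /= ?|[u v] /= []].
have [||m mE] := @measure_difference R _ T (p z.1) q.
- by move=> C mC; rewrite qE Qp.
- by rewrite prob_kernel ltry.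
rewrite /product_measure1 (eq_integral_set_fun _ (m2 := m)); last first.
  by move=> C mC; rewrite mE// qE.
have B_ge0 : 0 <= residual2 z B.
  have Qfin : Q z (setT `*` B) \is a fin_num.
    rewrite ge0_fin_numE//; apply: le_lt_trans (ltry 1).
    apply: le_trans (ltW Q1); apply: le_measure; rewrite ?inE//.
    exact: measurableX.
  by rewrite /residual2 sube_ge0 ?Qp2// Qfin.
rewrite [LHS](_ : _ = \int[m]_x ((\1_A x)%:E * residual2 z B)); last first.
  apply: eq_integral => x _ /=; rewrite indicE.
  have [xA|xA] := boolP (x \in A); first by rewrite in_xsectionX// mul1e.
  by rewrite notin_xsectionX// mul0e /residual2 setX0 !measure0 sube0.
rewrite (@ge0_integralZr _ _ _ m setT measurableT (EFin \o \1_A))//; last 2 first.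
- exact/measurable_EFinP/measurable_indic.
- by move=> x _; rewrite lee_fin.
by rewrite integral_indic// setIT mE// qE.
Qed.

End coupling.

Section markov_chain.
Context d (S : measurableType d) (R : realType).
Context dW (W : measurableType dW).

Definition natural_filtration (Z : nat -> W -> S) (n : nat) : set (set W) :=
  <<s [set G | exists i A, [/\ (i <= n)%N, measurable A & G = Z i @^-1` A]] >>.

(* [chain_step] says that the conditional expectation of the indicator of
   [Z n.+1 \in A] given the past up to time [n] is [K (Z n) A]. *)
Record markov_chain (K : S -> set S -> \bar R) (z : S)
    (Pr : probability W R) (Z : nat -> W -> S) : Prop := MarkovChain {
  chain_measurable : forall n, measurable_fun [set: W] (Z n) ;
  chain_start : forall A, measurable A -> Pr (Z 0%N @^-1` A) = \d_z A ;
  chain_step : forall n G A, natural_filtration Z n G -> measurable A ->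
    Pr (G `&` Z n.+1 @^-1` A) = \int[Pr]_(w in G) K (Z n w) A
}.

End markov_chain.

(* Equal to [+oo] when [D] is never reached, since [ereal_inf set0 = +oo]. *)
Definition hitting_time {R : realType} {S : Type} (D : set S) (z : nat -> S) :
  \bar R := ereal_inf [set n%:R%:E | n in [set n | D (z n)]].

(* [inv_pow b k] is [b^(-k)], with [b^(-oo) = +oo]. *)
Definition inv_pow {R : realType} (b : R) (k : \bar R) : \bar R :=
  if k is r%:E then (b `^ (- r))%:E else +oo.

(* Main.v *)
(* The kernel [coupling p Q] has marginals [p], so [|P^n f x - P^n f y|] is at
   most the expectation of [|f x_n - f y_n|] for the coupled chain [(x_n, y_n)].
   (A2) and (A3) provide a bounded function [phi], equal to a suitable profile of
   the distance on [F] and to [1] off [F], which never increases in mean and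
   strictly contracts on [D], the set of pairs of [F] with [L x + L y < R]. (A1)
   and (A4) provide weights [V n] growing at most like [1 + L x + L y] and
   contracting off [D]. The mixture [sqrt (phi (1 + th V n))] then contracts
   everywhere, so that [|P^n f x - P^n f y| <= q^n C (1 + L x + L y)] for every
   bounded Lipschitz [f].

   Consequently the laws [P^n(x, .)] are Cauchy for the Fortet-Mourier metric.
   Completeness makes them tight, which turns the limit of the integrals of
   Lipschitz functions into a Daniell integral, i.e. into a probability measure
   [mu_*]. Infimal convolutions with the distance extend the convergence from
   Lipschitz functions to [C_b]. *)

Require Import Defs.
From HB Require Import structures.
From mathcomp Require Import all_boot all_order all_algebra.
From mathcomp Require Import all_classical all_reals all_analysis.
From mathcomp Require Import measurable_realfun.
From mathcomp Require Import lra ring.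

Import Order.TTheory GRing.Theory Num.Theory.
Import numFieldNormedType.Exports.

Local Open Scope classical_set_scope.
Local Open Scope ring_scope.
Local Open Scope ereal_scope.

Set Implicit Arguments.
Unset Strict Implicit.
Unset Printing Implicit Defensive.

(** The shape of the contraction is forced by what is known on [D]: there [V] equals [1] at every
    index, while its mean after one step is only bounded by a constant [K] above [1]. A sum
    [phi + th V] would therefore fail to contract near the diagonal, where [phi] is small; in a
    product the two factors are estimated separately, and Cauchy-Schwarz pays for this with a square
    root. (A4) controls the hitting time only from the sublevel set [L x + L y < 4c/(1 - lambda)],
    and elsewhere its exponential moment is not known to be finite beforehand. Hence the weights are
    truncated: [V n] allows [n] more steps, is bounded and is defined by recursion on the kernel.
    Its index drops by one at each step of the chain, just as [P^(n+1) f] is reduced to [P^n f].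
    Outside the sublevel set the drift (A1) takes over and keeps [V n] below an affine function of
    [L x + L y]. The final estimate carries the weight [1 + L x + L y]; it becomes useful because
    [L] has moments under [P^n(x, .)] bounded by [L x + c/(1 - lambda)], uniformly in [n]. *)

(** * Integrals against mixtures of measures *)

Section iterated_integral.
Context d d' (S : measurableType d) (T : measurableType d') (R : realType).
Import HBNNSimple.

(** Monotone convergence, applied inside and outside, along a simple approximation of [h]. The point
    is that the right-hand side sees [mu] and [k] only through the numbers [\int[mu]_(x in D) k x
    A]. *)
Lemma iterated_integralE (mu : {measure set S -> \bar R}) (D : set S)
    (k : S -> {measure set T -> \bar R}) (h : T -> \bar R)
    (mD : measurable D)
    (mk : forall A, measurable A -> measurable_fun D (fun x => k x A))
    (mh : measurable_fun [set: T] h) (h0 : forall y, 0 <= h y) :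
  let h_ := nnsfun_approx measurableT mh in
  \int[mu]_(x in D) \int[k x]_y h y =
  limn (fun n => \sum_(r \in range (h_ n))
    (r%:E * \int[mu]_(x in D) k x (h_ n @^-1` [set r]))).
Proof.
move=> h_.
have hE x : \int[k x]_y h y = limn (fun n => \int[k x]_y (h_ n y)%:E).
  rewrite -monotone_convergence//; last 3 first.
  - by move=> n; exact/measurable_EFinP.
  - by move=> n y _; rewrite lee_fin.
  - by move=> y _ a b ab; rewrite lee_fin; exact/lefP/nd_nnsfun_approx.
  by apply: eq_integral => y _; apply/esym/cvg_lim => //; exact: cvg_nnsfun_approx.
have sE n x : \int[k x]_y (h_ n y)%:E =
    \sum_(r \in range (h_ n)) (r%:E * k x (h_ n @^-1` [set r])).
  under eq_integral do rewrite fimfunE -fsumEFin//.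
  rewrite ge0_integral_fsum//; last 2 first.
  - by move=> r; exact/measurable_EFinP/measurableT_comp.
  - by move=> r z _; rewrite EFinM nnfun_muleindic_ge0.
  apply: eq_fsbigr => r _.
  rewrite (integralZl_indic _ (fun r => h_ n @^-1` [set r]))//; last first.
    by move=> r0; rewrite preimage_nnfun0.
  by rewrite integral_indic// setIT.
have mI n : measurable_fun D (fun x => \int[k x]_y (h_ n y)%:E).
  rewrite (_ : (fun x => _) = (fun x => \sum_(r \in range (h_ n))
      (r%:E * k x (h_ n @^-1` [set r])))); last by apply/funext => x; rewrite sE.
  by apply: emeasurable_fsum => // r; apply: measurable_funeM; exact: mk.
transitivity (limn (fun n => \int[mu]_(x in D) \int[k x]_y (h_ n y)%:E)).
  rewrite -monotone_convergence//.
  - by apply: eq_integral => x _; rewrite hE.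
  - by move=> n x _; apply: integral_ge0 => y _; rewrite lee_fin.
  - move=> x _ a b ab; apply: ge0_le_integral => //.
    + by move=> z _; rewrite lee_fin.
    + exact/measurable_EFinP.
    + exact/measurable_EFinP.
    + by move=> z _; rewrite lee_fin; exact/lefP/nd_nnsfun_approx.
congr (limn _); apply/funext => n.
under eq_integral do rewrite sE.
rewrite ge0_integral_fsum//; last 2 first.
- by move=> r; apply: measurable_funeM; exact: mk.
- move=> r x _.
  have [r0|r0] := leP 0%R r; first by rewrite mule_ge0// lee_fin.
  by rewrite preimage_nnfun0// measure0 mule0.
apply: eq_fsbigr => r _.
have [r0|r0] := leP 0%R r; first by rewrite ge0_integralZl//; exact: mk.
rewrite preimage_nnfun0//.
by rewrite !integral0_eq ?mule0// => x _; rewrite measure0 ?mule0.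
Qed.

End iterated_integral.

Section eq_iterated_integral.
Import HBNNSimple.

(** Lets identities known on sets (Markov property, marginals, dual measure) pass to nonnegative
    functions. Taking a family of Dirac masses on one side covers integrals of composed functions as
    well. *)
Lemma eq_iterated_integral d1 d2 d' (S1 : measurableType d1)
    (S2 : measurableType d2) (T : measurableType d') (R : realType)
    (mu1 : {measure set S1 -> \bar R}) (mu2 : {measure set S2 -> \bar R})
    (D1 : set S1) (D2 : set S2)
    (k1 : S1 -> {measure set T -> \bar R}) (k2 : S2 -> {measure set T -> \bar R})
    (h : T -> \bar R) :
  measurable D1 -> measurable D2 ->
  (forall A, measurable A -> measurable_fun D1 (fun x => k1 x A)) ->
  (forall A, measurable A -> measurable_fun D2 (fun x => k2 x A)) ->
  (forall A, measurable A ->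
    \int[mu1]_(x in D1) k1 x A = \int[mu2]_(x in D2) k2 x A) ->
  measurable_fun [set: T] h -> (forall y, 0 <= h y) ->
  \int[mu1]_(x in D1) \int[k1 x]_y h y = \int[mu2]_(x in D2) \int[k2 x]_y h y.
Proof.
move=> mD1 mD2 mk1 mk2 k12 mh h0.
rewrite !(iterated_integralE _ _ _ mh)//; congr (limn _); apply/funext => n.
by apply: eq_fsbigr => r _; rewrite k12.
Qed.

End eq_iterated_integral.

Section disintegration.
Context d d' (S : measurableType d) (T : measurableType d') (R : realType).

(** [nu] is itself the mixture of the [\d_y] under [nu], so this compares two mixtures that agree on
    sets. *)
Lemma integral_mixture (mu : {measure set S -> \bar R}) (D : set S)
    (k : S -> {measure set T -> \bar R}) (nu : {measure set T -> \bar R})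
    (h : T -> \bar R) :
  measurable D ->
  (forall A, measurable A -> measurable_fun D (fun x => k x A)) ->
  (forall A, measurable A -> nu A = \int[mu]_(x in D) k x A) ->
  measurable_fun [set: T] h -> (forall y, 0 <= h y) ->
  \int[nu]_y h y = \int[mu]_(x in D) \int[k x]_y h y.
Proof.
move=> mD mk nuE mh h0.
rewrite -(@eq_iterated_integral _ _ _ T S T R nu mu setT D (fun y => \d_y))//.
- by apply: eq_integral => y _; rewrite integral_dirac// diracE mem_setT mul1e.
- by move=> A mA; exact/measurable_EFinP.
- by move=> A mA; rewrite -nuE// integral_indic// setIT.
Qed.

End disintegration.

(** * Weighted mean inequalities and Cauchy-Schwarz *)

Section real_lemmas.
Variable R : realType.
Local Open Scope ring_scope.

(** The right-hand side is linear in [a] and [b], so it can be integrated before [s] is optimised;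
    this yields Cauchy-Schwarz. *)
Lemma sqrtM_le_mean (a b s : R) : 0 <= a -> 0 <= b -> 0 < s ->
  Num.sqrt (a * b) <= (s * a + b / s) / 2.
Proof.
move=> a0 b0 s0.
have h : 0 <= (s * a + b / s) / 2.
  by rewrite divr_ge0// addr_ge0// ?divr_ge0// ?mulr_ge0 ?(ltW s0).
rewrite -[leRHS]ger0_norm// -sqrtr_sqr ler_sqrt ?sqr_ge0//.
rewrite (_ : a * b = (s * a) * (b / s)); last by field; rewrite gt_eqF.
have : 0 <= (s * a - b / s) ^+ 2 by exact: sqr_ge0.
nra.
Qed.

(** The concave power lies below its tangent at [1]. *)
Lemma powR_tangent (t nu : R) : 0 <= t -> 0 < nu -> nu <= 1 ->
  t `^ nu <= nu * t + (1 - nu).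
Proof.
move=> t0 nu0 nu1.
have [->|tn0] := eqVneq t 0; first by rewrite powR0 ?gt_eqF// mulr0 add0r subr_ge0.
have tp : 0 < t by rewrite lt_neqAle eq_sym tn0.
rewrite /powR (negbTE tn0); set x := ln t.
have -> : t = expR x by rewrite lnK.
(* With [expR (nu * x)] factored out, the bracket is at least [1]: in the combination of the two
   bounds [1 + y <= expR y] with weights [nu] and [1 - nu], the linear terms cancel. *)
have -> : nu * expR x + (1 - nu) =
    expR (nu * x) * (nu * expR ((1 - nu) * x) + (1 - nu) * expR (- (nu * x))).
  have := expRxMexpNx_1 (nu * x).
  have -> : expR x = expR (nu * x) * expR ((1 - nu) * x).
    by rewrite -expRD; congr expR; ring.
  nra.
have ex0 := expR_gt0 (nu * x).
have e1 := expR_ge1Dx ((1 - nu) * x).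
have e2 := expR_ge1Dx (- (nu * x)).
rewrite -[leLHS]mulr1 ler_wpM2l ?expR_ge0//.
nra.
Qed.

End real_lemmas.

Lemma measurable_sqrtr (R : realType) : measurable_fun [set: R] (@Num.sqrt R).
Proof. by apply: continuous_measurable_fun; exact: sqrt_continuous. Qed.

Section cauchy_schwarz.
Context d (T : measurableType d) (R : realType) (mu : {measure set T -> \bar R}).

(** Cauchy-Schwarz in terms of upper bounds [u], [v] of the two integrals. The value [u = 0] has to
    be allowed, since the coupling distance can vanish. *)
Lemma integral_sqrtM_le (f g : T -> R) (u v : R) :
  measurable_fun [set: T] f -> measurable_fun [set: T] g ->
  (forall x, 0 <= f x)%R -> (forall x, 0 <= g x)%R ->
  (0 <= u)%R -> (0 < v)%R ->
  \int[mu]_x (f x)%:E <= u%:E -> \int[mu]_x (g x)%:E <= v%:E ->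
  \int[mu]_x (Num.sqrt (f x * g x))%:E <= (Num.sqrt (u * v))%:E.
Proof.
move=> mf mg f0 g0 u0 v0 fu gv.
have key (s : R) : (0 < s)%R ->
    \int[mu]_x (Num.sqrt (f x * g x))%:E <= ((s * u + v / s) / 2)%:E.
  move=> s0.
  apply: (@le_trans _ _ (\int[mu]_x (((s / 2)%:E * (f x)%:E) + ((s^-1 / 2)%:E * (g x)%:E)))).
    apply: ge0_le_integral => //.
    - apply/measurable_EFinP.
      by apply: measurableT_comp (@measurable_sqrtr R) _; exact: measurable_funM.
    - by apply: emeasurable_funD; apply: measurable_funeM; exact/measurable_EFinP.
    - move=> x _; rewrite -!EFinM -EFinD lee_fin.
      apply: le_trans (sqrtM_le_mean (f0 x) (g0 x) s0) _.
      by rewrite le_eqVlt; apply/orP; left; apply/eqP; field; rewrite gt_eqF.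
  rewrite ge0_integralD//; last 4 first.
  - by move=> x _; rewrite mule_ge0// lee_fin// divr_ge0// ltW.
  - by apply: measurable_funeM; exact/measurable_EFinP.
  - by move=> x _; rewrite mule_ge0// lee_fin// divr_ge0// invr_ge0 ltW.
  - by apply: measurable_funeM; exact/measurable_EFinP.
  rewrite ge0_integralZl//; last 3 first.
  - exact/measurable_EFinP.
  - by move=> x _; rewrite lee_fin.
  - by rewrite lee_fin divr_ge0// ltW.
  rewrite ge0_integralZl//; last 3 first.
  - exact/measurable_EFinP.
  - by move=> x _; rewrite lee_fin.
  - by rewrite lee_fin divr_ge0// invr_ge0 ltW.
  rewrite (_ : ((s * u + v / s) / 2)%R = (s / 2 * u + s^-1 / 2 * v)%R); last first.
    by field; rewrite gt_eqF.
  rewrite EFinD !EFinM; apply: leeD; apply: lee_wpmul2l => //; rewrite lee_fin.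
  - by rewrite divr_ge0// ltW.
  - by rewrite divr_ge0// invr_ge0 ltW.
(* No [s] is optimal when [u = 0]; the choice [s = v / (2 e)] turns the bound into exactly [e]. *)
have [u00|un0] := eqVneq u 0%R.
  rewrite u00 mul0r sqrtr0; apply/lee_addgt0Pr => e e0; rewrite add0e.
  have s0 : (0 < v / (2 * e))%R by rewrite divr_gt0// mulr_gt0.
  apply: le_trans (key _ s0) _; rewrite u00 lee_fin le_eqVlt; apply/orP; left.
  by apply/eqP; field; rewrite !gt_eqF.
have up : (0 < u)%R by rewrite lt_neqAle eq_sym un0.
(* The minimiser of [s u + v / s]. *)
have s0 : (0 < Num.sqrt v / Num.sqrt u)%R by rewrite divr_gt0// sqrtr_gt0.
apply: le_trans (key _ s0) _; rewrite lee_fin le_eqVlt; apply/orP; left.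
have su : (0 < Num.sqrt u)%R by rewrite sqrtr_gt0.
have sv : (0 < Num.sqrt v)%R by rewrite sqrtr_gt0.
rewrite sqrtrM// -{2}(sqr_sqrtr u0) -{2}(sqr_sqrtr (ltW v0)).
by apply/eqP; field; rewrite !gt_eqF.
Qed.

End cauchy_schwarz.

(** * A bounded profile of the distance *)

Section profile.
Variable R : realType.
Local Open Scope ring_scope.
Variables alpha delta l nu : R.
Hypotheses (alpha_gt0 : 0 < alpha) (alpha_lt1 : alpha < 1) (delta_gt0 : 0 < delta)
  (l_gt0 : 0 < l) (nu_gt0 : 0 < nu) (nu_le1 : nu <= 1).

Let pow1 : 1 `^ nu = 1. Proof. by rewrite powR1. Qed.
Let an := alpha `^ nu.
Let an_gt0 : 0 < an. Proof. exact: powR_gt0. Qed.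
Let an_lt1 : an < 1.
Proof.
rewrite -pow1 /an; apply: gt0_ltr_powR => //; rewrite nnegrE//.
exact: ltW.
Qed.

(* [profile] has to contract on two scales. Below [profile_scale] the power
   [(t / scale) ^ nu] wins, since the mass [l t ^ nu] which may be lost is
   smaller than the gain [(1 - alpha ^ nu) (t / scale) ^ nu]. Above it, [1 - profile]
   drops exponentially fast in [t], so that reducing [t] to [alpha t] with
   probability [delta] is enough. *)
Definition profile_scale := ((1 - an) / (2 * l)) `^ nu^-1.
(** Chosen so that [1 - profile_drop] is the value of the power branch at half the scale: the
    exponential branch, never below [1 - profile_drop], can then be the smaller one only beyond
    [profile_scale / 2]. *)
Definition profile_drop := 1 - 2^-1 `^ nu.
(** Makes [delta * expR (profile_rate * (1 - alpha) * t)] at least [2] as soon as [t] exceeds half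
    the scale. *)
Definition profile_rate := 4 / (delta * (1 - alpha) * profile_scale).
Definition profile (t : R) :=
  Num.min ((t / profile_scale) `^ nu) (1 - profile_drop * expR (- (profile_rate * t))).

Local Notation d1 := profile_scale.
Local Notation sg := profile_drop.
Local Notation p := profile_rate.

Lemma profile_scale_gt0 : 0 < d1.
Proof. by rewrite powR_gt0// divr_gt0 ?subr_gt0// mulr_gt0. Qed.

(** The defining property of the scale: the loss [l t ^ nu] is exactly half of the gain
    [(1 - an) (t / d1) ^ nu]. *)
Let d1nu : l * d1 `^ nu = (1 - an) / 2.
Proof.
rewrite /d1 -powRrM mulVf ?gt_eqF// powRr1.
  by field; rewrite gt_eqF.
by rewrite divr_ge0// ?subr_ge0 ?mulr_ge0// ltW.
Qed.

Lemma profile_drop_gt0 : 0 < sg.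
Proof.
rewrite subr_gt0 -[ltRHS]pow1 gt0_ltr_powR//= ?nnegrE//.
by rewrite invf_lt1// ltr1n.
Qed.

Lemma profile_drop_lt1 : sg < 1.
Proof. by rewrite ltrBlDr ltrDl powR_gt0// invr_gt0. Qed.

Lemma profile_rate_gt0 : 0 < p.
Proof. by rewrite divr_gt0// !mulr_gt0// ?subr_gt0// profile_scale_gt0. Qed.

Lemma profile_le1 t : profile t <= 1.
Proof.
by rewrite ge_min lerBlDr lerDl mulr_ge0 ?expR_ge0 ?orbT// ltW// profile_drop_gt0.
Qed.

Let exp_le1 t : 0 <= t -> expR (- (p * t)) <= 1.
Proof. by move=> t0; rewrite expR_le1 oppr_le0 mulr_ge0// ltW// profile_rate_gt0. Qed.

Let drop_le t : 0 <= t -> 1 - sg <= 1 - sg * expR (- (p * t)).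
Proof.
by move=> t0; rewrite lerB// ger_pMr ?profile_drop_gt0// exp_le1.
Qed.

Lemma profile_ge0 t : 0 <= t -> 0 <= profile t.
Proof.
move=> t0; rewrite le_min powR_ge0/=; apply: le_trans (drop_le t0).
by rewrite subr_ge0 ltW// profile_drop_lt1.
Qed.

(** [Num.min 2 t] bounds the oscillation, at distance [t], of a 1-Lipschitz function with values in
    [[-1, 1]]. Below the scale [nu <= 1] makes the power dominate [t / d1]; elsewhere both branches
    stay away from [0]. *)
Lemma profile_ge_min : exists2 k : R, 0 < k &
  forall t, 0 <= t -> Num.min 2 t <= k * profile t.
Proof.
have d0 := profile_scale_gt0; have s1 := profile_drop_lt1.
have s1' : 0 < 1 - sg by rewrite subr_gt0.
have s1'' : (1 - sg)^-1 * (1 - sg) = 1 by rewrite mulVf ?gt_eqF.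
have i0 : 0 < (1 - sg)^-1 by rewrite invr_gt0.
exists (d1 + 2 + 2 / (1 - sg)) => [|t t0]; first by rewrite !addr_gt0 ?divr_gt0.
have k0 : 0 <= d1 + 2 + 2 / (1 - sg) by rewrite !addr_ge0 ?divr_ge0 ?ltW.
rewrite /profile minr_pMr// le_min; apply/andP; split; last first.
  apply: (@le_trans _ _ 2); first by rewrite ge_min lexx.
  apply: le_trans (ler_wpM2l k0 (drop_le t0)); nra.
have [td|td] := leP t d1.
  apply: (@le_trans _ _ t); first by rewrite ge_min lexx orbT.
  have [->|tn0] := eqVneq t 0; first by rewrite mulr_ge0 ?powR_ge0.
  have tp : 0 < t by rewrite lt_neqAle eq_sym tn0.
  have h : t / d1 <= (t / d1) `^ nu.
    by apply: ger1_powR => //; rewrite divr_gt0//= ler_pdivrMr// mul1r.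
  have -> : t = d1 * (t / d1) by rewrite mulrC divfK// gt_eqF.
  apply: ler_pM => //; [exact: ltW|by rewrite divr_ge0// ltW| |].
    by rewrite -addrA lerDl addr_ge0// divr_ge0// ltW.
  by rewrite (_ : d1 * (t / d1) = t) ?(mulrC d1) ?divfK ?gt_eqF.
apply: (@le_trans _ _ 2); first by rewrite ge_min lexx.
have h : 1 <= (t / d1) `^ nu.
  rewrite -pow1 ge0_ler_powR// ?nnegrE//; first exact: ltW.
    by rewrite divr_ge0// ltW.
  by rewrite ler_pdivlMr// mul1r ltW.
nra.
Qed.

(** [m] stands for the mean of the profile after one step. Each branch of the minimum uses its own
    bound on [m]. The gain of the exponential branch fades as [t] grows, so a uniform [eps] exists
    only for [t <= d0]. *)
Lemma profile_contract (d0 : R) : exists2 eps : R, 0 < eps < 1 &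
  forall (t m : R), 0 <= t ->
    m <= (alpha * t / d1) `^ nu + l * t `^ nu ->
    m <= 1 - delta * (sg * expR (- (p * (alpha * t)))) ->
    m <= profile t /\ (t <= d0 -> m <= (1 - eps) * profile t).
Proof.
have dp := profile_scale_gt0; have sp := profile_drop_gt0.
have s1 := profile_drop_lt1; have pp := profile_rate_gt0.
pose e0 := sg * expR (- (p * Num.max d0 0)).
have e00 : 0 < e0 by rewrite mulr_gt0 ?expR_gt0.
pose eps := Num.min ((1 - an) / 2) e0.
have eps0 : 0 < eps by rewrite lt_min e00 divr_gt0// subr_gt0.
have epsa : eps <= (1 - an) / 2 by rewrite ge_min lexx.
have epse : eps <= e0 by rewrite ge_min lexx orbT.
exists eps => [|t m t0 m1 m2]; first by rewrite eps0 /=; have := an_gt0; lra.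
pose h := sg * expR (- (p * t)).
have [g1|g2] := leP ((t / d1) `^ nu) (1 - h).
  have -> : profile t = (t / d1) `^ nu by apply/min_idPl.
  have tE : t `^ nu = (t / d1) `^ nu * d1 `^ nu.
    by rewrite -powRM ?divfK ?gt_eqF// ?divr_ge0// ltW.
  have {}m1 : m <= ((1 + an) / 2) * (t / d1) `^ nu.
    apply: le_trans m1 _; rewrite -mulrA powRM ?divr_ge0//; [|exact: ltW..].
    rewrite tE (mulrCA l) d1nu -/an. have := powR_ge0 (t / d1) nu; nra.
  have := powR_ge0 (t / d1) nu; have := an_lt1.
  by split => [|_]; nra.
have -> : profile t = 1 - h by apply/min_idPr; exact: ltW.
have h0 : 0 <= h by rewrite mulr_ge0 ?expR_ge0// ltW.
(* Otherwise the power is at most [2^-1 ^ nu = 1 - sg], hence at most [1 - h], against [g2]. *)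
have t2 : d1 / 2 < t.
  rewrite ltNge; apply/negP => t2; move: g2; rewrite ltNge => /negP; apply.
  apply: le_trans (drop_le t0); rewrite opprB addrCA subrr addr0.
  apply: ge0_ler_powR; rewrite ?nnegrE ?invr_ge0 ?divr_ge0//; [exact: ltW..|].
  by rewrite ler_pdivrMr// mulrC.
have m3 : m <= 1 - 2 * h.
  apply: le_trans m2 _; rewrite lerB//.
  have -> : - (p * (alpha * t)) = - (p * t) + p * (1 - alpha) * t by ring.
  rewrite expRD.
  (* Moving from [t] to [alpha * t] with weight [delta] at least doubles the drop [h] below [1]. *)
  have e1 : 2 <= delta * expR (p * (1 - alpha) * t).
    have /(ler_wpM2l (ltW delta_gt0)) := expR_ge1Dx (p * (1 - alpha) * t).
    apply: le_trans; rewrite mulrDr mulr1.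
    have -> : delta * (p * (1 - alpha) * t) = 4 * (t / d1).
      rewrite /p; field; rewrite !gt_eqF// subr_gt0//.
    have : 2^-1 < t / d1 by rewrite ltr_pdivlMr// mulrC.
    by move: delta_gt0; lra.
  rewrite (_ : delta * _ = h * (delta * expR (p * (1 - alpha) * t))); last first.
    by rewrite /h; ring.
  by rewrite mulrC ler_wpM2l.
split => [|td]; first by lra.
have eh : e0 <= h.
  rewrite ler_pM2l// ler_expR lerN2 ler_pM2l// le_max td//.
by nra.
Qed.

End profile.

(** Jensen's inequality for a subprobability: integrate the tangent to the power at a positive bound
    [w] of the mean, the total mass at most [1] absorbing the constant term. *)
Lemma integral_powR_le d (T : measurableType d) (R : realType)
    (mu : {measure set T -> \bar R}) (f : T -> R) (u nu : R) :
  mu setT <= 1 -> measurable_fun [set: T] f -> (forall x, 0 <= f x)%R ->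
  (0 < nu)%R -> (nu <= 1)%R -> (0 <= u)%R ->
  \int[mu]_x (f x)%:E <= u%:E -> \int[mu]_x (f x `^ nu)%:E <= (u `^ nu)%:E.
Proof.
move=> mu1 mf f0 nu0 nu1.
have main (w : R) : (0 < w)%R -> \int[mu]_x (f x)%:E <= w%:E ->
    \int[mu]_x (f x `^ nu)%:E <= (w `^ nu)%:E.
  move=> w0 fw.
  have c0 : (0 <= w `^ nu)%R by exact: powR_ge0.
  have a0 : (0 <= w `^ nu * nu / w)%R by rewrite divr_ge0 ?mulr_ge0// ltW.
  have b0 : (0 <= w `^ nu * (1 - nu))%R by rewrite mulr_ge0// subr_ge0.
  apply: (@le_trans _ _ (\int[mu]_x ((w `^ nu * nu / w)%:E * (f x)%:E +
      (cst (w `^ nu * (1 - nu))%:E x)))).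
    apply: ge0_le_integral => //.
    - by move=> x _; rewrite lee_fin powR_ge0.
    - apply/measurable_EFinP; exact: (measurableT_comp (measurable_powR nu) mf).
    - apply: emeasurable_funD => //.
      by apply: measurable_funeM; exact/measurable_EFinP.
    - move=> x _; rewrite -EFinM -EFinD lee_fin.
      have -> : f x = (w * (f x / w))%R by rewrite mulrC divfK// gt_eqF.
      rewrite powRM ?divr_ge0//; [|exact: ltW..].
      apply: le_trans (ler_wpM2l c0 (powR_tangent _ nu0 nu1)) _.
        by rewrite divr_ge0// ltW.
      by rewrite le_eqVlt; apply/orP; left; apply/eqP; field; rewrite gt_eqF.
  rewrite ge0_integralD//; last 2 first.
  - by move=> x _; rewrite mule_ge0// lee_fin.
  - by apply: measurable_funeM; exact/measurable_EFinP.
  rewrite ge0_integralZl//; last 2 first.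
  - exact/measurable_EFinP.
  - by move=> x _; rewrite lee_fin.
  rewrite integral_cst//.
  apply: (@le_trans _ _ ((w `^ nu * nu / w)%:E * w%:E + (w `^ nu * (1 - nu))%:E * 1)).
    by apply: leeD; apply: lee_wpmul2l => //; rewrite lee_fin.
  rewrite mule1 -EFinM -EFinD lee_fin le_eqVlt; apply/orP; left.
  by apply/eqP; field; rewrite gt_eqF.
move=> u0 fu; have [u00|un0] := eqVneq u 0%R; last first.
  by apply: main => //; rewrite lt_neqAle eq_sym un0.
(* There is no tangent at [0], so the bound is approached with [w = eps ^ (1 / nu)]. *)
rewrite u00 powR0 ?gt_eqF//; apply/lee_addgt0Pr => eps e0; rewrite add0e.
have := main (eps `^ nu^-1)%R; rewrite -powRrM mulVf ?gt_eqF// powRr1 ?(ltW e0)//.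
apply; first by rewrite powR_gt0.
by apply: le_trans fu _; rewrite u00 lee_fin powR_ge0.
Qed.

(** * Mean contraction of the coupling distance and of its weighted versions *)

Section contraction.
Context d (S : measurableType d) (R : realType).
Variables (B Q : S -> {measure set S -> \bar R}).
Hypothesis B1 : forall z, B z setT = 1.
Hypothesis QB : forall z A, measurable A -> Q z A <= B z A.
Variables (F : set S) (e : S -> R).
Hypotheses (mF : measurable F) (me : measurable_fun [set: S] e).
Hypothesis e0 : forall z, (0 <= e z)%R.
Variables (alpha delta l nu : R).
Hypotheses (alpha_gt0 : (0 < alpha)%R) (alpha_lt1 : (alpha < 1)%R)
  (delta_gt0 : (0 < delta)%R) (l_gt0 : (0 < l)%R)
  (nu_gt0 : (0 < nu)%R) (nu_le1 : (nu <= 1)%R).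
Hypothesis Q_support : forall z, F z -> Q z (~` F) = 0.
Hypothesis Q_contract : forall z, F z -> \int[Q z]_u (e u)%:E <= (alpha * e z)%:E.
Hypothesis Q_mass : forall z, F z -> 1 - Q z setT <= (l * e z `^ nu)%:E.
Hypothesis Q_close : forall z, F z ->
  delta%:E <= Q z [set u | (e u <= alpha * e z)%R].

Local Notation prof := (profile alpha delta l nu).
Local Notation d1 := (profile_scale alpha l nu).
Local Notation sg := (profile_drop nu).
Local Notation p := (profile_rate alpha delta l nu).

(** [1] is the upper bound of the profile: off [F], where nothing is assumed, the mean cannot
    increase, and mass of [B] not carried by [Q] costs at most its own size. *)
Definition coupling_distance (z : S) : R := if z \in F then prof (e z) else 1%R.
Local Notation phi := coupling_distance.

Lemma measurable_profile : measurable_fun [set: R] prof.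
Proof.
apply: measurable_minr.
  apply: (measurableT_comp (measurable_powR nu)); exact: measurable_funM.
apply: measurable_funB => //; apply: measurable_funM => //.
apply: (measurableT_comp (@measurable_expR R)); apply: measurableT_comp => //.
Qed.

Lemma measurable_coupling_distance : measurable_fun [set: S] phi.
Proof.
apply: measurable_fun_ifT => //.
- by apply: (measurable_fun_bool true); rewrite setTI;
    rewrite (_ : _ @^-1` _ = F)//; apply/seteqP; split => z /=; [exact: set_mem|exact: mem_set].
- exact: (measurableT_comp measurable_profile).
Qed.

Lemma coupling_distance_ge0 z : (0 <= phi z)%R.
Proof. by rewrite /phi; case: ifPn => // _; exact: profile_ge0. Qed.

Lemma coupling_distance_le1 z : (phi z <= 1)%R.
Proof. by rewrite /phi; case: ifPn => // _; exact: profile_le1. Qed.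

Lemma coupling_distance_ge_min : exists2 k : R, (0 < k)%R &
  forall z, (Num.min 2 (e z) <= k * phi z)%R.
Proof.
have [k k0 kP] := @profile_ge_min R alpha delta l nu alpha_gt0 alpha_lt1 delta_gt0
  l_gt0 nu_gt0 nu_le1.
exists (k + 2)%R => [|z]; first by rewrite addr_gt0.
have phi0 := coupling_distance_ge0 z; move: phi0; rewrite /phi.
case: ifPn => _ phi0; last by rewrite ge_min mulr1 lerDr ltW.
by apply: le_trans (kP _ (e0 z)) _; rewrite ler_wpM2r// lerDl.
Qed.

Let mphiE : measurable_fun [set: S] (fun z => (phi z)%:E).
Proof. exact/measurable_EFinP/measurable_coupling_distance. Qed.

Let int_le1 z (f : S -> \bar R) : measurable_fun [set: S] f ->
  (forall u, 0 <= f u) -> (forall u, f u <= 1) -> \int[B z]_u f u <= 1.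
Proof.
move=> mf f0 f1; rewrite -[leRHS](B1 z) -[leRHS]mul1e -(integral_cst (B z) measurableT 1).
by apply: ge0_le_integral.
Qed.

(** [B z] is [Q z] plus a measure of mass [1 - Q z setT], on which [phi <= 1]. *)
Lemma integral_le_sub z : \int[B z]_u (phi u)%:E <=
  \int[Q z]_u (phi u)%:E + (1 - Q z setT).
Proof.
have [|m mE] := @measure_difference R _ S (B z) (Q z) (QB z).
  by rewrite B1 ltry.
have Qfin A : measurable A -> Q z A \is a fin_num.
  move=> mA; rewrite ge0_fin_numE//; apply: le_lt_trans (QB z mA) _.
  apply: le_lt_trans (ltry 1); rewrite -(B1 z).
  by apply: le_measure; rewrite ?inE.
rewrite (eq_measure_integral (measure_add (Q z) m)); last first.
  move=> A mA _; apply: etrans (esym (measure_addE (Q z) m A)).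
  by rewrite mE// addeC subeK//; exact: Qfin.
rewrite ge0_integral_measure_add//; last first.
  by move=> u _; rewrite lee_fin coupling_distance_ge0.
rewrite leeD2l// -(B1 z) -mE// -[leRHS]mul1e -(integral_cst m measurableT 1).
apply: ge0_le_integral => //.
- by move=> u _; rewrite lee_fin coupling_distance_ge0.
- by move=> u _; rewrite lee_fin coupling_distance_le1.
Qed.

(** Since [Q z] does not charge the complement of [F], [phi] is almost everywhere below the power
    branch; Jensen and the mean contraction of [e] conclude, up to the lost mass. *)
Lemma coupling_distance_scale z : F z -> \int[B z]_u (phi u)%:E <=
  ((alpha * e z / d1) `^ nu + l * e z `^ nu)%:E.
Proof.
move=> Fz; apply: le_trans (integral_le_sub z) _.
rewrite EFinD; apply: leeD; last exact: Q_mass.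
have d0 : (0 < d1)%R by exact: profile_scale_gt0.
apply: (@le_trans _ _ (\int[Q z]_u ((e u / d1) `^ nu)%:E)).
  apply: ae_ge0_le_integral => //.
  - by move=> u _; rewrite lee_fin coupling_distance_ge0.
  - by move=> u _; rewrite lee_fin powR_ge0.
  - apply/measurable_EFinP; apply: (measurableT_comp (measurable_powR nu)).
    exact: measurable_funM.
  - exists (~` F); split; [exact: measurableC|exact: Q_support|].
    move=> u /= /not_implyP[_ h] Fu; apply: h; rewrite lee_fin /phi mem_set//.
    by rewrite ge_min lexx.
apply: integral_powR_le => //.
- by rewrite -(B1 z); exact: QB.
- exact: measurable_funM.
- by move=> u; rewrite divr_ge0// ltW.
- by rewrite divr_ge0 ?mulr_ge0// ltW.
under eq_integral do rewrite mulrC EFinM.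
rewrite ge0_integralZl//; last 3 first.
- exact/measurable_EFinP.
- by move=> u _; rewrite lee_fin.
- by rewrite lee_fin invr_ge0 ltW.
rewrite mulrC EFinM; apply: lee_wpmul2l; last exact: Q_contract.
by rewrite lee_fin invr_ge0 ltW.
Qed.

(** On the set [G] of close pairs in [F], of mass at least [delta], the exponential branch puts
    [phi] below [1 - h]; elsewhere [phi <= 1]. *)
Lemma coupling_distance_close z : F z -> \int[B z]_u (phi u)%:E <=
  (1 - delta * (sg * expR (- (p * (alpha * e z)))))%:E.
Proof.
move=> Fz; set h := (sg * _)%R.
have sg0 : (0 < sg)%R by exact: profile_drop_gt0.
have p0 : (0 < p)%R by exact: profile_rate_gt0.
have h0 : (0 <= h)%R by rewrite mulr_ge0 ?expR_ge0// ltW.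
pose G := F `&` [set u | (e u <= alpha * e z)%R].
have mE : measurable [set u | (e u <= alpha * e z)%R].
  by rewrite -[X in measurable X]setTI; exact: measurable_fun_le.
have mG : measurable G by exact: measurableI.
have BG : delta%:E <= B z G.
  apply: le_trans (QB z mG); apply: le_trans (Q_close Fz) _.
  apply: (@le_trans _ _ (Q z (G `|` ~` F))).
    apply: le_measure; rewrite ?inE//; first by apply: measurableU => //; exact: measurableC.
    by move=> u /= ue; have [Fu|nFu] := pselect (F u); [left|right].
  rewrite -[leRHS]adde0 -(Q_support Fz); apply: measureU2 => //.
  exact: measurableC.
have key : \int[B z]_u (phi u)%:E + h%:E * B z G <= 1.
  rewrite -(setIT G) -integral_indic// -ge0_integralZl//; last exact/measurable_EFinP.
  rewrite -ge0_integralD//; last 3 first.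
  - by move=> u _; rewrite lee_fin coupling_distance_ge0.
  - by move=> u _; rewrite mule_ge0// lee_fin.
  - by apply: measurable_funeM; exact/measurable_EFinP.
  apply: int_le1.
  - apply: emeasurable_funD => //.
    by apply: measurable_funeM; exact/measurable_EFinP.
  - by move=> u; rewrite adde_ge0// ?mule_ge0// lee_fin// coupling_distance_ge0.
  - move=> u; rewrite -EFinM -EFinD lee_fin indicE.
    have [|] := boolP (u \in G); rewrite ?mulr1 ?mulr0 ?addr0; last first.
      by move=> _; exact: coupling_distance_le1.
    rewrite inE => -[Fu /= ue]; rewrite /phi mem_set//.
    apply: (@le_trans _ _ ((1 - sg * expR (- (p * e u))) + h)%R).
      by rewrite lerD2r ge_min lexx orbT.
    rewrite -addrA gerDl addrC subr_le0 ler_pM2l// ler_expR lerN2.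
    by rewrite ler_pM2l.
rewrite EFinB EFinM muleC leeBrDr//.
by apply: le_trans key; rewrite leeD2l// lee_wpmul2l// lee_fin.
Qed.

Variables (D : set S) (d0 : R).
Hypotheses (DF : D `<=` F) (De : forall z, D z -> (e z <= d0)%R).

Lemma coupling_distance_contract : exists2 eps : R, (0 < eps < 1)%R &
  forall z, \int[B z]_u (phi u)%:E <= (phi z)%:E /\
    (D z -> \int[B z]_u (phi u)%:E <= ((1 - eps) * phi z)%:E).
Proof.
have [eps epsP H] := profile_contract alpha_gt0 alpha_lt1 delta_gt0 l_gt0 nu_gt0 d0.
exists eps => // z.
have I1 : \int[B z]_u (phi u)%:E <= 1.
  apply: int_le1 => // u; rewrite lee_fin.
    exact: coupling_distance_ge0.
  exact: coupling_distance_le1.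
have [Fz|nFz] := pselect (F z); last first.
  have -> : phi z = 1%R by rewrite /phi memNset.
  by split => // /DF.
have -> : phi z = prof (e z) by rewrite /phi mem_set.
have Ifin : \int[B z]_u (phi u)%:E \is a fin_num.
  rewrite ge0_fin_numE; first exact: le_lt_trans (ltry 1).
  by apply: integral_ge0 => u _; rewrite lee_fin coupling_distance_ge0.
have := coupling_distance_scale Fz; have := coupling_distance_close Fz.
move: Ifin I1; case: (\int[B z]_u (phi u)%:E) => // m _ _.
rewrite !lee_fin => m2 m1.
have [h1 h2] := H (e z) m (e0 z) m1 m2.
by split => // Dz; apply: h2; exact: De.
Qed.

(* [ell n] is [sqrt (phi (1 + th V n))]. By Cauchy-Schwarz its expectation is at
   most [sqrt (B phi (1 + th B (V n)))]; on [D] the first factor contracts and a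
   small [th] makes the second one harmless, off [D] the second one contracts
   as soon as it is compared with [V (n + 1)]. *)
Lemma exists_lyapunov (rho K : R) : (0 < rho)%R -> (rho < 1)%R -> (0 < K)%R ->
  exists q k : R, [/\ (0 < q)%R, (q < 1)%R, (0 < k)%R &
    forall V : nat -> S -> R,
    (forall n, measurable_fun [set: S] (V n)) ->
    (forall n z, 1 <= V n z)%R ->
    (forall n z, ~ D z -> \int[B z]_u (V n u)%:E <= (rho * V n.+1 z)%:E) ->
    (forall n z, D z -> \int[B z]_u (V n u)%:E <= K%:E) ->
    exists ell : nat -> S -> R,
    [/\ forall n, measurable_fun [set: S] (ell n),
       forall n z, (0 <= ell n z)%R,
       forall n z, (Num.min 2 (e z) <= k * ell n z)%R,
       forall n z, (ell n z <= k * V n z)%R &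
       forall n z, \int[B z]_u (ell n u)%:E <= (q * ell n.+1 z)%:E]].
Proof.
move=> rho0 rho1 K0.
have [eps /andP[eps0 eps1] phiP] := coupling_distance_contract.
have [k1 k10 k1P] := coupling_distance_ge_min.
(* On [D] the product of the two factors becomes [(1 - eps) (1 + eps / 2)], at most
   [1 - eps / 2]. *)
pose th : R := (eps / (2 * K))%R.
have th0 : (0 < th)%R by rewrite divr_gt0// mulr_gt0.
have thK : (th * K = eps / 2)%R by rewrite /th; field; rewrite gt_eqF.
(* Off [D], [1 + th rho v] has to be compared with [1 + th v]; for [v >= 1] the ratio is largest at
   [v = 1], where it is [r]. *)
pose r := ((1 + th * rho) / (1 + th))%R.
have r0 : (0 < r)%R by rewrite divr_gt0// addr_gt0// mulr_gt0.
have r1 : (r < 1)%R.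
  by rewrite ltr_pdivrMr ?addr_gt0// mul1r ltrD2l gtr_pMr.
have rE : (r * (1 + th) = 1 + th * rho)%R by rewrite divfK// gt_eqF// addr_gt0.
pose q2 := Num.max (1 - eps / 2)%R r.
have q20 : (0 < q2)%R by rewrite lt_max r0 orbT.
have q21 : (q2 < 1)%R by rewrite gt_max r1 andbT; lra.
have q2e : (1 - eps / 2 <= q2)%R by rewrite le_max lexx.
have q2r : (r <= q2)%R by rewrite le_max lexx orbT.
exists (Num.sqrt q2), (k1 + 1 + th)%R; split.
- by rewrite sqrtr_gt0.
- by rewrite -sqrtr1 ltr_sqrt.
- by rewrite !addr_gt0.
move=> V mV V1 VnD VD.
pose W n z := (1 + th * V n z)%R.
have mW n : measurable_fun [set: S] (W n).
  by apply: measurable_funD => //; exact: measurable_funM.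
have W1 n z : (1 <= W n z)%R.
  by rewrite lerDl mulr_ge0// ?(ltW th0)// (le_trans ler01).
have W0 n z : (0 < W n z)%R by exact: lt_le_trans (W1 n z).
have phi0 := coupling_distance_ge0.
have phi1 := coupling_distance_le1.
have IW n z (v : R) : \int[B z]_u (V n u)%:E <= v%:E ->
    \int[B z]_u (W n u)%:E <= (1 + th * v)%:E.
  move=> Iv.
  under eq_integral do rewrite /W EFinD EFinM.
  have V0 u : 0 <= (V n u)%:E by rewrite lee_fin (le_trans ler01).
  rewrite ge0_integralD//; last 2 first.
  - by move=> u _; rewrite mule_ge0// lee_fin ltW.
  - by apply: measurable_funeM; exact/measurable_EFinP.
  rewrite (integral_cst (B z) measurableT 1) B1 mule1 EFinD leeD2l//.
  rewrite ge0_integralZl//; last 2 first.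
  - exact/measurable_EFinP.
  - by rewrite lee_fin ltW.
  by rewrite (EFinM th v); apply: lee_wpmul2l => //; rewrite lee_fin ltW.
exists (fun n z => Num.sqrt (phi z * W n z)); split.
- move=> n; apply: measurableT_comp (@measurable_sqrtr R) _.
  by apply: measurable_funM => //; exact: measurable_coupling_distance.
- by move=> n z; exact: sqrtr_ge0.
(* [phi <= 1 <= W] gives [phi ^ 2 <= phi W], so the square root only enlarges [phi]. *)
- move=> n z; apply: le_trans (k1P z) _; apply: ler_pM => //; first exact: ltW.
    by rewrite -addrA lerDl addr_ge0// ltW.
  rewrite -[leLHS]ger0_norm// -sqrtr_sqr ler_wsqrtr// expr2 ler_wpM2l//.
  exact: le_trans (W1 n z).
- move=> n z; apply: (@le_trans _ _ (W n z)).
    rewrite -[leRHS](ger0_norm (ltW (W0 n z))) -sqrtr_sqr ler_wsqrtr//.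
    by rewrite expr2 ler_wpM2r ?(ltW (W0 n z))// (le_trans _ (W1 n z)).
  rewrite /W; have := V1 n z; move: k10; nra.
move=> n z.
suff [a [b [a0 b0 ab Ia Ib]]] : exists a b : R, [/\ (0 <= a)%R, (0 < b)%R,
    (a * b <= q2)%R, \int[B z]_u (phi u)%:E <= (a * phi z)%:E &
    \int[B z]_u (W n u)%:E <= (b * W n.+1 z)%:E].
  apply: le_trans (integral_sqrtM_le _ _ _ _ _ _ Ia Ib) _ => //.
  - exact: measurable_coupling_distance.
  - by move=> u; exact: ltW.
  - exact: mulr_ge0.
  - exact: mulr_gt0.
  rewrite lee_fin -sqrtrM ?(ltW q20)// ler_wsqrtr//.
  rewrite mulrACA ler_wpM2r// mulr_ge0//; exact: ltW.
have [Dz|nDz] := pselect (D z).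
  exists (1 - eps)%R, (1 + th * K)%R; split.
  - by rewrite subr_ge0 ltW.
  - by rewrite addr_gt0// mulr_gt0.
  - apply: le_trans q2e; rewrite thK; nra.
  - exact: (phiP z).2.
  - apply: le_trans (IW _ _ _ (VD _ _ Dz)) _; rewrite lee_fin ler_peMr//.
    by rewrite addr_ge0// mulr_ge0// ltW.
exists 1%R, r; split => //.
- by rewrite mul1r.
- by rewrite mul1r; exact: (phiP z).1.
- apply: le_trans (IW _ _ _ (VnD _ _ nDz)) _; rewrite lee_fin.
  have := V1 n.+1 z; rewrite /W; set v := V n.+1 z => v1.
  have : (1 + th * (rho * v) <= r * (1 + th) + r * th * (v - 1))%R.
    rewrite rE -/v.
    have : (rho <= r)%R.
      by rewrite ler_pdivlMr ?addr_gt0// mulrDr mulr1 (mulrC rho) lerD2r ltW.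
    by move: th0 rho0 => ? ? ?; nra.
  nra.
Qed.

End contraction.

(** * Truncated exponential moments of the hitting time *)

Section hitting.
Context d (S : measurableType d) (R : realType) dW (W : measurableType dW).
Variables (B : R.-pker S ~> S) (K : S -> set S -> \bar R).
Hypothesis KB : forall z A, measurable A -> K z A = B z A.
Variables (Pr : S -> probability W R) (Z : nat -> W -> S).
Hypothesis chainZ : forall z, markov_chain K z (Pr z) Z.
Variables (D : set S) (rho : R).
Hypotheses (mD : measurable D) (rho0 : (0 < rho)%R) (rho1 : (rho < 1)%R).

(* The expectation of [rho ^- min(kappa, m)] for the chain started at [z], where
   [kappa] is the hitting time of [D]. *)
Fixpoint hitting_weight (m : nat) (z : S) : R :=
  if m is m'.+1 then
    if z \in D then 1%R else (rho^-1 * fine (\int[B z]_u (hitting_weight m' u)%:E))%R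
  else 1%R.
Local Notation V := hitting_weight.

Let i1 : (1 <= rho^-1)%R. Proof. by rewrite invf_ge1// ltW. Qed.

Let mmemD : measurable_fun [set: S] (fun z => z \in D).
Proof.
apply: (measurable_fun_bool true); rewrite setTI (_ : _ @^-1` _ = D)//.
by apply/seteqP; split => z /=; [exact: set_mem|exact: mem_set].
Qed.

(** The crude upper bound keeps every integral finite, so that [fine] in the recursion loses
    nothing. Measurability and bounds feed each other and are proved in one induction. *)
Lemma measurable_hitting_weight m : measurable_fun [set: S] (V m) /\
  forall z, (1 <= V m z <= rho^-1 ^+ m)%R.
Proof.
elim: m => [|m [mV Vb]]; first by split => [|z] /=; [exact: measurable_cst|rewrite lexx].
have V0 z : 0 <= (V m z)%:E.
  by rewrite lee_fin; case/andP : (Vb z) => /(le_trans ler01).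
have mVE : measurable_fun [set: S] (fun z => (V m z)%:E) by exact/measurable_EFinP.
have ge1 z : 1 <= \int[B z]_u (V m u)%:E.
  rewrite -[leLHS](@prob_kernel _ _ _ _ _ B z) -[leLHS]mul1e.
  rewrite -(integral_cst (B z) measurableT 1); apply: ge0_le_integral => //.
  by move=> u _; rewrite lee_fin; case/andP : (Vb u).
have le_pow z : \int[B z]_u (V m u)%:E <= (rho^-1 ^+ m)%:E.
  rewrite -[leRHS]mule1 -(@prob_kernel _ _ _ _ _ B z).
  rewrite -(integral_cst (B z) measurableT); apply: ge0_le_integral => //.
  by move=> u _; rewrite lee_fin; case/andP : (Vb u).
split.
  apply: measurable_fun_ifT => //; apply: measurable_funM => //.
  apply: measurableT_comp => //.
  by apply: measurable_fun_integral_kernel => //; exact: measurable_kernel.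
move=> z /=; case: ifPn => _; first by rewrite lexx exprn_ege1.
have := ge1 z; have := le_pow z.
have : 0 <= \int[B z]_u (V m u)%:E by exact: integral_ge0.
case: (\int[B z]_u (V m u)%:E) => // v; rewrite !lee_fin => v0 v2 v1 /=.
rewrite exprS ler_wpM2l ?(le_trans ler01)// andbT.
by rewrite -[leLHS]mulr1 ler_pM.
Qed.

Let mV m : measurable_fun [set: S] (V m). Proof. exact: (measurable_hitting_weight m).1. Qed.
Let mVE m : measurable_fun [set: S] (fun z => (V m z)%:E).
Proof. exact/measurable_EFinP. Qed.

Lemma hitting_weight_ge1 m z : (1 <= V m z)%R.
Proof. by case/andP : ((measurable_hitting_weight m).2 z). Qed.

Let V0 m z : 0 <= (V m z)%:E.
Proof. by rewrite lee_fin (le_trans ler01)// hitting_weight_ge1. Qed.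

Let intV_fin m z : \int[B z]_u (V m u)%:E \is a fin_num.
Proof.
rewrite ge0_fin_numE; last by apply: integral_ge0.
apply: (@le_lt_trans _ _ (rho^-1 ^+ m)%:E); last exact: ltry.
rewrite -[leRHS]mule1 -(@prob_kernel _ _ _ _ _ B z).
rewrite -(integral_cst (B z) measurableT); apply: ge0_le_integral => //.
by move=> u _; rewrite lee_fin; case/andP : ((measurable_hitting_weight m).2 u).
Qed.

Lemma hitting_weight_step m z : ~ D z ->
  \int[B z]_u (V m u)%:E = (rho * V m.+1 z)%:E.
Proof.
by move=> nDz; rewrite /= memNset// mulrA divff ?gt_eqF// mul1r fineK.
Qed.

Fixpoint not_hit (j : nat) : set W :=
  if j is i.+1 then not_hit i `&` ~` (Z i @^-1` D) else setT.

Lemma not_hitP j w : not_hit j w <-> forall i, (i < j)%N -> ~ D (Z i w).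
Proof.
elim: j => [|j IH] /=; first by split.
split => [[/IH h nD] i|h]; first by rewrite ltnS leq_eqVlt => /predU1P[->|/h].
by split; [apply/IH => i ij; apply: h; exact: ltnW|exact: (h j)].
Qed.

(** [not_hit j] looks only at the times before [j], so index [n.+1] is still decided at time [n]. *)
Lemma natural_filtration_not_hit n j : (j <= n.+1)%N ->
  natural_filtration Z n (not_hit j).
Proof.
rewrite /natural_filtration; set G := [set _ | _].
elim: j => [_|j IH jn] /=; first exact: (@measurableT _ (g_sigma_algebraType G)).
apply: (@measurableI _ (g_sigma_algebraType G)); first by apply: IH; exact: ltnW.
apply: (@measurableC _ (g_sigma_algebraType G)).
by apply: sub_sigma_algebra; exists j, D.
Qed.

Variable z : S.
Local Notation P := (Pr z).

Let mZ n : measurable_fun [set: W] (Z n). Proof. exact: chain_measurable (chainZ z) n. Qed.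

Let mZD n : measurable (Z n @^-1` D).
Proof. by rewrite -[X in measurable X]setTI; exact: mZ. Qed.

Lemma measurable_not_hit j : measurable (not_hit j).
Proof.
by elim: j => //= j IH; apply: measurableI => //; exact: measurableC.
Qed.

Let dirac_kernel_measurable n (G : set W) A : measurable A ->
  measurable_fun G (fun w => \d_(Z n w) A : \bar R).
Proof.
move=> mA; apply: (@measurable_funS _ _ _ _ setT) => //.
have mh : measurable_fun [set: S] (fun x : S => \d_x A : \bar R) by exact/measurable_EFinP.
exact: measurableT_comp mh (mZ n).
Qed.

(** The Markov property for functions: [chain_step] is the case of indicators, and [h (Z n.+1 w)] is
    the integral of [h] against a Dirac mass. *)
Lemma chain_expectation n (G : set W) (h : S -> \bar R) :
  natural_filtration Z n G -> measurable G -> measurable_fun [set: S] h ->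
  (forall u, 0 <= h u) ->
  \int[P]_(w in G) h (Z n.+1 w) = \int[P]_(w in G) \int[B (Z n w)]_u h u.
Proof.
move=> FG mG mh h0.
transitivity (\int[P]_(w in G) \int[\d_(Z n.+1 w)]_u h u).
  by apply: eq_integral => w _; rewrite integral_dirac// diracT mul1e.
apply: eq_iterated_integral => //.
- by move=> A mA; exact: dirac_kernel_measurable.
- move=> A mA; apply: (@measurable_funS _ _ _ _ setT) => //.
  exact: measurableT_comp (measurable_kernel B A mA) (mZ n).
- move=> A mA.
  transitivity (P (G `&` Z n.+1 @^-1` A)); last first.
    rewrite (chain_step (chainZ z))//; apply: eq_integral => w _; exact: KB.
  rewrite setIC -integral_indic//; last by rewrite -[X in measurable X]setTI; exact: mZ.
Qed.

Lemma chain_start_expectation (h : S -> \bar R) : measurable_fun [set: S] h ->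
  (forall u, 0 <= h u) -> \int[P]_w h (Z 0%N w) = h z.
Proof.
move=> mh h0; transitivity (\int[\d_z]_u h u); last first.
  by rewrite integral_dirac// diracT mul1e.
rewrite (@integral_mixture _ _ _ _ _ P setT (fun w => \d_(Z 0%N w)))//.
- by apply: eq_integral => w _; rewrite integral_dirac// diracT mul1e.
- by move=> A mA; exact: dirac_kernel_measurable.
- move=> A mA; rewrite -[LHS](chain_start (chainZ z))// -[in LHS](setIT (_ @^-1` _)).
  by rewrite -integral_indic//; rewrite -[X in measurable X]setTI; exact: mZ.
Qed.

(* [stopped_weight m j w] is [rho ^- min(kappa, j + m)] on the event that the
   hitting time [kappa] of [D] is at least [j]. *)
Fixpoint stopped_weight (m j : nat) (w : W) : R :=
  if m is m'.+1 then
    if Z j w \in D then (rho^-1 ^+ j)%R else stopped_weight m' j.+1 w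
  else (rho^-1 ^+ j)%R.
Local Notation T := stopped_weight.

Let T0 m j w : (0 <= T m j w)%R.
Proof.
elim: m j => [|m IH] j /=; first by rewrite exprn_ge0// (le_trans ler01).
by case: ifPn => _ //; rewrite exprn_ge0// (le_trans ler01).
Qed.

Let mT m j : measurable_fun [set: W] (T m j).
Proof.
elim: m j => [|m IH] j //=; apply: measurable_fun_ifT => //.
exact: measurableT_comp mmemD (mZ j).
Qed.

(** Induction on [m], with [j] free. Where [Z j] is in [D] both integrands are [rho^-1 ^+ j];
    elsewhere unrolling [V] once is a conditional expectation, and its factor [rho^-1] raises the
    power to [j.+1]. *)
Lemma expectation_stopped_weight m j :
  \int[P]_(w in not_hit j) (rho^-1 ^+ j * V m (Z j w))%:E =
  \int[P]_(w in not_hit j) (T m j w)%:E.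
Proof.
elim: m j => [|m IH] j; first by apply: eq_integral => w _ /=; rewrite mulr1.
have r0 : (0 <= rho^-1)%R by exact: le_trans i1.
have mE := measurable_not_hit j.
have split_hit : not_hit j = (not_hit j `&` Z j @^-1` D) `|` not_hit j.+1.
  by rewrite /= -setIUr setUCr setIT.
have dis : [disjoint not_hit j `&` Z j @^-1` D & not_hit j.+1].
  by apply/disj_setPS => w [[_ h] [_ /=]].
have split_int (f : W -> \bar R) : measurable_fun [set: W] f -> (forall w, 0 <= f w) ->
    \int[P]_(w in not_hit j) f w = \int[P]_(w in not_hit j `&` Z j @^-1` D) f w +
      \int[P]_(w in not_hit j.+1) f w.
  move=> mf f0; rewrite {1}split_hit ge0_integral_setU//.
  - exact: measurableI.
  - exact: measurable_not_hit.
  - exact: measurable_funS mf.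
rewrite split_int; last 2 first.
- apply/measurable_EFinP; apply: measurable_funM => //.
  exact: measurableT_comp (mV m.+1) (mZ j).
- by move=> w; rewrite lee_fin mulr_ge0 ?exprn_ge0// -lee_fin.
rewrite [RHS]split_int; last 2 first.
- by apply/measurable_EFinP; exact: mT.
- by move=> w; rewrite lee_fin.
congr (_ + _).
  by apply: eq_integral => w /set_mem[_ /= ZD]; rewrite mem_set// mulr1.
transitivity (\int[P]_(w in not_hit j.+1) (rho^-1 ^+ j.+1 * V m (Z j.+1 w))%:E).
  rewrite (@chain_expectation _ _ (fun u => (rho^-1 ^+ j.+1 * V m u)%:E)); last 4 first.
  - exact: natural_filtration_not_hit.
  - exact: measurable_not_hit.
  - by apply/measurable_EFinP; exact: measurable_funM.
  - by move=> u; rewrite lee_fin mulr_ge0 ?exprn_ge0// -lee_fin.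
  apply: eq_integral => w /set_mem[_ /= nD]; rewrite memNset//.
  under [RHS]eq_integral do rewrite EFinM.
  rewrite ge0_integralZl//; last by rewrite lee_fin exprn_ge0.
  rewrite -[in RHS](fineK (intV_fin m (Z j w))) -EFinM; congr EFin.
  by rewrite mulrA exprSr.
rewrite IH; apply: eq_integral => w /set_mem[_ /= nD].
by rewrite [in RHS]memNset.
Qed.

(** [V m z] is the mean of [T m 0], which pathwise is at most [rho^-1] to the hitting time and, as
    [beta <= rho < 1], at most the integrand of (A4). *)
Lemma hitting_weight_le (beta Ct : R) : (0 < beta)%R -> (beta <= rho)%R ->
  \int[P]_w inv_pow beta (hitting_time D (fun n => Z n w)) <= Ct%:E ->
  forall m, (V m z <= Ct)%R.
Proof.
move=> beta0 beta_rho ICt m; rewrite -lee_fin; apply: le_trans ICt.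
rewrite -(@chain_start_expectation (fun u => (V m u)%:E))//.
have -> : \int[P]_w (V m (Z 0%N w))%:E = \int[P]_w (T m 0%N w)%:E.
  rewrite -[RHS](expectation_stopped_weight m 0).
  by apply: eq_integral => w _; rewrite expr0 mul1r.
have pow_le n w : not_hit n w ->
    (rho^-1 ^+ n)%:E <= inv_pow beta (hitting_time D (fun n => Z n w)).
  move=> /not_hitP nh; rewrite /inv_pow.
  have : (n%:R : R)%:E <= hitting_time D (fun n => Z n w).
    rewrite /hitting_time; apply: le_ereal_inf_tmp => _ [k /= Dk <-]; rewrite lee_fin ler_nat.
    by case: (leqP n k) => // kn; case: (nh k kn).
  case: hitting_time => [t| |] //=; last by move=> _; exact: leey.
  rewrite !lee_fin => nt.
  rewrite exprVn -powR_mulrn ?(ltW rho0)// -powRN.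
  apply: (@le_trans _ _ (beta `^ (- n%:R))%R).
    rewrite !powRN lef_pV2 ?posrE ?powR_gt0//.
    by rewrite ge0_ler_powR ?nnegrE// ltW.
  apply: ger_powR; last by rewrite lerN2.
  by rewrite beta0 (le_trans beta_rho)// ltW.
have T_le : forall w, (T m 0%N w)%:E <= inv_pow beta (hitting_time D (fun n => Z n w)).
  move=> w; have : not_hit 0 w by [].
  elim: m 0%N => [|m IH] j nh /=; first exact: pow_le.
  case: ifPn => [_|nD]; first exact: pow_le.
  by apply: IH; split => //= DZ; move: nD; rewrite mem_set.
(* Both integrals are written as suprema over simple functions, which are compared directly;
   measurability of the hitting time is never called upon. *)
rewrite ge0_integralTE//; last by move=> w; rewrite lee_fin.
rewrite ge0_integralTE//; last first.
  by move=> w; apply: le_trans (T_le w); rewrite lee_fin.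
apply: ereal_sup_le => _ [h hT <-]; exists h => // w.
exact: le_trans (hT w) (T_le w).
Qed.

End hitting.

(** * The coupling as a probability kernel with the prescribed marginals *)

Section coupling_kernel.
Context {R : realType} (X : completeMetricType R).
Local Notation T := (borel X).
Local Notation S := (T * T)%type.
Variables (p : R.-pker T ~> T) (Q : R.-spker S ~> S).
Hypothesis Q1 : forall z A, measurable A -> Q z (A `*` setT) <= p z.1 A.
Hypothesis Q2 : forall z A, measurable A -> Q z (setT `*` A) <= p z.2 A.

Let Qle1 z : Q z setT <= 1. Proof. exact: sprob_kernel_le1. Qed.

Let Qfin z C : measurable C -> Q z C \is a fin_num.
Proof.
move=> mC; rewrite ge0_fin_numE//; apply: le_lt_trans (ltry 1).
by apply: le_trans (Qle1 z); apply: le_measure; rewrite ?inE.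
Qed.

Let pfin (x : T) A : measurable A -> p x A \is a fin_num.
Proof.
move=> mA; rewrite ge0_fin_numE//; apply: le_lt_trans (ltry 1).
by rewrite -(@prob_kernel _ _ _ _ _ p x); apply: le_measure; rewrite ?inE.
Qed.

Let residual1_measure z : exists m : {measure set T -> \bar R},
  forall A, measurable A -> m A = residual1 p Q z A.
Proof.
have [q qE] : exists q : {measure set T -> \bar R}, forall C, q C = Q z (C `*` setT).
  have mfst : measurable_fun [set: S] (fst : S -> T) by exact: measurable_fst.
  unshelve eexists (pushforward (Q z) (fst : S -> T)) => //.
  move=> C; congr (Q z _).
  by apply/seteqP; split => [[u v] /= ?|[u v] /= []].
have [||m mE] := @measure_difference R _ T (p z.1) q.
- by move=> A mA; rewrite qE Q1.
- by rewrite prob_kernel ltry.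
by exists m => A mA; rewrite mE// qE.
Qed.

(** Finiteness is recorded here because this is the second factor of a product measure, the one
    whose sections are integrated. *)
Let residual2_measure z : exists m : {finite_measure set T -> \bar R},
  forall A, measurable A -> m A = residual2 p Q z A.
Proof.
have [q qE] : exists q : {measure set T -> \bar R}, forall C, q C = Q z (setT `*` C).
  have msnd : measurable_fun [set: S] (snd : S -> T) by exact: measurable_snd.
  unshelve eexists (pushforward (Q z) (snd : S -> T)) => //.
  move=> C; congr (Q z _).
  by apply/seteqP; split => [[u v] /= ?|[u v] /= []].
have [||m mE] := @measure_difference R _ T (p z.2) q.
- by move=> A mA; rewrite qE Q2.
- by rewrite prob_kernel ltry.
have fm : fin_num_fun m.
  by move=> A mA; rewrite mE// qE fin_numB pfin//= Qfin//; exact: measurableX.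
have sg : sigma_finite setT m by apply: fin_num_fun_sigma_finite; rewrite ?measure0.
pose m' := HB.pack_for (FiniteMeasure.type T R) (Measure.sort m)
  (isFinite.Build _ _ _ _ fm)
  (isSFinite.Build _ _ _ _ (sfinite_measure_sigma_finite sg))
  (isSigmaFinite.Build _ _ _ _ sg).
by exists m' => A mA; rewrite [LHS]mE// qE.
Qed.

(* The case split in [residual_coupling] is immaterial since [0^-1 = 0]. *)
Let residual_couplingE z C : residual_coupling p Q z C =
  ((1 - fine (Q z setT)) `^ (-1))%:E * (residual1 p Q z \x residual2 p Q z) C.
Proof.
have q1 : (0 <= 1 - fine (Q z setT))%R.
  by rewrite subr_ge0 -lee_fin fineK// Qfin.
rewrite /residual_coupling powR_inv1//; case: ifPn => //.
rewrite -leNgt => Q1'; have -> : Q z setT = 1 by apply/eqP; rewrite eq_le Qle1.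
by rewrite /= subrr invr0 mul0e.
Qed.

Let coupling_measure z : exists b : {measure set S -> \bar R},
  forall C, measurable C -> b C = coupling p Q z C.
Proof.
have [m1 m1E] := residual1_measure z; have [m2 m2E] := residual2_measure z.
pose c : {nonneg R} := NngNum (powR_ge0 (1 - fine (Q z setT))%R (-1)).
exists (measure_add (Q z) (mscale c (m1 \x m2))) => C mC.
apply: etrans (measure_addE _ _ _) _; congr (_ + _).
rewrite residual_couplingE; congr (_ * _).
rewrite /product_measure1 -(eq_integral_set_fun _ m1E).
apply: eq_integral => x _; apply: m2E; exact: measurable_xsection.
Qed.

Let b z := sval (cid (coupling_measure z)).
Let bE z C : measurable C -> b z C = coupling p Q z C.
Proof. exact: (svalP (cid (coupling_measure z))). Qed.

(** If [Q z] has mass below [1], the second residual of the whole space is [1 - Q z setT] and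
    cancels the normalisation. If it has mass [1], its marginal is dominated by a measure of the
    same mass; comparing complements gives equality. *)
Lemma coupling_fst z A : measurable A -> coupling p Q z (A `*` setT) = p z.1 A.
Proof.
move=> mA; have mAT : measurable (A `*` [set: T]) by exact: measurableX.
rewrite /coupling; have [Qlt1|] := boolP (Q z setT < 1).
  rewrite residual_coupling_rectangle//; last 2 first.
  - by move=> *; exact: Q1.
  - by move=> *; exact: Q2.
  rewrite prob_kernel setXTT.
  have := Qlt1; have := Qfin z measurableT; have := Qfin z mAT; have := pfin z.1 mA.
  case: (p z.1 A) => // a _; case: (Q z (A `*` setT)) => // q1 _.
  case: (Q z setT) => // q _; rewrite lte_fin => ql1.
  rewrite -!EFinB -!EFinM -EFinD /=; congr EFin.
  by field; rewrite subr_eq0 gt_eqF.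
rewrite -leNgt => Qge1; have QT : Q z setT = 1 by apply/eqP; rewrite eq_le Qle1.
rewrite residual_couplingE QT /= subrr powR0 ?oppr_eq0 ?oner_eq0// mul0e adde0.
apply/eqP; rewrite eq_le Q1//=.
have mA' := measurableC mA.
have mAT' : measurable (~` A `*` [set: T]) by exact: measurableX.
have pT : p z.1 A + p z.1 (~` A) = 1.
  have := @measureU _ _ _ (p z.1) _ _ mA mA' (setICr A).
  by rewrite setUCr => <-; exact: prob_kernel.
have qT : Q z (A `*` setT) + Q z (~` A `*` setT) = 1.
  rewrite -measureU//; last by rewrite -setXI setICr set0X.
  rewrite -[RHS]QT; congr (Q z _); apply/seteqP; split => // -[u v] _ /=.
  by have [|] := pselect (A u); [left|right].
have := Q1 z mA'; move: pT qT.
have := Qfin z mAT; have := pfin z.1 mA; have := Qfin z mAT'; have := pfin z.1 mA'.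
case: (p z.1 A) => // a; case: (Q z (A `*` setT)) => // q1.
case: (p z.1 (~` A)) => // a'; case: (Q z (~` A `*` setT)) => // q2 _ _ _ _.
rewrite -!EFinD => -[pT] [qT]; rewrite !lee_fin; lra.
Qed.

Lemma coupling_snd z A : measurable A -> coupling p Q z (setT `*` A) = p z.2 A.
Proof.
move=> mA; have mAT : measurable ([set: T] `*` A) by exact: measurableX.
rewrite /coupling; have [Qlt1|] := boolP (Q z setT < 1).
  rewrite residual_coupling_rectangle//; last 2 first.
  - by move=> *; exact: Q1.
  - by move=> *; exact: Q2.
  rewrite prob_kernel setXTT.
  have := Qlt1; have := Qfin z measurableT; have := Qfin z mAT; have := pfin z.2 mA.
  case: (p z.2 A) => // a _; case: (Q z (setT `*` A)) => // q1 _.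
  case: (Q z setT) => // q _; rewrite lte_fin => ql1.
  rewrite -!EFinB -!EFinM -EFinD /=; congr EFin.
  by field; rewrite subr_eq0 gt_eqF.
rewrite -leNgt => Qge1; have QT : Q z setT = 1 by apply/eqP; rewrite eq_le Qle1.
rewrite residual_couplingE QT /= subrr powR0 ?oppr_eq0 ?oner_eq0// mul0e adde0.
apply/eqP; rewrite eq_le Q2//=.
have mA' := measurableC mA.
have mAT' : measurable ([set: T] `*` ~` A) by exact: measurableX.
have pT : p z.2 A + p z.2 (~` A) = 1.
  have := @measureU _ _ _ (p z.2) _ _ mA mA' (setICr A).
  by rewrite setUCr => <-; exact: prob_kernel.
have qT : Q z (setT `*` A) + Q z (setT `*` ~` A) = 1.
  rewrite -measureU//; last by rewrite -setXI setICr setX0.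
  rewrite -[RHS]QT; congr (Q z _); apply/seteqP; split => // -[u v] _ /=.
  by have [|] := pselect (A v); [left|right].
have := Q2 z mA'; move: pT qT.
have := Qfin z mAT; have := pfin z.2 mA; have := Qfin z mAT'; have := pfin z.2 mA'.
case: (p z.2 A) => // a; case: (Q z (setT `*` A)) => // q1.
case: (p z.2 (~` A)) => // a'; case: (Q z (setT `*` ~` A)) => // q2 _ _ _ _.
rewrite -!EFinD => -[pT] [qT]; rewrite !lee_fin; lra.
Qed.

Let coupling_setT z : coupling p Q z setT = 1.
Proof. by rewrite -setXTT coupling_fst// prob_kernel. Qed.

(** Dynkin induction from rectangles, where the coupling is an explicit expression in [p] and [Q].
    The measures [b z], equal to the coupling on measurable sets, supply complements and disjoint
    unions. *)
Let measurable_coupling C : measurable C ->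
  measurable_fun [set: S] (fun z => coupling p Q z C).
Proof.
have mb C' : measurable C' -> measurable_fun [set: S] (fun z => b z C') ->
    measurable_fun [set: S] (fun z => coupling p Q z C').
  by move=> mC'; rewrite (_ : (fun z => b z C') = (fun z => coupling p Q z C'))//;
    apply/funext => z; rewrite bE.
rewrite measurable_prod_measurableType; move: C.
apply: (@dynkin_induction _ S _
  (fun C => measurable_fun [set: S] (fun z => coupling p Q z C))) => /=.
- by rewrite measurable_prod_measurableType.
- move=> _ _ [A1 mA1 [A2 mA2 <-]] [B1 mB1 [B2 mB2 <-]].
  exists (A1 `&` B1); first exact: measurableI.
  exists (A2 `&` B2); first exact: measurableI.
  by rewrite setXI.
- rewrite (_ : (fun z => coupling p Q z setT) = cst 1); first exact: measurable_cst.
  by apply/funext => z; exact: coupling_setT.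
- move=> _ [A mA [B mB <-]]; rewrite /coupling.
  have mAB : measurable (A `*` B) by exact: measurableX.
  have mAT : measurable (A `*` [set: T]) by exact: measurableX.
  have mBT : measurable ([set: T] `*` B) by exact: measurableX.
  apply: emeasurable_funD; first exact: measurable_kernel.
  under eq_fun do rewrite residual_couplingE.
  rewrite (_ : (fun z => _) = fun z =>
      ((1 - fine (Q z setT)) `^ (-1))%:E * (residual1 p Q z A * residual2 p Q z B)).
    apply: emeasurable_funM.
      apply/measurable_EFinP; apply: (measurableT_comp (measurable_powR (-1))).
      apply: measurable_funB => //; apply: measurableT_comp => //.
      exact: measurable_kernel.
    apply: emeasurable_funM; apply: emeasurable_funB; rewrite ?/residual1.
    + exact: (measurableT_comp (measurable_kernel p A mA) measurable_fst).
    + exact: measurable_kernel.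
    + exact: (measurableT_comp (measurable_kernel p B mB) measurable_snd).
    + exact: measurable_kernel.
  apply/funext => z; congr (_ * _).
  have [m1 m1E] := residual1_measure z; have [m2 m2E] := residual2_measure z.
  rewrite -m1E// -m2E// -product_measure1E// /product_measure1.
  rewrite -(eq_integral_set_fun _ m1E).
  by apply: eq_integral => x _; apply/esym/m2E; exact: measurable_xsection.
- move=> C mC IH; apply: mb; first exact: measurableC.
  rewrite (_ : (fun z => _) = fun z => 1 - coupling p Q z C).
    exact: emeasurable_funB.
  apply/funext => z; rewrite -bE//.
  have bT : b z setT = 1 by rewrite bE.
  have bT' : b z setT < +oo by rewrite bT ltry.
  by rewrite -bT -setTD (measureD _ _ bT')// setTI.
- move=> G mG tG IH; apply: mb; first exact: bigcup_measurable.
  rewrite (_ : (fun z => _) = fun z => \sum_(n <oo) coupling p Q z (G n)).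
    apply: ge0_emeasurable_sum => // n z _ _.
    by rewrite -bE.
  apply/funext => z; rewrite measure_semi_bigcup//; last exact: bigcup_measurable.
  by apply: eq_eseriesr => n _; rewrite bE.
Qed.

Lemma coupling_kernel : exists2 B : R.-pker S ~> S,
  forall z C, measurable C -> coupling p Q z C = B z C &
  forall z C, measurable C -> Q z C <= B z C.
Proof.
have mb C : measurable C -> measurable_fun [set: S] (b ^~ C).
  move=> mC; rewrite (_ : b ^~ C = fun z => coupling p Q z C).
    exact: measurable_coupling.
  by apply/funext => z; rewrite bE.
have b1 z : b z setT = 1 by rewrite bE.
pose kb := isKernel.Build _ _ S S R b mb.
pose B0 : R.-ker S ~> S := HB.pack b kb.
pose B : R.-pker S ~> S := HB.pack b kb (Kernel_isProbability.Build _ _ S S R B0 b1).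
exists B => z C mC; first by rewrite -bE.
rewrite [leRHS]bE// leeDl// residual_couplingE mule_ge0 ?lee_fin ?powR_ge0//.
have [m1 m1E] := residual1_measure z; have [m2 m2E] := residual2_measure z.
rewrite /product_measure1 -(eq_integral_set_fun _ m1E).
by apply: integral_ge0 => x _; rewrite /= -m2E//; exact: measurable_xsection.
Qed.

End coupling_kernel.

(** * Bounded Lipschitz functions *)

Section bounded_lipschitz.
Context {R : realType} (X : completeMetricType R).
Local Notation T := (borel X).
Implicit Types (f g : T -> R).

(** A single constant serves as bound and as Lipschitz constant. The class is closed under linear
    combinations, products and lattice operations, which the Daniell construction relies on. *)
Definition blip f := exists k : R, forall x y,
  (`|f x| <= k)%R /\ (`|f x - f y| <= k * mdist x y)%R.

Let d0 (x y : T) : (0 <= mdist x y)%R. Proof. exact: mdist_ge0. Qed.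

Lemma blip_cst (c : R) : blip (fun=> c).
Proof.
exists `|c|%R => x y; split; first exact: lexx.
by rewrite subrr normr0 mulr_ge0.
Qed.

Lemma blipD f g : blip f -> blip g -> blip (fun x => f x + g x)%R.
Proof.
move=> [k fk] [m gm]; exists (k + m)%R => x y.
have [f1 f2] := fk x y; have [g1 g2] := gm x y; split.
  by apply: le_trans (ler_normD _ _) _; exact: lerD.
rewrite (_ : _ - _ = (f x - f y) + (g x - g y))%R; last by ring.
by rewrite mulrDl; apply: le_trans (ler_normD _ _) _; exact: lerD.
Qed.

Lemma blipM f g : blip f -> blip g -> blip (fun x => f x * g x)%R.
Proof.
move=> [k fk] [m gm]; exists (k * m + k * m)%R => x y.
have [f1 f2] := fk x y; have [g1 g2] := gm x y.
have [f1' _] := fk y x; have [g1' _] := gm y x.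
have k0 : (0 <= k)%R by apply: le_trans f1.
have m0 : (0 <= m)%R by apply: le_trans g1.
split.
  rewrite normrM; apply: (@le_trans _ _ (k * m)%R); first exact: ler_pM.
  by rewrite lerDl mulr_ge0.
rewrite (_ : _ - _ = f x * (g x - g y) + (f x - f y) * g y)%R; last by ring.
apply: le_trans (ler_normD _ _) _; rewrite !normrM mulrDl; apply: lerD.
  by rewrite -mulrA; apply: ler_pM.
by rewrite mulrAC; apply: ler_pM.
Qed.

Lemma blipZ (c : R) f : blip f -> blip (fun x => c * f x)%R.
Proof. by move=> bf; apply: blipM => //; exact: blip_cst. Qed.

Lemma blipB f g : blip f -> blip g -> blip (fun x => f x - g x)%R.
Proof.
move=> bf bg; rewrite (_ : (fun x => _) = fun x => f x + (-1) * g x)%R.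
  by apply: blipD => //; exact: blipZ.
by apply/funext => x; rewrite mulN1r.
Qed.

Lemma normr_max_dist (a b c d e : R) : (`|a - c| <= e)%R -> (`|b - d| <= e)%R ->
  (`|Num.max a b - Num.max c d| <= e)%R.
Proof.
rewrite !ler_norml => /andP[? ?] /andP[? ?].
by have [ab|ab] := leP a b; have [cd|cd] := leP c d; apply/andP; split; lra.
Qed.

Lemma blip_max f g : blip f -> blip g -> blip (fun x => Num.max (f x) (g x)).
Proof.
move=> [k fk] [m gm]; exists (k + m)%R => x y.
have [f1 f2] := fk x y; have [g1 g2] := gm x y.
have k0 : (0 <= k)%R by apply: le_trans f1.
have m0 : (0 <= m)%R by apply: le_trans g1.
split.
  have := @normr_max_dist (f x) (g x) 0%R 0%R (k + m)%R.
  rewrite !subr0 maxxx subr0; apply.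
    by apply: le_trans f1 _; rewrite lerDl.
  by apply: le_trans g1 _; rewrite lerDr.
apply: normr_max_dist.
  by apply: le_trans f2 _; rewrite ler_wpM2r// lerDl.
by apply: le_trans g2 _; rewrite ler_wpM2r// lerDr.
Qed.

Lemma blip_min f g : blip f -> blip g -> blip (fun x => Num.min (f x) (g x)).
Proof.
move=> bf bg; rewrite (_ : (fun x => _) = fun x => f x + g x - Num.max (f x) (g x))%R.
  by apply: blipB; [exact: blipD|exact: blip_max].
by apply/funext => x; rewrite -(addr_max_min (f x) (g x)) addrAC subrr add0r.
Qed.

Lemma mdist_lip (x0 x y : T) : (`|mdist x0 x - mdist x0 y| <= mdist x y)%R.
Proof.
rewrite ler_distl; have := metric_triangle x0 y x; have := metric_triangle x0 x y.
by rewrite (metric_sym y x) => ? ?; apply/andP; split; lra.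
Qed.

Lemma blip_tent (x0 : T) (r : R) : blip (fun x => Num.max 0 (r - mdist x0 x))%R.
Proof.
exists (`|r| + 1)%R => x y; split.
  have := d0 x0 x; have := ler_norm r; have := normr_ge0 r.
  case: (leP 0%R (r - mdist x0 x)%R) => h ? ? ?; last by rewrite normr0; lra.
  by rewrite (ger0_norm h); lra.
apply: (@le_trans _ _ (mdist x y)); last by rewrite ler_peMl// lerDr.
apply: normr_max_dist; first by rewrite subrr normr0.
rewrite (_ : _ - _ = mdist x0 y - mdist x0 x)%R; last by ring.
by rewrite (metric_sym x y); exact: mdist_lip.
Qed.

Lemma lipschitz_continuous f (k : R) :
  (forall x y, `|f x - f y| <= k * mdist x y)%R -> continuous f.
Proof.
move=> fk x; apply/cvgrPdist_lt => e e0.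
have k0 : (0 < `|k| + 1)%R by rewrite ltr_wpDl.
have : nbhs x (ball x (e / (`|k| + 1))%R) by apply: nbhsx_ballx; rewrite divr_gt0.
apply: filterS => y /=; rewrite ballEmdist /= => xy; apply: le_lt_trans (fk x y) _.
move: xy; rewrite ltr_pdivlMr// mulrC; apply: le_lt_trans.
by rewrite ler_wpM2r// (le_trans (ler_norm _))// lerDl.
Qed.

Lemma continuous_measurable f : continuous f -> measurable_fun [set: T] f.
Proof.
move=> cf.
apply: (measurability _ (RGenOInfty.measurableE R)) => // _ [_ [x ->] <-].
rewrite setTI; apply: sub_sigma_algebra.
by apply: open_comp => [y _|]; [exact: cf|exact: interval_open].
Qed.

Lemma Cb_Bb f : Cb f -> Bb f.
Proof. by move=> [cf bf]; split => //; exact: continuous_measurable. Qed.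

Lemma bounded_fun_le f (k : R) : (forall x, `|f x| <= k)%R -> bounded_fun f.
Proof.
move=> fk; exists k; split; first exact: num_real.
by move=> m km x _; apply: le_trans (fk x) _; exact: ltW.
Qed.

Lemma Bb_bound f : Bb f -> exists2 k : R, (0 < k)%R & forall x, (`|f x| <= k)%R.
Proof.
move=> [_ [M [_ Mf]]]; exists (`|M| + 1)%R; first by rewrite ltr_wpDl.
by move=> x; apply: Mf => //; rewrite (le_lt_trans (ler_norm _))// ltrDl.
Qed.

Lemma blip_Cb f : blip f -> Cb f.
Proof.
move=> [k fk]; split.
  by apply: (@lipschitz_continuous f k) => x y; exact: (fk x y).2.
by apply: (@bounded_fun_le f k) => x; exact: (fk x x).1.
Qed.

Lemma blip_measurable f : blip f -> measurable_fun [set: T] f.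
Proof. by move=> /blip_Cb/Cb_Bb[]. Qed.

Lemma Bb_integrable (P : probability T R) f : Bb f -> P.-integrable setT (EFin \o f).
Proof.
move=> [mf bf]; apply: measurable_bounded_integrable => //.
by apply: le_lt_trans (probability_le1 P measurableT) _; exact: ltry.
Qed.

Lemma Bb_kernel_integrable (p : R.-pker T ~> T) x f : Bb f ->
  (p x).-integrable setT (EFin \o f).
Proof.
move=> [mf bf]; apply: measurable_bounded_integrable => //.
by rewrite prob_kernel ltry.
Qed.

End bounded_lipschitz.

(** The enumeration is independent of the array: the same one has to rearrange the cover at every
    point and the costs. *)
Lemma nneseries_pair (R : realType) : exists f : nat -> nat * nat,
  forall a : nat -> nat -> \bar R, (forall i j, 0 <= a i j) ->
  \sum_(i <oo) \sum_(j <oo) a i j = \sum_(n <oo) a (f n).1 (f n).2.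
Proof.
have /card_esym/ppcard_eqP[f] := card_nat2.
exists f => a a0.
rewrite [RHS]nneseries_esumT// -(@reindex_esum _ _ _ setT setT f (fun k => a k.1 k.2)).
  rewrite nneseries_esumT; last by move=> i; exact: nneseries_ge0.
  under eq_esum do rewrite nneseries_esumT//.
  rewrite esum_esum//; congr esum.
  by apply/seteqP; split.
exact: bij.
Qed.

Section dense_sequence.
Context {R : realType} (X : completeMetricType R).

Lemma dense_sequence : separable X -> exists s : nat -> borel X,
  forall (x : borel X) (e : R), (0 < e)%R -> exists n, (mdist (s n) x < e)%R.
Proof.
move=> [D cD dD]; have [f finj] := countable_injP _ cD.
exists (fun n => xget point [set d | D d /\ f d = n]) => x e e0.
have [d [/interior_subset xd Dd]] :=
  dD (ball (x : X) e)° (ex_intro _ x (nbhsx_ballx (x : X) _ e0)) (open_interior _).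
exists (f d); case: xgetP => [d' _ [Dd' /finj]|/(_ d)]; last by case.
rewrite !inE => /(_ Dd' Dd) ->.
by move: xd; rewrite ballEmdist /= metric_sym.
Qed.

End dense_sequence.

(** * From a positive functional on Lipschitz functions to a probability measure *)

Section daniell.
Context {R : realType} (X : completeMetricType R).
Local Notation T := (borel X).
Implicit Types (f g : T -> R) (A : set T).
Variable Lam : (T -> R) -> R.

Definition nnblip f := blip f /\ forall x, (0 <= f x)%R.

Hypothesis LamD : forall f g, nnblip f -> nnblip g ->
  Lam (fun x => f x + g x)%R = (Lam f + Lam g)%R.
Hypothesis Lam_ge0 : forall f, nnblip f -> (0 <= Lam f)%R.
Hypothesis Lam1 : Lam (fun=> 1%R) = 1%R.
Hypothesis Lam_sigma : forall g : nat -> T -> R, (forall i, nnblip (g i)) ->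
  (forall x, 1 <= \sum_(i <oo) (g i x)%:E) -> 1 <= \sum_(i <oo) (Lam (g i))%:E.

Let Lam0 : Lam (fun=> 0%R) = 0%R.
Proof.
have n0 : nnblip (fun=> 0%R) by split => //; exact: blip_cst.
have := LamD n0 n0.
rewrite (_ : (fun _ : T => (0 + 0)%R) = fun=> 0%R); last by apply/funext => x; rewrite addr0.
by move/eqP; rewrite -subr_eq0 opprD addrA subrr add0r oppr_eq0 => /eqP.
Qed.

Definition lip_cover A := [set g : nat -> T -> R | (forall i, nnblip (g i)) /\
  forall x, A x -> 1 <= \sum_(i <oo) (g i x)%:E].

(** The analogue of Lebesgue's outer measure in which functions with prescribed cost [Lam] replace
    the covering intervals. *)
Definition daniell_outer A : \bar R :=
  ereal_inf [set \sum_(i <oo) (Lam (g i))%:E | g in lip_cover A].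
Local Notation mu := daniell_outer.

Let outer_le A (g : nat -> T -> R) : lip_cover A g -> mu A <= \sum_(i <oo) (Lam (g i))%:E.
Proof. by move=> gA; apply: ereal_inf_lbound; exists g. Qed.

Let outer_le2 A (G : nat -> nat -> T -> R) : (forall i j, nnblip (G i j)) ->
  (forall x, A x -> 1 <= \sum_(i <oo) \sum_(j <oo) (G i j x)%:E) ->
  mu A <= \sum_(i <oo) \sum_(j <oo) (Lam (G i j))%:E.
Proof.
move=> nG GA; have [f fE] := nneseries_pair R.
rewrite fE; last by move=> i j; rewrite lee_fin Lam_ge0.
apply: (@outer_le _ (fun n => G (f n).1 (f n).2)); split => [i|x Ax]; first exact: nG.
by apply: le_trans (GA x Ax) _; rewrite fE// => i j; rewrite lee_fin; exact: (nG i j).2.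
Qed.

Let outer1_le A f : nnblip f -> (forall x, A x -> (1 <= f x)%R) -> mu A <= (Lam f)%:E.
Proof.
move=> nf fA; pose g (i : nat) : T -> R := if i is 0%N then f else fun=> 0%R.
have gE (h : (T -> R) -> R) : (h (fun=> 0) = 0)%R -> (0 <= h f)%R ->
    \sum_(i <oo) (h (g i))%:E = (h f)%:E.
  move=> h0 hf.
  rewrite nneseries_recl//; last by case=> [|i] _ /=; rewrite lee_fin// h0.
  rewrite eseries0 ?adde0//; case=> //= i _ _.
  by rewrite h0.
rewrite -(gE Lam)//; last exact: Lam_ge0.
apply: outer_le; split.
  by case=> [|i] //=; split => //; exact: blip_cst.
move=> x Ax; rewrite (gE (fun h => h x))// ?lee_fin; first exact: fA.
exact: nf.2.
Qed.

Let outer0 : mu set0 = 0.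
Proof.
apply/eqP; rewrite eq_le; apply/andP; split.
  rewrite -[leRHS]/(0%R%:E) -Lam0; apply: outer1_le => //.
  by split => //; exact: blip_cst.
apply: le_ereal_inf_tmp => _ [g [ng _] <-].
by apply: nneseries_ge0 => n _ _; rewrite lee_fin Lam_ge0.
Qed.

Let outer_ge0 A : 0 <= mu A.
Proof.
apply: le_ereal_inf_tmp => _ [g [ng _] <-].
by apply: nneseries_ge0 => n _ _; rewrite lee_fin Lam_ge0.
Qed.

Let outer_le_set : {homo mu : A B / A `<=` B >-> A <= B}.
Proof.
move=> A B AB; apply: ereal_inf_le_tmp => _ [g [ng gB] <-].
by exists g => //; split => // x /AB; exact: gB.
Qed.

Let outer_sub : sigma_subadditive mu.
Proof.
move=> F.
have [[i ioo]|] := pselect (exists i, mu (F i) = +oo).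
  rewrite (eseries_pinfty _ _ ioo) ?leey// => n _.
  by rewrite -ltNye (lt_le_trans _ (outer_ge0 _)).
rewrite -forallNE => Foo.
apply/lee_addgt0Pr => e e0.
apply: le_trans (epsilon_trick _ _ (ltW e0)); last by move=> n; exact: outer_ge0.
have [G PG] : {G : nat -> nat -> T -> R & forall n, lip_cover (F n) (G n) /\
    \sum_(i <oo) (Lam (G n i))%:E <= mu (F n) + (e / (2 ^ n.+1)%:R)%:E}.
  apply: (@choice _ _ (fun n Gn => lip_cover (F n) Gn /\
    \sum_(i <oo) (Lam (Gn i))%:E <= mu (F n) + (e / (2 ^ n.+1)%:R)%:E)) => n.
  have en : (0 < e / (2 ^ n.+1)%:R)%R by rewrite divr_gt0// ltr0n expn_gt0.
  have fn : mu (F n) \is a fin_num.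
    by rewrite ge0_fin_numE// ltey; exact/eqP/Foo.
  have [_ [g gF <-] h] := lb_ereal_inf_adherent en fn.
  by exists g; split => //; exact: ltW.
apply: (@le_trans _ _ (\sum_(i <oo) \sum_(j <oo) (Lam (G i j))%:E)).
  apply: outer_le2 => [i j|x [n _ Fx]]; first exact: (PG i).1.1.
  apply: le_trans ((PG n).1.2 x Fx) _.
  rewrite [leRHS](@nneseriesD1 _ _ n)//; last first.
    by move=> i _; apply: nneseries_ge0 => j _ _; rewrite lee_fin; exact: ((PG i).1.1 j).2.
  rewrite leeDl// nneseries_ge0// => i _ _.
  by apply: nneseries_ge0 => j _ _; rewrite lee_fin; exact: ((PG i).1.1 j).2.
apply: lee_nneseries => [i _ _|i _]; last exact: (PG i).2.
by apply: nneseries_ge0 => j _ _; rewrite lee_fin; exact: Lam_ge0 ((PG i).1.1 j).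
Qed.

HB.instance Definition _ := isOuterMeasure.Build R T mu
  outer0 outer_ge0 outer_le_set outer_sub.

Let UnnD f g : nnblip f -> nnblip g -> nnblip (fun x => f x + g x)%R.
Proof. by move=> nf ng; split => [|x]; [exact: blipD nf.1 ng.1|rewrite addr_ge0 ?nf.2 ?ng.2]. Qed.

Let UnnM f g : nnblip f -> nnblip g -> nnblip (fun x => f x * g x)%R.
Proof. by move=> nf ng; split => [|x]; [exact: blipM nf.1 ng.1|rewrite mulr_ge0 ?nf.2 ?ng.2]. Qed.

Let Lam_sum (F : nat -> T -> R) n : (forall i, nnblip (F i)) ->
  nnblip (fun x => \sum_(0 <= i < n) F i x)%R /\
  Lam (fun x => \sum_(0 <= i < n) F i x)%R = (\sum_(0 <= i < n) Lam (F i))%R.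
Proof.
move=> nF; elim: n => [|n [nS IH]].
  rewrite (_ : (fun x => _) = fun=> 0%R); last by apply/funext => x; rewrite big_geq.
  by rewrite big_geq// Lam0; split => //; split => //; exact: blip_cst.
rewrite (_ : (fun x => _) = fun x => (\sum_(0 <= i < n) F i x + F n x)%R).
  by rewrite big_nat_recr//= LamD// IH; split => //; exact: UnnD.
by apply/funext => x; rewrite big_nat_recr.
Qed.

(* With [h_j = min(1, j f)] increasing to the indicator of [f > 0], a cover
   [(g_i)] of [A] splits into the cover [(g_i (h_(j+1) - h_j))] of the part of
   [A] where [f > 0], and the covers [(g_i (1 - h_J))] of the rest; all the
   costs add up by additivity of [Lam]. *)
Lemma daniell_measurable_pos f : nnblip f -> mu.-caratheodory [set x | (0 < f x)%R].
Proof.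
move=> nf; apply: le_caratheodory_measurable => A; set U := [set x | _].
apply: le_ereal_inf_tmp => _ [g [ng gA] <-].
pose h (j : nat) x : R := Num.min 1%R (j%:R * f x)%R.
have h0 x : h 0%N x = 0%R by rewrite /h mul0r; apply/min_idPr.
have nh j : nnblip (h j).
  split => [|x]; first by apply: blip_min; [exact: blip_cst|exact: blipZ nf.1].
  by rewrite le_min ler01 mulr_ge0// nf.2.
have h1 j x : (h j x <= 1)%R by rewrite ge_min lexx.
have hS j x : (h j x <= h j.+1 x)%R.
  by rewrite le_min h1/= ge_min ler_wpM2r ?orbT ?nf.2// ler_nat.
pose ph j x := (h j.+1 x - h j x)%R.
have nph j : nnblip (ph j).
  by split => [|x]; [exact: blipB (nh _).1 (nh _).1|rewrite subr_ge0].
have phE J x : (\sum_(0 <= j < J) ph j x = h J x)%R.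
  by rewrite telescope_sumr// h0 subr0.
have nG j i : nnblip (fun x => g i x * ph j x)%R by exact: UnnM.
have nH J i : nnblip (fun x => g i x * (1 - h J x))%R.
  apply: UnnM => //; split => [|x]; last by rewrite subr_ge0.
  by apply: blipB (nh J).1; exact: blip_cst.
have AU : mu (A `&` U) <= \sum_(j <oo) \sum_(i <oo) (Lam (fun x => g i x * ph j x)%R)%:E.
  apply: outer_le2 => // x [Ax Ux].
  have ph0 j : (0 <= ph j x)%R by exact: (nph j).2.
  apply: (@le_trans _ _ (\sum_(j <oo) (ph j x)%:E)); last first.
    apply: lee_nneseries => [j _ _|j _]; first by rewrite lee_fin.
    under eq_eseriesr do rewrite EFinM muleC.
    rewrite nneseriesZl//; last by move=> i _; rewrite lee_fin; exact: (ng i).2.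
    by rewrite -[leLHS]mule1; apply: lee_wpmul2l; [rewrite lee_fin|exact: gA].
  have [J fJ] : exists J : nat, (1 <= J%:R * f x)%R.
    exists (Num.truncn (f x)^-1).+1; rewrite -ler_pdivrMr// mul1r.
    by apply/ltW/truncnS_gt.
  apply: le_trans (nneseries_lim_ge J _); last by move=> j _; rewrite lee_fin.
  by rewrite sumEFin phE lee_fin le_min lexx.
apply: (@le_trans _ _ (\sum_(j <oo) \sum_(i <oo) (Lam (fun x => g i x * ph j x)%R)%:E +
  mu (A `&` ~` U))); first exact: leeD2r.
have L0 j i : 0 <= (Lam (fun x => g i x * ph j x)%R)%:E by rewrite lee_fin Lam_ge0.
have bound J : \sum_(0 <= j < J) \sum_(i <oo) (Lam (fun x => g i x * ph j x)%R)%:E +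
    mu (A `&` ~` U) <= \sum_(i <oo) (Lam (g i))%:E.
  apply: (@le_trans _ _ (\sum_(0 <= j < J) \sum_(i <oo) (Lam (fun x => g i x * ph j x)%R)%:E +
      \sum_(i <oo) (Lam (fun x => g i x * (1 - h J x))%R)%:E)).
    apply: leeD2l; apply: outer_le; split => // x [Ax nUx].
    have hx : h J x = 0%R.
      have fx : f x = 0%R by apply/eqP; rewrite eq_le nf.2 andbT leNgt; exact/negP.
      by rewrite /h fx mulr0; apply/min_idPr.
    by under eq_eseriesr do rewrite hx subr0 mulr1; exact: gA.
  rewrite -nneseries_sum_nat; last by move=> *; exact: L0.
  rewrite -nneseriesD; last 2 first.
  - by move=> i _ _; apply: sume_ge0 => j _; exact: L0.
  - by move=> i _ _; rewrite lee_fin; exact: Lam_ge0.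
  apply: lee_nneseries => [i _ _|i _].
    by rewrite adde_ge0//; [apply: sume_ge0 => j _; exact: L0|rewrite lee_fin; exact: Lam_ge0].
  have [nS SE] := @Lam_sum (fun j x => g i x * ph j x)%R J (nG^~ i).
  rewrite sumEFin -EFinD -SE -LamD// lee_fin le_eqVlt; apply/orP; left; apply/eqP.
  by congr Lam; apply/funext => x; rewrite -mulr_sumr phE -mulrDr addrC subrK mulr1.
set c := \sum_(i <oo) (Lam (g i))%:E in bound *.
have [->|cfin] := eqVneq c +oo; first exact: leey.
have mfin : mu (A `&` ~` U) \is a fin_num.
  rewrite ge0_fin_numE//; have := bound 0%N; rewrite big_geq// add0e => /le_lt_trans; apply.
  by rewrite ltey.
rewrite -leeBrDr//; apply: lime_le.
  by apply: is_cvg_nneseries => j _ _; exact: nneseries_ge0.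
by apply: nearW => J; rewrite leeBrDr.
Qed.

Hypothesis sepX : separable X.

Let measurable_ball_outer (x : T) (r : R) : mu.-caratheodory [set y | (mdist x y < r)%R].
Proof.
rewrite (_ : [set y | _] = [set y | (0 < Num.max 0 (r - mdist x y))%R]).
  apply: daniell_measurable_pos; split; first exact: blip_tent.
  by move=> y; rewrite le_max lexx.
by apply/seteqP; split => y /=; rewrite lt_max ltxx/= subr_gt0.
Qed.

(** By separability an open set is a countable union of balls centred on the dense sequence, and a
    ball is the positivity set of a tent function. *)
Let caratheodory_borel A : measurable A -> mu.-caratheodory A.
Proof.
have [s sP] := dense_sequence sepX.
suff : <<s @open X >> `<=` mu.-caratheodory by exact.
apply: smallest_sub.
  split; first exact: caratheodory_measurable_set0.
    by move=> B mB; rewrite setTD; exact: caratheodory_measurable_setC.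
  by move=> F mF; exact: caratheodory_measurable_bigcup.
move=> O oO.
pose b n m := [set y : T | (mdist (s n) y < (m.+1%:R)^-1)%R].
have -> : O = \bigcup_n \bigcup_m (if `[< b n m `<=` O >] then b n m else set0).
  apply/seteqP; split => [x Ox|x [n _ [m _]]]; last by case: asboolP => // h /h.
  have /nbhs_ballP[r /= r0 rO] : nbhs (x : X) O by exact: open_nbhs_nbhs.
  have r2 : (0 < r / 2)%R by rewrite divr_gt0.
  have [m _ /(_ m (leqnn _)) /= mr] := near_infty_natSinv_lt (PosNum r2).
  have [n nx] := sP x (m.+1%:R^-1)%R (ltac:(by rewrite invr_gt0)).
  exists n => //; exists m => //; case: asboolP => // -[] y /= ny.
  have tri (u v w : T) (a : R) : (mdist u v < a -> mdist u w < a -> mdist v w < a + a)%R.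
    rewrite (metric_sym u v) => uv uw.
    by apply: le_lt_trans (metric_triangle v u w) _; exact: ltrD.
  apply: rO; rewrite ballEmdist /=; apply: lt_trans (tri _ _ _ _ nx ny) _.
  by rewrite [X in (_ < X)%R]splitr; exact: ltrD.
apply: caratheodory_measurable_bigcup => n; apply: caratheodory_measurable_bigcup => m.
case: asboolP => _; [exact: measurable_ball_outer|exact: caratheodory_measurable_set0].
Qed.

Let outer_sigma_additive : semi_sigma_additive (mu : set T -> \bar R).
Proof.
move=> F mF tF mUF; apply: (@caratheodory_measure_sigma_additive R T mu) => //.
- by move=> i; exact: caratheodory_borel.
- exact: caratheodory_borel.
Qed.

(** [Lam_sigma] is what prevents mass from being lost: no countable cover of the whole space costs
    less than [1]. *)
Let outerT : mu setT = 1.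
Proof.
apply/eqP; rewrite eq_le; apply/andP; split.
  rewrite -Lam1; apply: outer1_le => //; split => //; exact: blip_cst.
by apply: le_ereal_inf_tmp => _ [g [ng gT] <-]; apply: Lam_sigma => // x; exact: gT.
Qed.

Let clamp (t : R) : R := Num.max 0%R (Num.min 1%R t).

Let clamp_sum (N : nat) (t : R) : (0 <= t)%R ->
  (\sum_(0 <= j < N) clamp (t - j%:R) = Num.min N%:R t)%R.
Proof.
move=> t0; elim: N => [|N IH]; first by rewrite big_geq//; apply/esym/min_idPl.
rewrite big_nat_recr//= IH /clamp -natr1.
by case: (leP N%:R t) => h1; case: (leP 1%R (t - N%:R)%R) => h2;
  [case: (leP 0%R 1%R)|case: (leP 0%R (t - N%:R)%R)
  |case: (leP 0%R 1%R)|case: (leP 0%R (t - N%:R)%R)] => h3;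
  case: (leP (N%:R + 1)%R t) => h4; lra.
Qed.

Let nnblip_clamp f (c : R) : blip f -> nnblip (fun x => clamp (f x - c)).
Proof.
move=> bf; split => [|x]; last by rewrite le_max lexx.
apply: blip_max; first exact: blip_cst.
by apply: blip_min; [exact: blip_cst|apply: blipB bf _; exact: blip_cst].
Qed.

(* Layer cake: [n f] is the sum of the [clamp (n f - j)], and the integral of
   each layer is at most the value of [Lam] on the previous one. *)
Lemma daniell_integral_le (P : probability T R) f n :
  (forall A, measurable A -> P A = mu A) -> nnblip f -> (forall x, (f x <= 1)%R) ->
  n.+1%:R%:E * \int[P]_x (f x)%:E <= (1 + n.+1%:R * Lam f)%:E.
Proof.
move=> PE nf f1.
pose N : R := n.+1%:R.
have N0 : (0 <= N)%R by [].
have bNf : blip (fun x => N * f x)%R by exact: blipZ nf.1.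
pose F (j : nat) x := clamp (N * f x - j%:R).
have nF j : nnblip (F j) by exact: nnblip_clamp.
have mF j : measurable_fun [set: T] (F j) by exact: blip_measurable (nF j).1.
have F1 j x : (F j x <= 1)%R by rewrite ge_max ler01 ge_min lexx.
have NfE x : (N * f x = \sum_(0 <= j < n.+1) F j x)%R.
  rewrite clamp_sum ?mulr_ge0 ?nf.2//; apply/esym/min_idPr.
  by rewrite ler_piMr.
(* The indicator of [N f > j + 1] fits between the two layers: it dominates [F j.+1] and is covered
   by [F j] alone. *)
have intF j : \int[P]_x (F j.+1 x)%:E <= (Lam (F j))%:E.
  have mU : measurable [set x | (j.+1%:R < N * f x)%R].
    have := blip_measurable bNf measurableT (measurable_itv `]j.+1%:R, +oo[).
    by rewrite setTI preimage_itvoy.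
  apply: (@le_trans _ _ (\int[P]_x (\1_[set x | (j.+1%:R < N * f x)%R] x)%:E)).
    apply: ge0_le_integral => //.
    - by move=> x _; rewrite lee_fin (nF _).2.
    - exact/measurable_EFinP.
    - exact/measurable_EFinP.
    - move=> x _; rewrite lee_fin indicE; have [//|] := boolP (x \in _).
      move=> /negP; rewrite inE /= => /negP; rewrite -leNgt => h.
      by rewrite /F /clamp ge_max lexx/= ge_min subr_le0 h orbT.
  rewrite integral_indic// setIT [leLHS](PE _ mU); apply: outer1_le => // x /= h.
  rewrite le_max le_min lexx/=; apply/orP; right.
  by rewrite lerBrDr -natr1 addrC in h *; exact: ltW.
rewrite -ge0_integralZl//; last 2 first.
- by apply/measurable_EFinP; exact: blip_measurable nf.1.
- by move=> x _; rewrite lee_fin nf.2.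
under eq_integral do rewrite -EFinM NfE -sumEFin.
rewrite ge0_integral_sum//; last 2 first.
- by move=> j; exact/measurable_EFinP.
- by move=> j x _; rewrite lee_fin (nF j).2.
rewrite big_nat_recl// EFinD; apply: leeD.
  rewrite -[leRHS](@probability_setT _ _ _ P) -[leRHS]mul1e -(integral_cst P measurableT 1).
  apply: ge0_le_integral => //.
  - by move=> x _; rewrite lee_fin (nF _).2.
  - exact/measurable_EFinP.
  - by move=> x _; rewrite lee_fin.
apply: (@le_trans _ _ (\sum_(0 <= j < n) (Lam (F j))%:E)).
  by apply: lee_sum => j _; exact: intF.
have [_ LF] := Lam_sum n.+1 nF.
have [_ Lf] := @Lam_sum (fun=> f) n.+1 (fun=> nf).
rewrite sumEFin lee_fin (_ : N * Lam f = Lam (fun x => N * f x))%R; last first.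
  rewrite (_ : (fun x => N * f x)%R = fun x => (\sum_(0 <= j < n.+1) f x)%R).
    by rewrite Lf big_const_nat subn0 iter_addr addr0 mulr_natl.
  by apply/funext => x; rewrite big_const_nat subn0 iter_addr addr0 mulr_natl.
rewrite (_ : (fun x => N * f x)%R = fun x => (\sum_(0 <= j < n.+1) F j x)%R); last exact/funext.
by rewrite LF big_nat_recr//= lerDl Lam_ge0.
Qed.

(** Dividing the layer-cake bound by [n.+1] and letting [n] grow gives [\int f <= Lam f]; the same
    inequality for [1 - f] gives equality. *)
Lemma daniell_measure : exists P : probability T R,
  forall f, nnblip f -> (forall x, (f x <= 1)%R) -> \int[P]_x (f x)%:E = (Lam f)%:E.
Proof.
have [P PE] : exists P : probability T R, forall A, measurable A -> P A = mu A.
  pose m := isMeasure.Build _ T R (mu : set T -> \bar R)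
    outer0 outer_ge0 outer_sigma_additive.
  pose M : {measure set T -> \bar R} := HB.pack (mu : set T -> \bar R) m.
  pose P : probability T R := HB.pack (mu : set T -> \bar R) m
    (Measure_isProbability.Build _ T R M outerT).
  by exists P.
exists P.
have Ifin f : nnblip f -> (forall x, (f x <= 1)%R) -> \int[P]_x (f x)%:E \is a fin_num.
  move=> nf f1; apply: (@integrable_fin_num _ _ _ P) => //; apply: Bb_integrable.
  by apply: Cb_Bb; apply: blip_Cb; exact: nf.1.
have le_int f : nnblip f -> (forall x, (f x <= 1)%R) -> \int[P]_x (f x)%:E <= (Lam f)%:E.
  move=> nf f1;  have H n := daniell_integral_le n PE nf f1.
  move: H (Ifin f nf f1); case: (\int[P]_x (f x)%:E) => // r H _.
  rewrite lee_fin leNgt; apply/negP => Lr.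
  have d0 : (0 < r - Lam f)%R by rewrite subr_gt0.
  have := H (Num.truncn (r - Lam f)^-1); rewrite -EFinM lee_fin.
  set N : R := _.+1%:R => hN.
  have : ((r - Lam f)^-1 < N)%R by exact: truncnS_gt.
  rewrite -[X in (X < _)%R]mul1r ltr_pdivrMr// mulrBr; lra.
move=> f nf f1; apply/eqP; rewrite eq_le le_int//=.
have n1 : nnblip (fun=> 1%R) by split => //; exact: blip_cst.
have ng : nnblip (fun x => 1 - f x)%R.
  by split => [|x]; [apply: blipB nf.1; exact: blip_cst|rewrite subr_ge0].
have g1 x : (1 - f x <= 1)%R by rewrite lerBlDr lerDl nf.2.
have := le_int _ ng g1.
have LE : (Lam f + Lam (fun x => 1 - f x)%R = 1)%R.
  by rewrite -LamD// -[RHS]Lam1; congr Lam; apply/funext => x; rewrite addrC subrK.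
have IE : \int[P]_x (f x)%:E + \int[P]_x (1 - f x)%:E = 1.
  rewrite -ge0_integralD//; last 4 first.
  - by move=> x _; rewrite lee_fin nf.2.
  - by apply/measurable_EFinP; exact: blip_measurable nf.1.
  - by move=> x _; rewrite lee_fin ng.2.
  - by apply/measurable_EFinP; exact: blip_measurable ng.1.
  under eq_integral do rewrite -EFinD addrC subrK.
  by rewrite -[RHS](@probability_setT _ _ _ P) -[RHS]mul1e -(integral_cst P measurableT 1).
move: IE (Ifin f nf f1) (Ifin _ ng g1); case: (\int[P]_x (f x)%:E) => // a.
case: (\int[P]_x (1 - f x)%:E) => // b; rewrite -EFinD => -[ab] _ _.
by rewrite !lee_fin; lra.
Qed.

End daniell.

(** * Limits of Cauchy sequences for the Fortet-Mourier metric *)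

Section cauchy_limit.
Context {R : realType} (X : completeMetricType R).
Local Notation T := (borel X).
Variable s : nat -> T.
Hypothesis sP : forall (x : T) (e : R), (0 < e)%R -> exists n, (mdist (s n) x < e)%R.

(* The maximum of [0] and of the tents [r - mdist (s i) x] for [i < k]. *)
Fixpoint net_fun (r : R) (k : nat) (x : T) : R :=
  if k is k'.+1 then Num.max (net_fun r k' x) (r - mdist (s k') x)%R else 0%R.

Local Notation g := net_fun.

Lemma net_fun_lip r k x y : (`|g r k x - g r k y| <= mdist x y)%R.
Proof.
elim: k => [|k IH] /=; first by rewrite subrr normr0 mdist_ge0.
apply: normr_max_dist => //.
rewrite (_ : _ - _ = mdist (s k) y - mdist (s k) x)%R; last by ring.
by rewrite (metric_sym x y); exact: mdist_lip.
Qed.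

Lemma net_fun_mono r k m x : (k <= m)%N -> (g r k x <= g r m x)%R.
Proof.
move=> /subnK <-; elim: (m - k)%N => [|j IH] //; rewrite addSn /=.
by rewrite le_max IH.
Qed.

Lemma net_fun_ge0 r k x : (0 <= g r k x)%R.
Proof. by have := @net_fun_mono r 0 k x isT. Qed.

Lemma net_fun_gt0 r k x : (0 < g r k x)%R -> exists2 i, (i < k)%N & (mdist (s i) x < r)%R.
Proof.
elim: k => [|k IH] /=; first by rewrite ltxx.
rewrite lt_max => /orP[/IH[i ik h]|h]; first by exists i => //; exact: ltnW.
by exists k => //; rewrite -subr_gt0.
Qed.

Lemma net_fun_half r x : (0 < r)%R -> exists k, (r / 2 <= g r k x)%R.
Proof.
move=> r0; have [n nx] := sP x (divr_gt0 r0 (ltr0n R 2)).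
by exists n.+1; rewrite /= le_max; apply/orP; right; lra.
Qed.

(** The cap keeps the function below [r / 2], so that for [r <= 1] it is a test function allowed by
    [cauchy_mu]. *)
Let f r k x := Num.min (r / 2)%R (g r k x).

Let f_lip r k x y : (`|f r k x - f r k y| <= mdist x y)%R.
Proof.
have := net_fun_lip r k x y; rewrite /f !ler_norml => /andP[h1 h2].
have := mdist_ge0 x y.
case: (leP (r / 2)%R (g r k x)) => ?; case: (leP (r / 2)%R (g r k y)) => ? ?;
  by apply/andP; split; lra.
Qed.

Let f_ge0 r k x : (0 < r)%R -> (0 <= f r k x)%R.
Proof. by move=> r0; rewrite le_min net_fun_ge0 divr_ge0// ltW. Qed.

Let f_le r k x : (f r k x <= r / 2)%R. Proof. by rewrite ge_min lexx. Qed.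

Let f_Cb r k : (0 < r)%R -> Cb (f r k).
Proof.
move=> r0; split.
  by apply: (@lipschitz_continuous _ _ _ 1%R) => x y; rewrite mul1r.
have h x : (`|f r k x| <= r / 2)%R by rewrite ger0_norm ?f_ge0.
exact: bounded_fun_le h.
Qed.

Let mfE r k : (0 < r)%R -> measurable_fun [set: T] (fun x => (f r k x)%:E).
Proof. by move=> r0; apply/measurable_EFinP; exact: (Cb_Bb (f_Cb k r0)).1. Qed.

Lemma net_continuous r k : continuous (g r k).
Proof. by apply: (@lipschitz_continuous _ _ _ 1%R) => x y; rewrite mul1r net_fun_lip. Qed.

Lemma closed_net r k : closed [set x | (r / 4 <= g r k x)%R].
Proof.
rewrite (_ : [set x | _] = g r k @^-1` [set y | (r / 4 <= y)%R]); last by [].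
apply: closed_comp => [x _|]; [exact: net_continuous|exact: closed_ge].
Qed.

Lemma measurable_net r k : measurable [set x | (g r k x < r / 4)%R].
Proof.
have := continuous_measurable (@net_continuous r k) measurableT (measurable_itv `]-oo, (r / 4)%R[).
by rewrite setTI preimage_itvNyo.
Qed.

Variable mu_ : nat -> probability T R.
Hypothesis cauchy_mu : forall e : R, (0 < e)%R -> exists N, forall n, (N <= n)%N ->
  forall h : T -> R, (forall x y, `|h x - h y| <= mdist x y)%R -> (forall x, `|h x| <= 1)%R ->
  (`|\int[mu_ n]_x h x - \int[mu_ N]_x h x| <= e)%R.

Let net_approx n r e : (0 < r)%R -> (0 < e)%R ->
  exists k0, forall k, (k0 <= k)%N -> (r / 2 - e <= \int[mu_ n]_x f r k x)%R.
Proof.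
move=> r0 e0.
have cvgf : \int[mu_ n]_x (f r k x)%:E @[k --> \oo] --> (r / 2)%:E.
  rewrite -[X in _ --> X]mule1 -(@probability_setT _ _ _ (mu_ n)) -(integral_cst (mu_ n) measurableT).
  rewrite [X in _ --> X](_ : _ = \int[mu_ n]_x limn (fun k => (f r k x)%:E)).
    apply: cvg_monotone_convergence => //.
    - by move=> k; exact: mfE.
    - by move=> k x _; rewrite lee_fin f_ge0.
    - move=> x _ a b ab; rewrite lee_fin le_min ge_min lexx/= ge_min.
      by rewrite net_fun_mono ?orbT.
  apply: eq_integral => x _; apply/esym/cvg_lim => //.
  have [k0 kx] := net_fun_half x r0.
  apply: (@cvg_near_cst _ _ _ _ _); exists k0 => // k /= kk.
  congr EFin; apply/min_idPl; apply: le_trans kx _; exact: net_fun_mono.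
have Ifin k : \int[mu_ n]_x (f r k x)%:E \is a fin_num.
  apply: (@integrable_fin_num _ _ _ (mu_ n)) => //; apply: Bb_integrable.
  by apply: Cb_Bb; exact: f_Cb.
have /fine_cvgP[_ /cvgrPdist_le /(_ e e0)[k0 _ H]] := cvgf.
exists k0 => k kk; have := H k kk; rewrite /= ler_distl => /andP[_ h].
by rewrite lerBlDr.
Qed.

(* The 1-Lipschitz function [min (r / 2) (g r k)] increases to [r / 2] with [k],
   so its integral is close to [r / 2] for [mu_ 0], ..., [mu_ N], hence for all
   [mu_ n] by the Cauchy property. *)
Lemma net_tight r e : (0 < r)%R -> (r <= 1)%R -> (0 < e)%R ->
  exists k, forall n, mu_ n [set x | (g r k x < r / 4)%R] <= e%:E.
Proof.
move=> r0 r1 e0.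
(* On the exceptional set [f] is at least [r / 4] below its cap, so a deficit of the integral of at
   most [w / 4] forces mass at most [e] there. *)
pose w : R := (r * e)%R.
have w0 : (0 < w)%R by rewrite mulr_gt0.
have e' : (0 < w / 8)%R by rewrite divr_gt0.
have [N NP] := cauchy_mu e'.
have [kn knP] := choice (fun n => net_approx n r0 e').
exists (\max_(i < N.+1) kn i) => n; set k := \max_(i < N.+1) _.
have key : (r / 2 - w / 4 <= \int[mu_ n]_x f r k x)%R.
  have knk (i : nat) : (i <= N)%N -> (kn i <= k)%N.
    by move=> iN; exact: (leq_bigmax (Ordinal (iN : (i < N.+1)%N))).
  have [nN|Nn] := leqP n N.
    by apply: le_trans (knP n k (knk n nN)); lra.
  have := NP n (ltnW Nn) (f r k) (f_lip r k).
  have h1 : forall x, (`|f r k x| <= 1)%R.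
    by move=> x; rewrite ger0_norm ?f_ge0//; apply: le_trans (f_le r k x) _; lra.
  move=> /(_ h1); rewrite ler_distl => /andP[h _].
  have := knP N k (knk N (leqnn _)); lra.
set A := [set x | _].
have mA : measurable A by exact: measurable_net.
have : \int[mu_ n]_x (f r k x)%:E + (r / 4)%:E * mu_ n A <= (r / 2)%:E.
  rewrite -{1}(setIT A) -integral_indic// -ge0_integralZl//; last 2 first.
  - exact/measurable_EFinP.
  - by rewrite lee_fin divr_ge0// ltW.
  rewrite -ge0_integralD//; last 4 first.
  - by move=> x _; rewrite lee_fin f_ge0.
  - exact: mfE.
  - by move=> x _; rewrite mule_ge0// lee_fin// divr_ge0// ltW.
  - by apply: measurable_funeM; exact/measurable_EFinP.
  rewrite -[leRHS]mule1 -(@probability_setT _ _ _ (mu_ n)) -(integral_cst (mu_ n) measurableT).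
  apply: ge0_le_integral => //.
  - move=> x _; apply: adde_ge0; first by rewrite lee_fin f_ge0.
    by apply: mule_ge0; rewrite lee_fin// divr_ge0// ltW.
  - apply: emeasurable_funD; first exact: mfE.
    by apply: measurable_funeM; exact/measurable_EFinP.
  - move=> x _; rewrite -EFinM -EFinD lee_fin indicE.
    have [|] := boolP (x \in A); rewrite ?mulr1 ?mulr0 ?addr0; last by move=> _; exact: f_le.
    rewrite inE /A /= => xA.
    have : (f r k x <= g r k x)%R by rewrite ge_min lexx orbT.
    lra.
have -> : \int[mu_ n]_x (f r k x)%:E = (\int[mu_ n]_x f r k x)%R%:E.
  rewrite fineK//; apply: (@integrable_fin_num _ _ _ (mu_ n)) => //; apply: Bb_integrable.
  by apply: Cb_Bb; exact: f_Cb.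
have : mu_ n A \is a fin_num by exact: fin_num_measure.
case: (mu_ n A) => // a _; rewrite -EFinM -EFinD !lee_fin => h.
have : (r / 4 * a <= r / 4 * e)%R by move: h key; rewrite /w; lra.
by rewrite ler_pM2l// divr_gt0.
Qed.

(** A point with [g] positive lies in one of [k] balls of radius [r], and an ultrafilter containing
    a finite union contains one of its members. *)
Lemma ultra_net (F : set_system T) (UF : UltraFilter F) (r : R) k :
  (0 < r)%R -> F [set x | (r / 4 <= g r k x)%R] -> exists x, F (ball x r).
Proof.
move=> r0 Fk.
have {Fk} : F [set x | exists2 i, (i < k)%N & (mdist (s i) x < r)%R].
  apply: filterS Fk => x /= h; apply: net_fun_gt0; apply: lt_le_trans h.
  by rewrite divr_gt0.
elim: k => [|k IH] Fk.
  by have [x [i]] := filter_ex Fk.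
have [h|h] := in_ultra_setVsetC [set x | (mdist (s k) x < r)%R] UF.
  by exists (s k); rewrite ballEmdist.
apply: IH; apply: filterS (filterI Fk h) => x [/= [i ik ix] nx].
exists i => //; move: ik; rewrite ltnS leq_eqVlt => /predU1P[ik|//].
by case: nx; rewrite -ik.
Qed.

(** [K] intersects closed sets covered by finitely many balls of radius [1 / (m + 1)], the [m]-th
    missing mass at most [e / 2^(m+1)]. Ultrafilters on [K] are thus Cauchy, hence converge by
    completeness. *)
Lemma cauchy_tight e : (0 < e)%R -> exists K : set T,
  [/\ compact K, measurable K & forall n, mu_ n (~` K) <= e%:E].
Proof.
move=> e0.
pose r (m : nat) : R := (m.+1%:R^-1)%R.
have r0 m : (0 < r m)%R by rewrite invr_gt0.
have r1 m : (r m <= 1)%R by rewrite invf_le1// ler1n.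
have em m : (0 < e / (2 ^ m.+1)%:R)%R by rewrite divr_gt0// ltr0n expn_gt0.
have [k kP] := choice (fun m => net_tight (r0 m) (r1 m) (em m)).
pose A m := [set x | (r m / 4 <= g (r m) (k m) x)%R].
have AC m : ~` A m = [set x | (g (r m) (k m) x < r m / 4)%R].
  by apply/seteqP; split => x /=; [move=> /negP|move=> ?; apply/negP]; rewrite -ltNge.
have mAC m : measurable (~` A m) by rewrite AC; exact: measurable_net.
have mA m : measurable (A m) by rewrite -[A m]setCK; exact: measurableC.
have clK : closed (\bigcap_m A m) by apply: closed_bigI => m _; exact: closed_net.
exists (\bigcap_m A m); split.
- rewrite compact_ultra => F UF FK.
  have cF : cauchy F.
    apply: cauchy_exP => eps eps0.
    have [m _ /(_ m (leqnn _)) /= mr] := near_infty_natSinv_lt (PosNum eps0).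
    have [|x Fx] := @ultra_net F UF (r m) (k m) (r0 m).
      by apply: filterS FK => x /(_ m); exact.
    by exists x; apply: filterS Fx; apply: le_ball; exact: ltW.
  have FL : F --> lim F by exact: cauchy_cvg.
  exists (lim F); split => //.
  suff : closure (\bigcap_m A m) (lim F) by rewrite -((closure_id _).1 clK).
  move=> B /FL FB.
  by have [x] := filter_ex (filterI FK FB); exists x.
- by apply: bigcapT_measurable.
- move=> n; rewrite setC_bigcap.
  apply: (@le_trans _ _ (\sum_(m <oo) mu_ n (~` A m))).
    apply: measure_sigma_subadditive => //.
    by apply: bigcupT_measurable.
  apply: le_trans (epsilon_trick0 xpredT (ltW e0)).
  by apply: lee_nneseries => m _ //; rewrite AC; exact: kP.
Qed.

Definition limit_functional (h : T -> R) : R := limn (fun n => \int[mu_ n]_x h x)%R.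
Local Notation Lam := limit_functional.

Let intb n (h : T -> R) : Bb h -> (mu_ n).-integrable setT (EFin \o h).
Proof. exact: Bb_integrable. Qed.

Let blip_Bb (h : T -> R) : blip h -> Bb h. Proof. by move=> /blip_Cb/Cb_Bb. Qed.

(** Dividing [h] by a constant makes it a test function of the Cauchy hypothesis. *)
Lemma cvg_limit_functional (h : T -> R) : blip h -> (\int[mu_ n]_x h x)%R @[n --> \oo] --> Lam h.
Proof.
move=> bh; have [c0 hc] := bh.
pose c := (`|c0| + 1)%R; have cp : (0 < c)%R by rewrite ltr_wpDl.
have c0c : (c0 <= c)%R by rewrite (le_trans (ler_norm _))// lerDl.
apply: (@cauchy_cvg R); apply: cauchy_exP => e e0.
have ec : (0 < e / (2 * c))%R by rewrite divr_gt0// mulr_gt0.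
have [N NP] := cauchy_mu ec.
exists (\int[mu_ N]_x h x)%R; exists N => // n /= Nn.
have := NP n Nn (fun x => c^-1 * h x)%R.
have h1 x y : (`|c^-1 * h x - c^-1 * h y| <= mdist x y)%R.
  rewrite -mulrBr normrM gtr0_norm ?invr_gt0// mulrC ler_pdivrMr// mulrC.
  by apply: le_trans (hc x y).2 _; rewrite ler_wpM2r// mdist_ge0.
have h2 x : (`|c^-1 * h x| <= 1)%R.
  rewrite normrM gtr0_norm ?invr_gt0// mulrC ler_pdivrMr// mul1r.
  exact: le_trans (hc x x).1 _.
move=> /(_ h1 h2); rewrite !RintegralZl//; [|exact: intb (blip_Bb bh)..].
rewrite -mulrBr normrM gtr0_norm ?invr_gt0// mulrC ler_pdivrMr// => H.
rewrite /ball /= distrC; apply: le_lt_trans H _.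
rewrite (_ : e / (2 * c) * c = e / 2)%R; last by field; rewrite gt_eqF.
by rewrite ltr_pdivrMr// ltr_pMr// ltr1n.
Qed.

Let Lam_cvg (h : T -> R) : blip h -> cvgn (fun n => \int[mu_ n]_x h x)%R.
Proof. by move=> /cvg_limit_functional; exact: cvgP. Qed.

Let LamD (h1 h2 : T -> R) : nnblip h1 -> nnblip h2 ->
  Lam (fun x => h1 x + h2 x)%R = (Lam h1 + Lam h2)%R.
Proof.
move=> [b1 _] [b2 _]; apply/cvg_lim => //.
rewrite (_ : (fun n => _) = (fun n => \int[mu_ n]_x h1 x + \int[mu_ n]_x h2 x)%R).
  by apply: cvgD; exact: cvg_limit_functional.
by apply/funext => n; rewrite RintegralD//; exact: intb (blip_Bb _).
Qed.

Let Lam_ge (h : T -> R) (a : R) : blip h -> (forall n, a <= \int[mu_ n]_x h x)%R ->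
  (a <= Lam h)%R.
Proof. by move=> bh ah; apply: limr_ge; [exact: Lam_cvg|exact: nearW]. Qed.

Let Lam_sum (h : nat -> T -> R) k : (forall i, nnblip (h i)) ->
  nnblip (fun x => \sum_(0 <= i < k) h i x)%R /\
  Lam (fun x => \sum_(0 <= i < k) h i x)%R = (\sum_(0 <= i < k) Lam (h i))%R.
Proof.
move=> nh; elim: k => [|k [nS IH]].
  rewrite (_ : (fun x => _) = fun=> 0%R); last by apply/funext => x; rewrite big_geq.
  split; first by split => //; exact: blip_cst.
  rewrite big_geq//; apply/cvg_lim => //.
  rewrite (_ : (fun n => _) = cst 0%R); first exact: cvg_cst.
  by apply/funext => n; rewrite /Rintegral integral0.
rewrite (_ : (fun x => _) = fun x => (\sum_(0 <= i < k) h i x + h k x)%R); last first.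
  by apply/funext => x; rewrite big_nat_recr.
rewrite big_nat_recr//= LamD// IH; split => //; split => [|x].
  exact: blipD nS.1 (nh k).1.
by rewrite addr_ge0 ?nS.2 ?(nh k).2.
Qed.

(* Dini's theorem on a compact set carrying most of the mass of every [mu_ n]. *)
Let Lam_sigma (h : nat -> T -> R) : (forall i, nnblip (h i)) ->
  (forall x, 1 <= \sum_(i <oo) (h i x)%:E) -> 1 <= \sum_(i <oo) (Lam (h i))%:E.
Proof.
move=> nh h1.
have L0 i : (0 <= Lam (h i))%R.
  by apply: Lam_ge => [|n]; [exact: (nh i).1|apply: Rintegral_ge0 => x _; exact: (nh i).2].
suff H e : (0 < e)%R -> (e < 1)%R -> (1 - 2 * e)%:E <= \sum_(i <oo) (Lam (h i))%:E.
  apply/lee_subgt0Pr => e e0.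
  have e0' : (0 < Num.min (e / 2) (1 / 2))%R by rewrite lt_min !divr_gt0.
  have e1' : (Num.min (e / 2) (1 / 2) < 1)%R by rewrite gt_min; apply/orP; right; lra.
  apply: le_trans (H _ e0' e1'); rewrite -EFinB lee_fin.
  have : (Num.min (e / 2) (1 / 2) <= e / 2)%R by rewrite ge_min lexx.
  lra.
move=> e0 e1; have [K [cK mK KP]] := cauchy_tight e0.
pose G k x := (\sum_(0 <= i < k) h i x)%R.
have bG k : nnblip (G k) by exact: (Lam_sum k nh).1.
have Gmono k m x : (k <= m)%N -> (G k x <= G m x)%R.
  move=> km; rewrite /G (big_cat_nat (leq0n k) km)/= lerDl sumr_ge0// => i _; exact: (nh i).2.
have [k Gk] : exists k, forall x, K x -> (1 - e < G k x)%R.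
  move: cK; rewrite compact_cover => /(_ nat setT (fun k => [set x | (1 - e < G k x)%R])).
  case.
  - move=> k _; rewrite (_ : [set x | _] = G k @^-1` [set y | (1 - e < y)%R]); last by [].
    apply: open_comp => [x _|]; last exact: open_gt.
    exact: (blip_Cb (bG k).1).1.
  - move=> x _; have := h1 x => hx; apply: contrapT => nex.
    have : \sum_(i <oo) (h i x)%:E <= (1 - e)%:E.
      apply: lime_le; first by apply: is_cvg_nneseries => i _ _; rewrite lee_fin (nh i).2.
      apply: nearW => k; rewrite sumEFin lee_fin leNgt; apply/negP => hk.
      by apply: nex; exists k.
    by move=> /(le_trans hx); rewrite lee_fin; lra.
  move=> D' _ KD; exists (\max_(i <- finmap.enum_fset D') i) => x /KD[i /= iD' ix].
  by apply: lt_le_trans ix _; apply: Gmono; exact: (@leq_bigmax_seq _ _ xpredT (fun i => i)). 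
(* [G k] exceeds [1 - e] on [K], whose mass is at least [1 - e], and [(1 - e)^2 >= 1 - 2 e]. *)
have LG : (1 - 2 * e <= Lam (G k))%R.
  apply: Lam_ge => [|n]; first exact: (bG k).1.
  have KK : (mu_ n K = 1 - mu_ n (~` K)) by rewrite -[in LHS](setCK K) probability_setC//; exact: measurableC.
  have fK : mu_ n (~` K) \is a fin_num by apply: fin_num_measure; exact: measurableC.
  rewrite -lee_fin fineK; last first.
    apply: (@integrable_fin_num _ _ _ (mu_ n)) => //; apply: intb.
    exact: blip_Bb (bG k).1.
  apply: (@le_trans _ _ (\int[mu_ n]_x ((1 - e)%:E * (\1_K x)%:E))); last first.
    apply: ge0_le_integral => //.
    - by move=> x _; apply: mule_ge0; rewrite lee_fin// subr_ge0 ltW.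
    - by apply: measurable_funeM; exact/measurable_EFinP.
    - by apply/measurable_EFinP; exact: blip_measurable (bG k).1.
    - move=> x _; rewrite -EFinM lee_fin indicE; have [|_] := boolP (x \in K).
        by rewrite inE mulr1 => /Gk/ltW.
      by rewrite mulr0 (bG k).2.
  rewrite ge0_integralZl//; last 2 first.
  - exact/measurable_EFinP.
  - by rewrite lee_fin subr_ge0 ltW.
  rewrite integral_indic// setIT.
  apply: (@le_trans _ _ ((1 - e)%:E * mu_ n K)); last exact: lexx.
  rewrite KK.
  have := KP n; move: fK; case: (mu_ n (~` K)) => // a _; rewrite lee_fin => ae.
  rewrite -EFinB -EFinM lee_fin; nra.
apply: le_trans (nneseries_lim_ge k _); last by move=> i _; rewrite lee_fin.
by rewrite sumEFin lee_fin -(Lam_sum k nh).2.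
Qed.

Hypothesis sepX : separable X.

Lemma cauchy_limit : exists P : probability T R, forall h : T -> R, blip h ->
  (\int[mu_ n]_x h x)%R @[n --> \oo] --> (\int[P]_x h x)%R.
Proof.
have Lam_ge0 h : nnblip h -> (0 <= Lam h)%R.
  by move=> [bh h0]; apply: Lam_ge => // n; apply: Rintegral_ge0.
have intc (P : probability T R) (a : R) : (\int[P]_x a = a)%R.
  by rewrite Rintegral_cst// -[RHS]mulr1; congr (_ * _)%R; exact: (congr1 fine (probability_setT P)).
have Lam1 : Lam (fun=> 1%R) = 1%R.
  apply/cvg_lim => //; rewrite (_ : (fun n => (\int[mu_ n]_x 1)%R) = cst (1%R : R)); first exact: cvg_cst.
  by apply/funext => n; rewrite intc.
have [P PL] := daniell_measure LamD Lam_ge0 Lam1 Lam_sigma sepX.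
exists P => h bh; rewrite (_ : (\int[P]_x h x)%R = Lam h); first exact: cvg_limit_functional.
have [c0 hc] := bh; pose c := (`|c0| + 1)%R; have cp : (0 < c)%R by rewrite ltr_wpDl.
have hcc x : (`|h x| <= c)%R.
  by apply: le_trans (hc x x).1 _; rewrite (le_trans (ler_norm _))// lerDl.
(* The Daniell measure represents [Lam] on functions with values in [[0, 1]]; an affine change
   brings [h] there. *)
pose f1 x := ((h x + c) / (2 * c))%R.
have c2 : (0 < 2 * c)%R by rewrite mulr_gt0.
have nf1 : nnblip f1.
  split => [|x].
    rewrite (_ : f1 = fun x => (2 * c)^-1 * (h x + c))%R; last by apply/funext => x; rewrite mulrC.
    by apply: blipZ; apply: blipD => //; exact: blip_cst.
  have := hcc x; rewrite ler_norml => /andP[? ?]; rewrite divr_ge0//; lra.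
have f11 x : (f1 x <= 1)%R.
  by have := hcc x; rewrite ler_norml => /andP[? ?]; rewrite ler_pdivrMr//; lra.
have hE : h = (fun x => (2 * c) * f1 x - c)%R.
  by apply/funext => x; rewrite /f1; field; rewrite gt_eqF.
have IE (M : probability T R) : (\int[M]_x h x = (2 * c) * \int[M]_x f1 x - c)%R.
  have if1 : M.-integrable setT (EFin \o f1) by apply: Bb_integrable; exact: blip_Bb nf1.1.
  rewrite {1}hE RintegralB//; last 2 first.
  - by apply: Bb_integrable; apply: blip_Bb; exact: blipZ nf1.1.
  - by apply: Bb_integrable; apply: blip_Bb; exact: blip_cst.
  by rewrite RintegralZl// intc.
rewrite IE; apply/esym/cvg_lim => //.
under eq_fun do rewrite IE.
apply: cvgB; last exact: cvg_cst.
apply: cvgM; first exact: cvg_cst.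
by rewrite /Rintegral (PL _ nf1 f11) /=; exact: cvg_limit_functional nf1.1.
Qed.

End cauchy_limit.

(** * Borel sets and supports on the square *)

Section square.
Context {R : realType} (X : completeMetricType R).
Local Notation T := (borel X).
Local Notation S := (T * T)%type.
Hypothesis sepX : separable X.

Lemma open_square_measurable (U : set S) : open U -> measurable U.
Proof.
move=> oU; have := measurable_borel_square sepX.
by move=> /(congr1 (fun M : set (set S) => M U)) ->; exact: sub_sigma_algebra.
Qed.

Lemma continuous_mdist : continuous (fun z : S => mdist z.1 z.2 : R).
Proof.
move=> [u v]; apply/cvgrPdist_lt => e e0 /=.
have e2 : (0 < e / 2)%R by rewrite divr_gt0.
exists (ball u (e / 2)%R, ball v (e / 2)%R) => /=; first by split; exact: nbhsx_ballx.
move=> [u' v'] /= []; rewrite !ballEmdist /= => uu vv.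
have h1 := metric_triangle u u' v; have h2 := metric_triangle u' v' v.
have h3 := metric_triangle u' u v'; have h4 := metric_triangle u v v'.
rewrite (metric_sym v' v) in h2; rewrite (metric_sym u' u) in h3.
rewrite ltr_distl; apply/andP; split; lra.
Qed.

Lemma measurable_mdist : measurable_fun [set: S] (fun z : S => mdist z.1 z.2 : R).
Proof.
apply: (measurability _ (RGenOInfty.measurableE R)) => // _ [_ [x ->] <-].
rewrite setTI; apply: open_square_measurable.
by apply: open_comp => [y _|]; [exact: continuous_mdist|exact: interval_open].
Qed.

(** Each point off the support has a null neighbourhood containing one of countably many boxes
    around the point, so the complement of [F] lies in a countable union of null boxes. *)
Lemma measure_support_null (mu : {measure set S -> \bar R}) (F : set S) :
  measurable F -> measure_support mu `<=` F -> mu (~` F) = 0.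
Proof.
move=> mF suppF; have [s sP] := dense_sequence sepX.
pose e (m : nat) : R := (m.+1%:R^-1)%R.
have oball n m : open ((ball (s n) (e m))° : set T) by exact: open_interior.
pose box (i : nat * nat * nat) : set S :=
  (ball (s i.1.1) (e i.2))° `*` (ball (s i.1.2) (e i.2))°.
have obox i : open (box i).
  rewrite (_ : box i = fst @^-1` (ball (s i.1.1) (e i.2))° `&`
      snd @^-1` (ball (s i.1.2) (e i.2))°); last by [].
  by apply: openI; apply: open_comp => // z _; [exact: cvg_fst|exact: cvg_snd].
have mbox i : measurable (box i) by exact: open_square_measurable.
pose N i := if mu (box i) == 0 then box i else set0.
have mN i : measurable (N i) by rewrite /N; case: ifPn.
have N0 i : mu (N i) = 0 by rewrite /N; case: ifPn => [/eqP|_] //; rewrite measure0.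
have FN : ~` F `<=` \bigcup_(n in [set: nat]) odflt set0 (omap N (unpickle n)).
  move=> [u v] nF.
  have /existsNP[U /not_implyP[oU /not_implyP[Uuv]]] : ~ measure_support mu (u, v).
    by move=> /suppF.
  move=> /negP; rewrite -leNgt => muU.
  have [[A B] /= [nA nB] ABU] := oU _ Uuv.
  have /nbhs_ballP[r1 /= r1_gt0 rA] := nA.
  have /nbhs_ballP[r2 /= r2_gt0 rB] := nB.
  have r_gt0 : (0 < Num.min r1 r2 / 2)%R by rewrite divr_gt0// lt_min r1_gt0.
  have [m _ /(_ m (leqnn _)) /= mr] := near_infty_natSinv_lt (PosNum r_gt0).
  have em : (0 < e m)%R by rewrite invr_gt0.
  have [n1 un] := sP u (e m) em; have [n2 vn] := sP v (e m) em.
  have inball (x : T) n : (mdist (s n) x < e m)%R -> (ball (s n) (e m))° x.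
    move=> nx; apply/nbhs_ballP; exists (e m - mdist (s n) x)%R => /=; first by rewrite subr_gt0.
    move=> y; rewrite !ballEmdist /= => xy.
    by apply: le_lt_trans (metric_triangle (s n) x y) _; rewrite -ltrBrDl.
  have sub (x : T) n r : (Num.min r1 r2 <= r)%R -> (mdist (s n) x < e m)%R ->
      (ball (s n) (e m))° `<=` ball x r.
    move=> rr nx y /interior_subset; rewrite !ballEmdist /= => ny.
    apply: le_lt_trans (metric_triangle x (s n) y) _.
    rewrite (metric_sym x (s n)); apply: lt_le_trans (ltrD nx ny) _.
    by apply: le_trans rr; rewrite [leRHS]splitr; apply: ltW; exact: ltrD.
  exists (pickle (n1, n2, m)) => //; rewrite pickleK /= /N.
  have -> : mu (box (n1, n2, m)) == 0.
    apply/eqP/le_anti/andP; split=> //; apply: le_trans muU.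
    apply: le_measure; rewrite ?inE//; first exact: open_square_measurable.
    move=> [a b] [/= ha hb]; apply: ABU; split => /=.
      by apply: rA; apply: (sub u n1) ha => //; rewrite ge_min lexx.
    by apply: rB; apply: (sub v n2) hb => //; rewrite ge_min lexx orbT.
  by split => /=; exact: inball.
have mG n : measurable (odflt set0 (omap N (unpickle n))) by case: unpickle => /=.
apply/le_anti/andP; split=> //.
apply: le_trans (measure_sigma_subadditive _ mG _ FN) _ => //; first exact: measurableC.
rewrite eseries0// => n _ _; case: unpickle => //=.
Qed.

End square.

(** * The weighted contraction estimate *)

Section coupling_step.
Context {R : realType} (X : completeMetricType R).
Local Notation T := (borel X).
Local Notation S := (T * T)%type.
Variables (p : R.-pker T ~> T) (B : R.-pker S ~> S).
Hypothesis B_fst : forall z A, measurable A -> B z (A `*` setT) = p z.1 A.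
Hypothesis B_snd : forall z A, measurable A -> B z (setT `*` A) = p z.2 A.

Lemma ge0_integral_fst z (g : T -> \bar R) : measurable_fun [set: T] g ->
  (forall x, 0 <= g x) -> \int[B z]_u g u.1 = \int[p z.1]_x g x.
Proof.
move=> mg g0.
rewrite (@integral_mixture _ _ _ _ _ (B z) setT (fun u => \d_u.1))//.
- by apply: eq_integral => u _; rewrite integral_dirac// diracT mul1e.
- move=> A mA.
  have mh : measurable_fun [set: T] (fun x : T => \d_x A : \bar R) by exact/measurable_EFinP.
  exact: measurableT_comp mh measurable_fst.
- move=> A mA; rewrite -B_fst//.
  rewrite -[in LHS](setIT (_ `*` _)) -integral_indic//; last exact: measurableX.
  apply: eq_integral => u _; by rewrite [RHS]diracE indicE in_setX in_setT /= ?andbT.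
Qed.

Lemma ge0_integral_snd z (g : T -> \bar R) : measurable_fun [set: T] g ->
  (forall x, 0 <= g x) -> \int[B z]_u g u.2 = \int[p z.2]_x g x.
Proof.
move=> mg g0.
rewrite (@integral_mixture _ _ _ _ _ (B z) setT (fun u => \d_u.2))//.
- by apply: eq_integral => u _; rewrite integral_dirac// diracT mul1e.
- move=> A mA.
  have mh : measurable_fun [set: T] (fun x : T => \d_x A : \bar R) by exact/measurable_EFinP.
  exact: measurableT_comp mh measurable_snd.
- move=> A mA; rewrite -B_snd//.
  rewrite -[in LHS](setIT (_ `*` _)) -integral_indic//; last exact: measurableX.
  apply: eq_integral => u _; by rewrite [RHS]diracE indicE in_setX in_setT /= ?andbT.
Qed.

(** The marginals turn both integrals of [g] into integrals against [B z]. Shifting by a bound [c]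
    makes all integrands nonnegative, and two one-sided inequalities avoid subtracting extended
    reals. *)
Lemma integral_coupling_le z (g : T -> R) : Bb g ->
  `|(\int[p z.1]_x g x - \int[p z.2]_x g x)%R|%:E <= \int[B z]_u `|g u.1 - g u.2|%:E.
Proof.
move=> Bg; have [c c0 gc] := Bb_bound Bg.
have mg := Bg.1.
have mg1 : measurable_fun [set: S] (fun u => g u.1) by exact: measurableT_comp mg measurable_fst.
have mg2 : measurable_fun [set: S] (fun u => g u.2) by exact: measurableT_comp mg measurable_snd.
have gc0 x : (0 <= g x + c)%R by have := gc x; rewrite ler_norml => /andP[]; lra.
have mgc : measurable_fun [set: T] (fun x => (g x + c)%:E).
  by apply/measurable_EFinP; exact: measurable_funD.
have intE x : \int[p x]_y (g y + c)%:E = (\int[p x]_y g y + c)%R%:E.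
  under eq_integral do rewrite EFinD.
  rewrite integralD//; last 2 first.
  - exact: Bb_kernel_integrable.
  - apply: (@Bb_kernel_integrable _ _ p x (fun=> c)); apply: Cb_Bb; apply: blip_Cb; exact: blip_cst.
  rewrite (integral_cst (p x) measurableT c%:E) prob_kernel mule1 EFinD; congr (_ + _).
  by rewrite fineK//; apply: integrable_fin_num => //; exact: Bb_kernel_integrable.
have le1 : \int[p z.1]_x (g x + c)%:E <= \int[p z.2]_x (g x + c)%:E + \int[B z]_u `|g u.1 - g u.2|%:E.
  rewrite -(@ge0_integral_fst z)// -(@ge0_integral_snd z)//.
  rewrite -ge0_integralD//; last 3 first.
  - by move=> u _; rewrite lee_fin.
  - by apply/measurable_EFinP; exact: measurable_funD.
  - by apply/measurable_EFinP; apply: measurableT_comp => //; exact: measurable_funB.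
  apply: ge0_le_integral => //.
  - by move=> u _; rewrite lee_fin.
  - by apply/measurable_EFinP; exact: measurable_funD.
  - apply: emeasurable_funD; apply/measurable_EFinP; first exact: measurable_funD.
    by apply: measurableT_comp => //; exact: measurable_funB.
  - move=> u _; rewrite -EFinD lee_fin.
    by have := ler_norm (g u.1 - g u.2); lra.
have le2 : \int[p z.2]_x (g x + c)%:E <= \int[p z.1]_x (g x + c)%:E + \int[B z]_u `|g u.1 - g u.2|%:E.
  rewrite -(@ge0_integral_snd z)// -(@ge0_integral_fst z)//.
  rewrite -ge0_integralD//; last 3 first.
  - by move=> u _; rewrite lee_fin.
  - by apply/measurable_EFinP; exact: measurable_funD.
  - by apply/measurable_EFinP; apply: measurableT_comp => //; exact: measurable_funB.
  apply: ge0_le_integral => //.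
  - by move=> u _; rewrite lee_fin.
  - by apply/measurable_EFinP; exact: measurable_funD.
  - apply: emeasurable_funD; apply/measurable_EFinP; first exact: measurable_funD.
    by apply: measurableT_comp => //; exact: measurable_funB.
  - move=> u _; rewrite -EFinD lee_fin.
    by have := ler_norm (g u.2 - g u.1); rewrite distrC; lra.
move: le1 le2; rewrite !intE.
have : 0 <= \int[B z]_u `|g u.1 - g u.2|%:E by apply: integral_ge0 => u _; rewrite lee_fin.
case: (\int[B z]_u _) => [b| |] //; last by move=> *; exact: leey.
rewrite -!EFinD !lee_fin ler_distl => _ *; apply/andP; split; lra.
Qed.

End coupling_step.

Section contraction_estimate.
Context {R : realType} (X : completeMetricType R).
Local Notation T := (borel X).
Local Notation S := (T * T)%type.
Variables (sepX : separable X) (p : R.-pker T ~> T) (Q : R.-spker S ~> S).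
Hypothesis Q1 : forall (x y : T) (A : set T), measurable A -> Q (x, y) (A `*` setT) <= p x A.
Hypothesis Q2 : forall (x y : T) (A : set T), measurable A -> Q (x, y) (setT `*` A) <= p y A.
Variables (L : T -> R) (lambda c : R).
Hypotheses (L_ge0 : forall x, (0 <= L x)%R) (L_continuous : continuous L).
Hypothesis L_infty : ~ metric_bounded [set: T] -> tends_to_infinity L.
Hypotheses (lambda_gt0 : (0 < lambda)%R) (lambda_lt1 : (lambda < 1)%R) (c_gt0 : (0 < c)%R).
Hypothesis A1 : forall x, \int[p x]_y (L y)%:E <= (lambda * L x + c)%:E.
Variables (F : set S) (alpha : R).
Hypotheses (mF : measurable F) (alpha_gt0 : (0 < alpha)%R) (alpha_lt1 : (alpha < 1)%R).
Hypothesis A2_support : forall x y, F (x, y) -> measure_support (Q (x, y)) `<=` F.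
Hypothesis A2_contract : forall x y, F (x, y) ->
  \int[Q (x, y)]_u (mdist u.1 u.2)%:E <= (alpha * mdist x y)%:E.
Variables (delta l nu : R).
Hypotheses (delta_gt0 : (0 < delta)%R) (l_gt0 : (0 < l)%R)
  (nu_gt0 : (0 < nu)%R) (nu_le1 : (nu <= 1)%R).
Hypothesis A3_mass : forall x y, F (x, y) ->
  1 - Q (x, y) setT <= (l * mdist x y `^ nu)%:E.
Hypothesis A3_close : forall x y, F (x, y) ->
  delta%:E <= Q (x, y) [set u | (mdist u.1 u.2 <= alpha * mdist x y)%R].
Variables (dW : measure_display) (W : measurableType dW) (Pr : S -> probability W R)
  (Z : nat -> W -> S).
Hypothesis chainZ : forall z : S, markov_chain (coupling p Q) z (Pr z) Z.
Variables (beta Ct r : R).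
Hypotheses (beta_gt0 : (0 < beta)%R) (beta_lt1 : (beta < 1)%R) (r_gt0 : (0 < r)%R).
Hypothesis A4 : forall x y, (L x + L y < 4 * c / (1 - lambda))%R ->
  \int[Pr (x, y)]_w inv_pow beta (hitting_time
    [set z | F z /\ (L z.1 + L z.2 < r)%R] (fun n => Z n w)) <= Ct%:E.

Let LL (z : S) := (L z.1 + L z.2)%R.
Let D : set S := [set z | F z /\ (LL z < r)%R].
Let e (z : S) : R := mdist z.1 z.2.
Let a : R := (4 * c / (1 - lambda))%R.

Let mL : measurable_fun [set: T] L. Proof. exact: continuous_measurable. Qed.

Let mLL : measurable_fun [set: S] LL.
Proof.
by apply: measurable_funD; [exact: measurableT_comp mL measurable_fst
  |exact: measurableT_comp mL measurable_snd].
Qed.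

Let LL0 z : (0 <= LL z)%R. Proof. by rewrite addr_ge0. Qed.

Let mD : measurable D.
Proof.
rewrite (_ : D = F `&` LL @^-1` `]-oo, r[).
  by apply: measurableI => //; rewrite -[X in measurable X]setTI; exact: mLL.
by rewrite preimage_itvNyo.
Qed.

Let lam1 : (0 < 1 - lambda)%R. Proof. by rewrite subr_gt0. Qed.
Let a0 : (0 < a)%R. Proof. by rewrite divr_gt0// mulr_gt0. Qed.
Let ca : (c / a = (1 - lambda) / 4)%R.
Proof. by rewrite /a; field; rewrite !gt_eqF. Qed.

(** [L < r] at both points confines them to a ball; this is how [L] tending to infinity enters. *)
Let D_bounded : exists d0, forall z, D z -> (e z <= d0)%R.
Proof.
have [[M HM]|unb] := pselect (metric_bounded [set: T]).
  by exists M => z _; exact: HM.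
have [s sP] := L_infty unb point r.
exists (s + s)%R => -[x y] [_]; rewrite /LL /e /= => Lr.
have near0 w : (L w < r)%R -> (mdist point w <= s)%R.
  by move=> Lw; rewrite leNgt; apply/negP => /sP; rewrite ltNge (ltW Lw).
apply: le_trans (metric_triangle x point y) _.
rewrite (metric_sym x point); apply: lerD; apply: near0; apply: le_lt_trans Lr.
  by rewrite lerDl.
by rewrite lerDr.
Qed.

Lemma contraction_estimate : exists q C : R, [/\ (0 < q)%R, (q < 1)%R, (0 < C)%R &
  forall g : nat -> T -> R, (forall n, Bb (g n)) ->
  (forall n x, g n.+1 x = \int[p x]_y g n y)%R ->
  (forall x y, `|g 0%N x - g 0%N y| <= Num.min 2 (mdist x y))%R ->
  forall n x y, (`|g n x - g n y| <= q ^+ n * C * (1 + L x + L y))%R].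
Proof.
have Q1' z A : measurable A -> Q z (A `*` setT) <= p z.1 A.
  by case: z => x y; exact: Q1.
have Q2' z A : measurable A -> Q z (setT `*` A) <= p z.2 A.
  by case: z => x y; exact: Q2.
have [B KB QB] := coupling_kernel Q1' Q2'.
have B_fst z A : measurable A -> B z (A `*` setT) = p z.1 A.
  by move=> mA; rewrite -KB ?coupling_fst//; exact: measurableX.
have B_snd z A : measurable A -> B z (setT `*` A) = p z.2 A.
  by move=> mA; rewrite -KB ?coupling_snd//; exact: measurableX.
have B1 z : B z setT = 1 by exact: prob_kernel.
have [d0 dD] := D_bounded.
have ILL z : \int[B z]_u (LL u)%:E <= (lambda * LL z + 2 * c)%:E.
  under eq_integral do rewrite EFinD.
  rewrite ge0_integralD//; last 4 first.
  - by move=> u _; rewrite lee_fin.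
  - by apply/measurable_EFinP; exact: measurableT_comp mL measurable_fst.
  - by move=> u _; rewrite lee_fin.
  - by apply/measurable_EFinP; exact: measurableT_comp mL measurable_snd.
  rewrite (@ge0_integral_fst _ _ p B B_fst z (fun x => (L x)%:E))//; last first.
    exact/measurable_EFinP.
  rewrite (@ge0_integral_snd _ _ p B B_snd z (fun x => (L x)%:E))//; last first.
    exact/measurable_EFinP.
  apply: le_trans (leeD (A1 _) (A1 _)) _.
  by rewrite -EFinD lee_fin /LL le_eqVlt; apply/orP; left; apply/eqP; ring.
(* [rho] must be at least [beta] for (A4) to apply, and at least [(3 + lambda) / 4], the rate at
   which [1 + LL / a] contracts in mean when [LL >= a]. *)
pose rho := Num.max beta ((3 + lambda) / 4)%R.
have rho_beta : (beta <= rho)%R by rewrite le_max lexx.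
have rho_lam : ((3 + lambda) / 4 <= rho)%R by rewrite le_max lexx orbT.
have rho0 : (0 < rho)%R by exact: lt_le_trans rho_beta.
have rho1 : (rho < 1)%R by rewrite gt_max beta_lt1/=; move: lambda_lt1; lra.
pose V := hitting_weight B D rho.
have V1 m z : (1 <= V m z)%R by exact: hitting_weight_ge1.
have mV m : measurable_fun [set: S] (V m) by exact: (measurable_hitting_weight B mD rho0 rho1 m).1.
pose C1 := Num.max Ct 1%R.
have C11 : (1 <= C1)%R by rewrite le_max lexx orbT.
have C10 : (0 <= C1)%R by exact: le_trans C11.
have C1t : (Ct <= C1)%R by rewrite le_max lexx.
(* A majorant of all the [V m]. [C1] is at least [Ct], for the region covered by (A4), and at least
   [1], the value of [V] on [D] and at [m = 0]. *)
pose U z := (C1 * (1 + LL z / a))%R.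
have U1 z : (C1 <= U z)%R by rewrite ler_peMr// lerDl divr_ge0// ltW.
have IU z : \int[B z]_u (U u)%:E <= (C1 * (1 + (lambda * LL z + 2 * c) / a))%:E.
  rewrite (_ : (fun u => (U u)%:E) = fun u => C1%:E + (C1 / a)%:E * (LL u)%:E); last first.
    by apply/funext => u; rewrite -EFinM -EFinD; congr EFin; rewrite /U; ring.
  have Ca : (0 <= C1 / a)%R by rewrite divr_ge0// ltW.
  have LLE0 u : 0 <= (LL u)%:E by rewrite lee_fin.
  have mLLE : measurable_fun [set: S] (fun u => (LL u)%:E) by exact/measurable_EFinP.
  rewrite ge0_integralD//; last 2 first.
  - by move=> u _; apply: mule_ge0.
  - exact: measurable_funeM.
  rewrite (integral_cst (B z) measurableT C1%:E) B1 mule1 ge0_integralZl//.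
  apply: le_trans (leeD2l _ (lee_wpmul2l _ (ILL z))) _; first by rewrite lee_fin.
  by rewrite -EFinM -EFinD lee_fin le_eqVlt; apply/orP; left; apply/eqP; ring.
(* Three regions: (A4) for [LL z < a]; [V = 1] on [D]; elsewhere one step of the recursion, where
   the drift of [LL] contracts [U] by the factor [rho]. *)
have VU m z : (V m z <= U z)%R.
  elim: m z => [|m IH] z; first exact: le_trans (U1 z).
  have [za|az] := ltP (LL z) a.
    apply: le_trans (le_trans C1t (U1 z)).
    apply: (@hitting_weight_le _ _ _ _ _ B _ KB Pr Z chainZ D rho mD rho0 rho1 z beta) => //.
    by case: z za => x y za; exact: A4.
  have [Dz|nDz] := pselect (D z).
    by rewrite /V /= mem_set//; apply: le_trans (U1 z).
  have : \int[B z]_u (V m u)%:E <= \int[B z]_u (U u)%:E.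
    apply: ge0_le_integral => //.
    - by move=> u _; rewrite lee_fin (le_trans ler01).
    - exact/measurable_EFinP.
    - apply/measurable_EFinP; apply: measurable_funM => //.
      by apply: measurable_funD => //; exact: measurable_funM.
    - by move=> u _; rewrite lee_fin.
  rewrite (hitting_weight_step B mD rho0 rho1)// => /le_trans/(_ (IU z)); rewrite lee_fin => h.
  rewrite -(ler_pM2l rho0); apply: le_trans h _.
  rewrite mulrCA ler_wpM2l//.
  have t1 : (1 <= LL z / a)%R by rewrite ler_pdivlMr// mul1r.
  (* With [t = LL z / a >= 1] the claim is [1 + lambda t + (1 - lambda) / 2 <= (3 + lambda) / 4 * (1
     + t)], an equality at [t = 1]. *)
  have -> : ((lambda * LL z + 2 * c) / a = lambda * (LL z / a) + (1 - lambda) / 2)%R.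
    rewrite (_ : (1 - lambda) / 2 = 2 * (c / a))%R; last by rewrite ca; field.
    by ring.
  apply: (@le_trans _ _ ((3 + lambda) / 4 * (1 + LL z / a)))%R; last first.
    by rewrite ler_wpM2r// addr_ge0// (le_trans ler01).
  by move: t1 lambda_gt0 lambda_lt1; set t := (LL z / a)%R => *; nra.
pose K := (C1 * (1 + (lambda * r + 2 * c) / a))%R.
have K0 : (0 < K)%R.
  apply: mulr_gt0; first exact: lt_le_trans C11.
  by rewrite addr_gt0// divr_gt0// addr_gt0// mulr_gt0.
have e0 z : (0 <= e z)%R by exact: mdist_ge0.
have Qs z : F z -> Q z (~` F) = 0.
  by case: z => x y Fz; apply: (measure_support_null sepX mF); exact: A2_support.
have Qc z : F z -> \int[Q z]_u (e u)%:E <= (alpha * e z)%:E.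
  by case: z => x y; exact: A2_contract.
have Qm z : F z -> 1 - Q z setT <= (l * e z `^ nu)%:E by case: z => x y; exact: A3_mass.
have Qd z : F z -> delta%:E <= Q z [set u | (e u <= alpha * e z)%R].
  by case: z => x y; exact: A3_close.
have DF : D `<=` F by move=> z [].
have [q [k [q0 q1 k0 /(_ V mV V1)]]] := exists_lyapunov B1 QB mF (measurable_mdist sepX)
  e0 alpha_gt0 alpha_lt1 delta_gt0 l_gt0 nu_gt0 nu_le1 Qs Qc Qm Qd DF dD rho0 rho1 K0.
case.
- by move=> n z nDz; rewrite (hitting_weight_step B mD rho0 rho1).
- move=> n z Dz; apply: (@le_trans _ _ (\int[B z]_u (U u)%:E)).
    apply: ge0_le_integral => //.
    - by move=> u _; rewrite lee_fin (le_trans ler01).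
    - exact/measurable_EFinP.
    - apply/measurable_EFinP; apply: measurable_funM => //.
      by apply: measurable_funD => //; exact: measurable_funM.
    - by move=> u _; rewrite lee_fin.
  apply: le_trans (IU z) _; rewrite lee_fin ler_wpM2l// lerD2l ler_pM2r ?invr_gt0//.
  by rewrite lerD2r ler_wpM2l ?(ltW lambda_gt0)// ltW//; case: Dz.
move=> ell [mell ell0 ell_min ellV ellB].
exists q, (k * (k * (C1 * (1 + a^-1))))%R; split => //.
  by rewrite !mulr_gt0 ?addr_gt0 ?invr_gt0// (lt_le_trans ltr01).
move=> g Bg gS g0.
(* One step of the coupled chain passes from [g n.+1] to [g n], and the integral of [ell n] is at
   most [q * ell n.+1 z], so the indices match. *)
have key n z : (`|g n z.1 - g n z.2| <= k * q ^+ n * ell n z)%R.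
  elim: n z => [|n IH] z.
    by rewrite expr0 mulr1; apply: le_trans (g0 _ _) _; exact: ell_min.
  rewrite -lee_fin !gS; apply: le_trans (integral_coupling_le B_fst B_snd z (Bg n)) _.
  have kq : (0 <= k * q ^+ n)%R by rewrite mulr_ge0 ?exprn_ge0// ltW.
  apply: (@le_trans _ _ (\int[B z]_u ((k * q ^+ n)%:E * (ell n u)%:E))).
    apply: ge0_le_integral => //.
    - apply/measurable_EFinP; apply: measurableT_comp => //; apply: measurable_funB.
        exact: measurableT_comp (Bg n).1 measurable_fst.
      exact: measurableT_comp (Bg n).1 measurable_snd.
    - by apply: measurable_funeM; exact/measurable_EFinP.
    - by move=> u _; rewrite -EFinM lee_fin.
  rewrite ge0_integralZl//; last 2 first.
  - exact/measurable_EFinP.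
  - by move=> u _; rewrite lee_fin.
  apply: le_trans (lee_wpmul2l _ (ellB n z)) _; first by rewrite lee_fin.
  by rewrite -EFinM lee_fin le_eqVlt; apply/orP; left; apply/eqP; rewrite exprS; ring.
move=> n x y; apply: le_trans (key n (x, y)) _.
have ell_bound : (ell n (x, y) <= k * (C1 * (1 + a^-1)) * (1 + L x + L y))%R.
  apply: le_trans (ellV n (x, y)) _; rewrite -mulrA ler_wpM2l ?(ltW k0)//.
  apply: le_trans (VU n (x, y)) _; rewrite /U -mulrA ler_wpM2l// /LL /=.
  have ai : (0 < a^-1)%R by rewrite invr_gt0.
  move: (L_ge0 x) (L_ge0 y) => Lx Ly; nra.
rewrite [leRHS](_ : _ = k * q ^+ n * (k * (C1 * (1 + a^-1)) * (1 + L x + L y)))%R; last by ring.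
by rewrite ler_wpM2l// mulr_ge0 ?exprn_ge0// ltW.
Qed.

End contraction_estimate.

(** * From Lipschitz functions to continuous functions and open sets *)

Section lipschitz_test_functions.
Context {R : realType} (X : completeMetricType R).
Local Notation T := (borel X).
Implicit Types (f g : T -> R) (P Q : probability T R).

Definition inf_conv f (m : nat) (x : T) : R := inf [set (f y + m%:R * mdist x y)%R | y in setT].

(** Lower semicontinuity covers both uses of the infimal convolution: continuous functions for weak
    convergence, indicators of open sets for the identification of measures. *)
Definition lsc f := forall x (e : R), (0 < e)%R -> exists2 d : R, (0 < d)%R &
  forall y, (mdist x y < d)%R -> (f x - e < f y)%R.

Section inf_conv.
Variables (f : T -> R) (k : R).
Hypothesis fk : forall x, (`|f x| <= k)%R.

Let fk1 x : (- k <= f x)%R. Proof. by have := fk x; rewrite ler_norml => /andP[]. Qed.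
Let fk2 x : (f x <= k)%R. Proof. by have := fk x; rewrite ler_norml => /andP[]. Qed.
Let d0 (x y : T) : (0 <= mdist x y)%R. Proof. exact: mdist_ge0. Qed.

Let lb m x : lbound [set (f y + m%:R * mdist x y)%R | y in setT] (- k)%R.
Proof.
move=> _ [y _ <-]; apply: le_trans (fk1 y) _.
by rewrite lerDl mulr_ge0.
Qed.

Lemma inf_conv_le m x y : (inf_conv f m x <= f y + m%:R * mdist x y)%R.
Proof. by apply: ge_inf; [exists (- k)%R; exact: lb|exists y]. Qed.

Lemma inf_conv_ge m x (a : R) : (forall y, a <= f y + m%:R * mdist x y)%R ->
  (a <= inf_conv f m x)%R.
Proof.
move=> H; apply: lb_le_inf; last by move=> _ [y _ <-].
by exists (f x + m%:R * mdist x x)%R; exists x.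
Qed.

Lemma inf_conv_le_fun m x : (inf_conv f m x <= f x)%R.
Proof. by apply: le_trans (inf_conv_le m x x) _; rewrite mdistxx mulr0 addr0. Qed.

Lemma inf_conv_bound m x : (`|inf_conv f m x| <= k)%R.
Proof.
rewrite ler_norml; apply/andP; split; last exact: le_trans (inf_conv_le_fun m x) (fk2 x).
by apply: inf_conv_ge => y; apply: (lb (m := m) (x := x)); exists y.
Qed.

Lemma inf_conv_lip m x y : (`|inf_conv f m x - inf_conv f m y| <= m%:R * mdist x y)%R.
Proof.
have H (u v : T) : (inf_conv f m u <= inf_conv f m v + m%:R * mdist u v)%R.
  rewrite -lerBlDr; apply: inf_conv_ge => w; rewrite lerBlDr.
  apply: le_trans (inf_conv_le m u w) _.
  by rewrite -addrA lerD2l -mulrDr ler_wpM2l// addrC metric_triangle.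
rewrite ler_distl; have := H x y; have := H y x; rewrite (metric_sym y x) => ? ?.
by apply/andP; split; lra.
Qed.

Lemma blip_inf_conv m : blip (inf_conv f m).
Proof.
have k0 : (0 <= k)%R by apply: le_trans (fk point).
exists (k + m%:R)%R => x y; split.
  by apply: le_trans (inf_conv_bound m x) _; rewrite lerDl.
by apply: le_trans (inf_conv_lip m x y) _; rewrite ler_wpM2r// lerDr.
Qed.

(** Within distance [d] semicontinuity bounds [f y] from below; beyond it, once [m d >= 2 k], the
    penalty outweighs the whole oscillation of [f]. *)
Lemma cvg_inf_conv x : lsc f -> inf_conv f m x @[m --> \oo] --> f x.
Proof.
move=> lf; apply/cvgrPdist_le => e e0; have [d dp H] := lf x e e0.
have k0 : (0 <= k)%R by apply: le_trans (fk point).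
exists (Num.truncn (2 * k / d)).+1 => // m /= mk.
rewrite ger0_norm ?subr_ge0 ?inf_conv_le_fun// lerBlDr -lerBlDl.
apply: inf_conv_ge => y; have [xy|xy] := ltP (mdist x y) d.
  apply: le_trans (ltW (H _ xy)) _; by rewrite lerDl mulr_ge0.
have : (2 * k <= m%:R * mdist x y)%R.
  apply: (@le_trans _ _ (m%:R * d)%R); last by rewrite ler_wpM2l.
  rewrite -ler_pdivrMr//; apply: (@le_trans _ _ (Num.truncn (2 * k / d)).+1%:R).
    by apply/ltW/truncnS_gt.
  by rewrite ler_nat.
by have := fk1 y; have := fk2 x; lra.
Qed.

Lemma cvg_integral_inf_conv P : measurable_fun [set: T] f -> lsc f ->
  (\int[P]_x inf_conv f m x)%R @[m --> \oo] --> (\int[P]_x f x)%R.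
Proof.
move=> mf lf.
have bf : Bb f by split => //; exact: bounded_fun_le fk.
have Pf : \int[P]_x (f x)%:E \is a fin_num.
  by apply: (@integrable_fin_num _ _ _ P) => //; exact: Bb_integrable.
apply: fine_cvg; rewrite fineK//.
have k0 : (0 <= k)%R by apply: le_trans (fk point).
apply: (@dominated_cvg _ _ _ P setT measurableT (fun m x => (inf_conv f m x)%:E)
   (fun x => (f x)%:E) (fun=> k%:E)) => //.
- by move=> m; apply/measurable_EFinP; apply: blip_measurable; exact: blip_inf_conv.
- by move=> x _; apply: cvg_EFin; [exact: nearW|exact: cvg_inf_conv].
- apply: (@Bb_integrable _ _ P (fun=> k)); apply: Cb_Bb; apply: blip_Cb; exact: blip_cst.
- by move=> m x _; rewrite abse_EFin lee_fin; exact: inf_conv_bound.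
Qed.

End inf_conv.

Lemma continuous_lsc f : continuous f -> lsc f.
Proof.
move=> cf x e e0; have /cvgrPdist_lt/(_ e e0) := cf x.
move=> /nbhs_ballP[d /= d0 H]; exists d => // y xy.
have := H y; rewrite ballEmdist /= => /(_ xy); rewrite ltr_distl; lra.
Qed.

Lemma indic_open_lsc (O : set T) : open O -> lsc (\1_O : T -> R).
Proof.
move=> oO x e e0; have [xO|xO] := pselect (O x); last first.
  exists 1%R => // y _; rewrite indicE memNset// sub0r.
  by apply: (@lt_le_trans _ _ 0%R); [rewrite oppr_lt0|rewrite indicE].
have /nbhs_ballP[d /= d0 H] : nbhs x O by exact: open_nbhs_nbhs.
exists d => // y xy; have yO : O y by apply: H; rewrite ballEmdist.
by rewrite !indicE !mem_set// ltrBlDr ltrDl.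
Qed.

(** Indicators of open sets are limits of their infimal convolutions, so [P] and [Q] agree on open
    sets, which are stable under intersection and generate the sigma-algebra. *)
Lemma probability_eq_lipschitz P Q :
  (forall f, blip f -> \int[P]_x f x = \int[Q]_x f x)%R ->
  forall A, measurable A -> P A = Q A.
Proof.
move=> PQ.
have eqO (O : set T) : open O -> P O = Q O.
  move=> oO; have mO : measurable O by exact: sub_sigma_algebra.
  have ik x : (`|\1_O x : R| <= 1)%R.
    by rewrite indicE; case: (x \in O); rewrite ?normr0 ?normr1.
  have mi : measurable_fun [set: T] (\1_O : T -> R) by exact: measurable_indic.
  have cP := cvg_integral_inf_conv (P := P) ik mi (indic_open_lsc oO).
  have cQ := cvg_integral_inf_conv (P := Q) ik mi (indic_open_lsc oO).
  have IE (M : probability T R) : (\int[M]_x \1_O x = fine (M O) :> R)%R.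
    by rewrite /Rintegral integral_indic// setIT.
  have : fine (P O) = fine (Q O).
    rewrite -!IE; apply: (@cvg_unique _ (@Rhausdorff R) _ _ _ _ cP).
    rewrite (_ : (fun m => _) = (fun m => (\int[Q]_x inf_conv (\1_O : T -> R) m x)%R))//.
    by apply/funext => m; apply: PQ; exact: blip_inf_conv ik _.
  have fM (M : probability T R) : M O \is a fin_num by exact: fin_num_measure.
  by move=> h; rewrite -(fineK (fM P)) -(fineK (fM Q)) h.
apply: (@g_sigma_algebra_measure_unique _ R T (@open X) _ (fun=> setT)).
- by move=> O oO; exact: sub_sigma_algebra.
- by move=> _; exact: openT.
- by rewrite bigcup_const//; exists 0%N.
- exact: openI.
- exact: eqO.
- by move=> _; exact: le_lt_trans (probability_le1 P measurableT) (ltry 1).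
Qed.

(** Approximation from below bounds the lower limit of the integrals of [f]; the same for [- f]
    bounds the upper limit. *)
Lemma cvg_lipschitz_Cb (M : nat -> probability T R) P :
  (forall h, blip h -> (\int[M n]_x h x)%R @[n --> \oo] --> (\int[P]_x h x)%R) ->
  forall f, Cb f -> (\int[M n]_x f x)%R @[n --> \oo] --> (\int[P]_x f x)%R.
Proof.
move=> MP.
have lower f e : Cb f -> (0 < e)%R ->
    \forall n \near \oo, (\int[P]_x f x - e <= \int[M n]_x f x)%R.
  move=> Cf e0; have [k k0 fk] := Bb_bound (Cb_Bb Cf).
  have e2 : (0 < e / 2)%R by rewrite divr_gt0.
  have /cvgrPdist_le/(_ _ e2)[m _ /(_ m (leqnn _)) /= Hm] :=
    cvg_integral_inf_conv (P := P) fk (Cb_Bb Cf).1 (continuous_lsc Cf.1).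
  have /cvgrPdist_le/(_ _ e2) := MP _ (blip_inf_conv fk m).
  apply: filterS => n Hn.
  have : (\int[M n]_x inf_conv f m x <= \int[M n]_x f x)%R.
    apply: le_Rintegral => //.
    - apply: (Bb_integrable (M n)); apply: Cb_Bb; apply: blip_Cb; exact: (blip_inf_conv fk).
    - apply: (Bb_integrable (M n)); exact: Cb_Bb.
    - by move=> x _; exact: (inf_conv_le_fun fk).
  by move: Hm Hn; rewrite !ler_distl => /andP[? ?] /andP[? ?]; lra.
move=> f Cf; apply/cvgrPdist_le => e e0.
have Cnf : Cb (fun x => - f x)%R.
  split; first by move=> x; apply: cvgN; exact: Cf.1.
  have [k k0 fk] := Bb_bound (Cb_Bb Cf).
  by apply: (@bounded_fun_le _ _ _ k) => x; rewrite normrN.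
have IN (N : probability T R) : (\int[N]_x (- f x) = - \int[N]_x f x)%R.
  rewrite -[RHS]mulN1r -RintegralZl//; last by apply: (Bb_integrable N); exact: Cb_Bb.
  by apply: eq_Rintegral => x _; rewrite mulN1r.
have h1 := lower f e Cf e0; have := lower _ e Cnf e0; rewrite IN => h2.
apply: filterS2 h1 h2 => n a; rewrite IN => b.
by rewrite ler_distl; apply/andP; split; lra.
Qed.

End lipschitz_test_functions.

(** * Iterates of the dual operator and their moments *)

Section dual_iterates.
Context {R : realType} (X : completeMetricType R).
Local Notation T := (borel X).
Variables (P : (T -> R) -> (T -> R)) (p : R.-pker T ~> T).
Hypotheses (markovP : markov_operator P) (Pp : transition_function P p).

Lemma probability_of_measure (m : {measure set T -> \bar R}) : m setT = 1 ->
  exists M : probability T R, forall A, M A = m A.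
Proof.
move=> m1; pose f : set T -> \bar R := m.
pose mf := isMeasure.Build _ T R f (measure0 m) (measure_ge0 m)
  (@measure_semi_sigma_additive _ _ _ m).
pose M0 : {measure set T -> \bar R} := HB.pack f mf.
pose M : probability T R := HB.pack f mf (Measure_isProbability.Build _ T R M0 m1).
by exists M.
Qed.

Lemma ge0_integral_dual (mu : {measure set T -> \bar R}) (h : T -> \bar R) :
  measurable_fun [set: T] h -> (forall x, 0 <= h x) ->
  \int[dual_measure p mu]_x h x = \int[mu]_x \int[p x]_y h y.
Proof. by move=> mh h0; apply: integral_mixture => // A mA; exact: measurable_kernel. Qed.

Lemma transition_functionE f : Bb f -> P f = (fun x => \int[p x]_y f y)%R.
Proof. by move=> Bf; apply/funext => x; rewrite /Rintegral -Pp. Qed.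

Lemma markov_iter f n : Bb f -> Bb (iter n P f).
Proof. by move=> Bf; elim: n => //= n; exact: markov_Bb. Qed.

Lemma Bb_cst (a : R) : Bb ((fun=> a) : T -> R).
Proof. by apply: Cb_Bb; apply: blip_Cb; exact: blip_cst. Qed.

Lemma Rintegral_probability_cst (M : probability T R) (a : R) : (\int[M]_x a = a)%R.
Proof.
rewrite Rintegral_cst// -[RHS]mulr1; congr (_ * _)%R.
exact: (congr1 fine (probability_setT M)).
Qed.

Lemma EFin_Rintegral (M : probability T R) f : Bb f ->
  (\int[M]_x f x)%R%:E = \int[M]_x (f x)%:E.
Proof.
by move=> Bf; rewrite fineK//; apply: (@integrable_fin_num _ _ _ M) => //; exact: Bb_integrable.
Qed.

Lemma Rintegral_dual (mu M : probability T R) f : Bb f ->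
  (forall A, measurable A -> M A = dual_measure p mu A) ->
  (\int[M]_x f x = \int[mu]_x P f x)%R.
Proof.
move=> Bf ME; have [c c0 fc] := Bb_bound Bf.
have fc0 x : (0 <= f x + c)%R by have := fc x; rewrite ler_norml => /andP[]; lra.
have mfc : measurable_fun [set: T] (fun x => (f x + c)%:E).
  by apply/measurable_EFinP; apply: measurable_funD => //; exact: Bf.1.
have splitI (N : probability T R) g : Bb g ->
    \int[N]_x (g x + c)%:E = (\int[N]_x g x + c)%R%:E.
  move=> Bg; under eq_integral do rewrite EFinD.
  rewrite integralD//; last 2 first.
  - exact: (Bb_integrable N).
  - exact: (Bb_integrable N (Bb_cst c)).
  rewrite EFinD (EFin_Rintegral N Bg); congr (_ + _).
  by rewrite -(EFin_Rintegral N (Bb_cst c)) Rintegral_probability_cst.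
have : \int[M]_x (f x + c)%:E = \int[mu]_x \int[p x]_y (f y + c)%:E.
  by rewrite (eq_measure_integral (dual_measure p mu)) ?ge0_integral_dual// => A mA _; exact: ME.
rewrite splitI//.
have -> : \int[mu]_x \int[p x]_y (f y + c)%:E = \int[mu]_x (P f x + c)%:E.
  apply: eq_integral => x _; under eq_integral do rewrite EFinD.
  rewrite integralD//; last 2 first.
  - exact: Bb_kernel_integrable.
  - exact: (Bb_kernel_integrable p x (Bb_cst c)).
  by rewrite (integral_cst (p x) measurableT c%:E) prob_kernel mule1 -Pp.
rewrite splitI; last exact: markov_Bb.
by move=> [] /addIr.
Qed.

Variables (L : T -> R) (lambda c : R).
Hypotheses (L_ge0 : forall x, (0 <= L x)%R) (L_continuous : continuous L)
  (lambda_gt0 : (0 < lambda)%R) (lambda_lt1 : (lambda < 1)%R) (c_gt0 : (0 < c)%R)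
  (A1 : forall x, \int[p x]_y (L y)%:E <= (lambda * L x + c)%:E).

Let mL : measurable_fun [set: T] (fun x => (L x)%:E).
Proof. by apply/measurable_EFinP; exact: continuous_measurable. Qed.

(** The moment bound survives every step because [c / (1 - lambda)] is the fixed point of
    [t -> lambda t + c]. *)
Lemma dual_iterate (mu : probability T R) n : exists M : probability T R,
  [/\ forall A, measurable A -> M A = iter n (dual_measure p) mu A,
      forall f, Bb f -> (\int[M]_x f x = \int[mu]_x iter n P f x)%R &
      \int[M]_x (L x)%:E <= \int[mu]_x (L x)%:E + (c / (1 - lambda))%:E].
Proof.
have l1 : (0 < 1 - lambda)%R by rewrite subr_gt0.
elim: n => [|n [M [ME Mf ML]]].
  exists mu; split => //; rewrite leeDl// lee_fin divr_ge0// ltW//.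
have dM : dual_measure p M setT = 1.
  rewrite -[RHS](@probability_setT _ _ _ M) -[RHS]mul1e -(integral_cst M measurableT 1).
  by apply: eq_integral => x _; exact: prob_kernel.
have [M' M'E] := probability_of_measure dM.
exists M'; split.
- move=> A mA; rewrite M'E /=; apply: eq_measure_integral => B mB _; exact: ME.
- move=> f Bf; rewrite (@Rintegral_dual M M' f Bf)//.
  by rewrite iterSr; apply: Mf; exact: markov_Bb.
- rewrite (eq_measure_integral (dual_measure p M)); last by move=> A mA _; exact: M'E.
  have L0 x : 0 <= (L x)%:E by rewrite lee_fin.
  rewrite ge0_integral_dual//.
  apply: (@le_trans _ _ (\int[M]_x (lambda%:E * (L x)%:E + c%:E))).
    apply: ge0_le_integral => //.
    - by move=> x _; exact: integral_ge0.
    - by apply: measurable_fun_integral_kernel => // A mA; exact: measurable_kernel.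
    - by apply: emeasurable_funD => //; exact: measurable_funeM.
  rewrite ge0_integralD//; last 3 first.
  - by move=> x _; apply: mule_ge0 => //; rewrite lee_fin ltW.
  - exact: measurable_funeM.
  - by move=> x _; rewrite lee_fin ltW.
  rewrite ge0_integralZl//; last by rewrite lee_fin ltW.
  rewrite -(EFin_Rintegral M (Bb_cst c)) Rintegral_probability_cst.
  apply: (@le_trans _ _ (lambda%:E * (\int[mu]_x (L x)%:E + (c / (1 - lambda))%:E) + c%:E)).
    by apply: leeD2r; apply: lee_wpmul2l => //; rewrite lee_fin ltW.
  have : 0 <= \int[mu]_x (L x)%:E by exact: integral_ge0.
  case: (\int[mu]_x (L x)%:E) => [m| |] //; last by move=> _; rewrite leey.
  rewrite lee_fin -!EFinD lee_fin => m0.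
  have -> : (lambda * (m + c / (1 - lambda)) + c = lambda * m + c / (1 - lambda))%R.
    by field; rewrite gt_eqF.
  by rewrite lerD2r ler_piMl// ltW.
Qed.

(** Integrates a pointwise estimate with weight affine in [L]; applied once for each of the two
    variables of the contraction estimate. *)
Lemma Rintegral_dist_le (M : probability T R) (g : T -> R) (a u k m : R) : Bb g ->
  (0 <= u)%R -> (0 <= k)%R -> (forall y, `|a - g y| <= u + k * L y)%R ->
  \int[M]_x (L x)%:E <= m%:E -> (`|a - \int[M]_x g x| <= u + k * m)%R.
Proof.
move=> Bg u0 k0 ag Lm.
have Bag : Bb (fun y => a - g y)%R.
  have [b b0 gb] := Bb_bound Bg.
  split; first by apply: measurable_funB => //; exact: Bg.1.
  apply: (@bounded_fun_le _ _ _ (`|a| + b)%R) => x.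
  by apply: le_trans (ler_normB _ _) _; rewrite lerD2l.
have -> : (a - \int[M]_x g x = \int[M]_x (a - g x))%R.
  rewrite RintegralB// ?Rintegral_probability_cst//.
    exact: (Bb_integrable M (Bb_cst a)).
  exact: (Bb_integrable M).
rewrite -lee_fin; apply: (@le_trans _ _ (\int[M]_x (u%:E + k%:E * (L x)%:E))).
  apply: (@le_trans _ _ (\int[M]_x `|(a - g x)%:E|)).
    rewrite -abse_EFin (EFin_Rintegral M Bag); apply: le_abse_integral => //.
    by apply/measurable_EFinP; exact: Bag.1.
  apply: ge0_le_integral => //.
  - by apply: measurableT_comp => //; apply/measurable_EFinP; exact: Bag.1.
  - by apply: emeasurable_funD => //; exact: measurable_funeM.
  - by move=> x _; rewrite abse_EFin -EFinM -EFinD lee_fin.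
have L0 x : 0 <= (L x)%:E by rewrite lee_fin.
rewrite ge0_integralD//; last 2 first.
- by move=> x _; apply: mule_ge0.
- exact: measurable_funeM.
rewrite ge0_integralZl//.
rewrite -(EFin_Rintegral M (Bb_cst u)) Rintegral_probability_cst.
rewrite EFinD EFinM; apply: leeD2l; exact: lee_wpmul2l.
Qed.

End dual_iterates.

(** * Existence, uniqueness, attraction and rate for the invariant measure *)

Unset Implicit Arguments.

Theorem theorem2p1 (R : realType) (X : completeMetricType R)
  (sepX : separable X)
  (P : (borel X -> R) -> (borel X -> R)) (p : R.-pker borel X ~> borel X)
  (markovP : markov_operator P) (Pp : transition_function P p)
  (Q : R.-spker (borel X * borel X)%type ~> (borel X * borel X)%type)
  (Q1 : forall (x y : borel X) (A : set (borel X)), measurable A ->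
    Q (x, y) (A `*` setT) <= p x A)
  (Q2 : forall (x y : borel X) (A : set (borel X)), measurable A ->
    Q (x, y) (setT `*` A) <= p y A)
  (* (A0) *)
  (A0 : feller P)
  (* (A1) *)
  (L : borel X -> R) (lambda c : R)
  (L_ge0 : forall x, (0 <= L x)%R)
  (L_continuous : continuous L)
  (L_bounded : forall A, metric_bounded A ->
    exists M : R, forall x, A x -> (L x <= M)%R)
  (L_infty : ~ metric_bounded [set: borel X] -> tends_to_infinity L)
  (lambda_gt0 : (0 < lambda)%R) (lambda_lt1 : (lambda < 1)%R)
  (c_gt0 : (0 < c)%R)
  (A1 : forall x, \int[p x]_y (L y)%:E <= (lambda * L x + c)%:E)
  (* (A2) *)
  (F : set (borel X * borel X)) (alpha : R)
  (mF : measurable F)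
  (alpha_gt0 : (0 < alpha)%R) (alpha_lt1 : (alpha < 1)%R)
  (A2_support : forall x y, F (x, y) -> measure_support (Q (x, y)) `<=` F)
  (A2_contract : forall x y, F (x, y) ->
    \int[Q (x, y)]_u (mdist u.1 u.2)%:E <= (alpha * mdist x y)%:E)
  (* (A3) *)
  (delta l nu : R)
  (delta_gt0 : (0 < delta)%R) (l_gt0 : (0 < l)%R)
  (nu_gt0 : (0 < nu)%R) (nu_le1 : (nu <= 1)%R)
  (A3_mass : forall x y, F (x, y) ->
    1 - Q (x, y) setT <= (l * mdist x y `^ nu)%:E)
  (A3_close : forall x y, F (x, y) ->
    delta%:E <= Q (x, y) [set u | (mdist u.1 u.2 <= alpha * mdist x y)%R])
  (* the Markov chain with transition function [coupling p Q]: [Pr z] is the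
     probability under which the chain [Z] starts from [z] *)
  (dW : measure_display) (W : measurableType dW)
  (Pr : borel X * borel X -> probability W R)
  (Z : nat -> W -> borel X * borel X)
  (chainZ : forall z : borel X * borel X, markov_chain (coupling p Q) z (Pr z) Z)
  (* (A4) *)
  (beta Ct r : R)
  (beta_gt0 : (0 < beta)%R) (beta_lt1 : (beta < 1)%R)
  (Ct_gt0 : (0 < Ct)%R) (r_gt0 : (0 < r)%R)
  (A4 : forall x y, (L x + L y < 4 * c / (1 - lambda))%R ->
    \int[Pr (x, y)]_w inv_pow beta (hitting_time
        [set z | F z /\ (L z.1 + L z.2 < r)%R] (fun n => Z n w)) <= Ct%:E) :
  exists mus : probability (borel X) R,
    [/\ invariant_measure p mus,
        \int[mus]_x (L x)%:E < +oo,
        forall mu : probability (borel X) R, invariant_measure p mu ->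
          forall A, measurable A -> mu A = mus A,
        forall (f : borel X -> R) (mu : probability (borel X) R), Cb f ->
          \int[mu]_x (iter n P f x)%:E @[n --> \oo] --> \int[mus]_x (f x)%:E &
        exists q C : R, [/\ (0 < q)%R, (q < 1)%R, (0 < C)%R &
          forall mu : probability (borel X) R, \int[mu]_x (L x)%:E < +oo ->
          forall n : nat, (0 < n)%N ->
            fortet_mourier (iter n (dual_measure p) mu) mus
              <= (q ^+ n * C)%:E * (1 + \int[mu]_x (L x)%:E)]].
Proof.
have [q [C [q0 q1 C0 est]]] := contraction_estimate sepX Q1 Q2 L_ge0 L_continuous
  L_infty lambda_gt0 lambda_lt1 c_gt0 A1 mF alpha_gt0 alpha_lt1 A2_support A2_contract
  delta_gt0 l_gt0 nu_gt0 nu_le1 A3_mass A3_close chainZ beta_gt0 beta_lt1 r_gt0 A4.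
have lip_Bb (f : borel X -> R) : (forall x y, `|f x - f y| <= mdist x y)%R ->
    (forall x, `|f x| <= 1)%R -> Bb f.
  move=> f1 f2; apply: Cb_Bb; apply: blip_Cb; exists 1%R => x y; rewrite mul1r.
  by split; [exact: f2|exact: f1].
have lip_est (f : borel X -> R) : (forall x y, `|f x - f y| <= mdist x y)%R ->
    (forall x, `|f x| <= 1)%R -> forall n x y,
    (`|iter n P f x - iter n P f y| <= q ^+ n * C * (1 + L x + L y))%R.
  move=> f1 f2; apply: (est (fun n => iter n P f)).
  - by move=> n; apply: (markov_iter markovP); exact: lip_Bb.
  - move=> n x; rewrite /= (transition_functionE Pp)//.
    by apply: (markov_iter markovP); exact: lip_Bb.
  - move=> x y; rewrite le_min f1 andbT; apply: le_trans (ler_normB _ _) _.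
    by have := f2 x; have := f2 y; lra.
have l1 : (0 < 1 - lambda)%R by rewrite subr_gt0.
pose b : R := (c / (1 - lambda))%R.
have b0 : (0 < b)%R by rewrite divr_gt0.
have mLE : measurable_fun [set: borel X] (fun x => (L x)%:E).
  by apply/measurable_EFinP; exact: continuous_measurable.
(* The laws [P^n(y, .)], obtained as dual iterates of a Dirac mass, with a moment of [L] bounded
   uniformly in [n]. *)
have /choice[nuf nufP] : forall yn : borel X * nat, exists M : probability (borel X) R,
    (forall f, Bb f -> (\int[M]_x f x = iter yn.2 P f yn.1)%R) /\
    \int[M]_x (L x)%:E <= (L yn.1 + b)%:E.
  move=> [y n] /=.
  have [M [_ Mf ML]] := dual_iterate markovP Pp L_ge0 L_continuous lambda_gt0 lambda_lt1
    c_gt0 A1 (\d_y) n.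
  exists M; split => [f Bf|].
    rewrite Mf// /Rintegral integral_dirac ?diracT ?mul1e//.
    by apply/measurable_EFinP; exact: (markov_iter markovP n Bf).1.
  by move: ML; rewrite integral_dirac// diracT mul1e.
pose nuy y n := nuf (y, n).
have nuyE y n f : Bb f -> (\int[nuy y n]_x f x = iter n P f y)%R.
  by move=> Bf; rewrite (nufP (y, n)).1.
have nuyL y n : \int[nuy y n]_x (L x)%:E <= (L y + b)%:E by exact: (nufP (y, n)).2.
pose x0 : borel X := point.
pose M0 : R := (L x0 + b)%R.
have M00 : (0 <= M0)%R by rewrite addr_ge0// ltW.
have qn0 n : (0 <= q ^+ n * C)%R by rewrite mulr_ge0 ?exprn_ge0// ltW.
have small (K e : R) : (0 < e)%R -> (0 <= K)%R -> exists N, forall n, (N <= n)%N ->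
    (q ^+ n * C * K <= e)%R.
  move=> e0 K0.
  have K1 : (0 < C * K + 1)%R by rewrite ltr_wpDl// mulr_ge0// ltW.
  have /cvgrPdist_le/(_ (e / (C * K + 1))%R) : (q ^+ n)%R @[n --> \oo] --> (0 : R)%R.
    by apply: cvg_expr; rewrite ger0_norm// ltW.
  rewrite divr_gt0// => /(_ isT) [N _ H]; exists N => n Nn.
  have := H n Nn; rewrite /= sub0r normrN ger0_norm ?exprn_ge0 ?(ltW q0)//.
  rewrite ler_pdivlMr// => h; apply: le_trans h.
  by rewrite -mulrA ler_wpM2l ?exprn_ge0 ?(ltW q0)// lerDl.
have [s sP] := dense_sequence sepX.
have cauchy_nu : forall e : R, (0 < e)%R -> exists N, forall n, (N <= n)%N ->
    forall h : borel X -> R, (forall x y, `|h x - h y| <= mdist x y)%R ->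
    (forall x, `|h x| <= 1)%R ->
    (`|\int[nuy x0 n]_x h x - \int[nuy x0 N]_x h x| <= e)%R.
  move=> e e0; have K0 : (0 <= 1 + L x0 + M0)%R by rewrite addr_ge0// addr_ge0//.
  have [N NP] := small _ _ e0 K0.
  exists N => n Nn h h1 h2; have Bh := lip_Bb h h1 h2.
  (* [P^n h (x0)] is the mean of [P^N h] under [P^(n-N)(x0, .)]; the contraction estimate at time
     [N] is then integrated in its second variable. *)
  rewrite !nuyE// -(subnK Nn) iterD -nuyE; last exact: (markov_iter markovP).
  rewrite distrC; apply: le_trans (NP N (leqnn _)).
  rewrite mulrDr; apply: (Rintegral_dist_le (L := L)) => //.
  - exact: (markov_iter markovP).
  - by rewrite mulr_ge0// addr_ge0.
  - by move=> y; rewrite -mulrDr; exact: lip_est.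
have [mus musP] := cauchy_limit sP cauchy_nu sepX.
(* The limit was built from [x0]; the contraction estimate between [x0] and [y] shows that every
   starting point shares it. *)
have lim_blip y (h : borel X -> R) : blip h ->
    (\int[nuy y n]_x h x)%R @[n --> \oo] --> (\int[mus]_x h x)%R.
  move=> bh; have [c0 hc] := bh.
  pose k := (`|c0| + 1)%R; have k0 : (0 < k)%R by rewrite ltr_wpDl.
  have c0k : (c0 <= k)%R by rewrite (le_trans (ler_norm _))// lerDl.
  pose h' x := (k^-1 * h x)%R.
  have h1 x x' : (`|h' x - h' x'| <= mdist x x')%R.
    rewrite -mulrBr normrM gtr0_norm ?invr_gt0// mulrC ler_pdivrMr// mulrC.
    by apply: le_trans (hc x x').2 _; rewrite ler_wpM2r// mdist_ge0.
  have h2 x : (`|h' x| <= 1)%R.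
    rewrite normrM gtr0_norm ?invr_gt0// mulrC ler_pdivrMr// mul1r.
    exact: le_trans (hc x x).1 _.
  have Bh' := lip_Bb h' h1 h2.
  have hE n z : (\int[nuy z n]_x h x = k * iter n P h' z)%R.
    rewrite -nuyE// -RintegralZl//; last exact: (Bb_integrable (nuy z n)).
    by apply: eq_Rintegral => x _; rewrite /h' mulrA divff ?gt_eqF// mul1r.
  apply/cvgrPdist_le => e e0; have e2 : (0 < e / 2)%R by rewrite divr_gt0.
  have ek : (0 < e / 2 / k)%R by rewrite divr_gt0.
  have K0 : (0 <= 1 + L y + L x0)%R by rewrite addr_ge0// addr_ge0//.
  have [N NP] := small _ _ ek K0.
  have /cvgrPdist_le/(_ _ e2)[N' _ NP'] := musP h bh.
  exists (maxn N N') => // n /=; rewrite geq_max => /andP[Nn N'n].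
  have := NP' n N'n; rewrite /= !hE => a1.
  have : (`|k * iter n P h' x0 - k * iter n P h' y| <= e / 2)%R.
    rewrite -mulrBr normrM gtr0_norm// mulrC -ler_pdivlMr// distrC.
    exact: le_trans (lip_est _ h1 h2 n y x0) (NP n Nn).
  by move: a1; rewrite !ler_norml => /andP[? ?] /andP[? ?]; apply/andP; split; lra.
have lim_Cb y f : Cb f -> (\int[nuy y n]_x f x)%R @[n --> \oo] --> (\int[mus]_x f x)%R.
  by apply: cvg_lipschitz_Cb => h; exact: lim_blip.
have iter_bound f k n : Bb f -> (forall x, `|f x| <= k)%R -> (forall x, `|iter n P f x| <= k)%R.
  move=> Bf fk x; rewrite -nuyE//.
  apply: le_trans (le_normr_Rintegral _ _) _ => //; first exact: (Bb_integrable (nuy x n)).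
  rewrite -[leRHS](Rintegral_probability_cst (nuy x n)); apply: le_Rintegral => //.
    have := Bb_integrable (nuy x n) Bf; exact: integrable_norm.
  exact: (Bb_integrable (nuy x n) (Bb_cst _ k)).
(* Dominated convergence in the starting point, hence for every [mu], with or without a moment of
   [L]. *)
have attractive (f : borel X -> R) (mu : probability (borel X) R) : Cb f ->
    \int[mu]_x (iter n P f x)%:E @[n --> \oo] --> \int[mus]_x (f x)%:E.
  move=> Cf; have Bf := Cb_Bb Cf; have [k k0 fk] := Bb_bound Bf.
  rewrite -(EFin_Rintegral mus Bf) -(Rintegral_probability_cst mu (\int[mus]_x f x)%R).
  rewrite (EFin_Rintegral mu (Bb_cst _ _)).
  apply: (@dominated_cvg _ _ _ mu setT measurableT (fun n x => (iter n P f x)%:E)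
     _ (fun=> k%:E)) => //.
  - by move=> n; apply/measurable_EFinP; exact: (markov_iter markovP n Bf).1.
  - move=> x _; have := lim_Cb x _ Cf.
    rewrite (_ : (fun n => _) = (fun n => iter n P f x)); last first.
      by apply/funext => n; rewrite nuyE.
    by move=> h; apply: cvg_EFin => //; exact: nearW.
  - exact: (Bb_integrable mu (Bb_cst _ k)).
  - by move=> n x _; rewrite abse_EFin lee_fin; exact: iter_bound.
(* [P^(n+1) f (x0)] tends to the integral of [f], and also to that of [P f]; the Feller property
   enters here, making [P f] an admissible test function. *)
have musI : invariant_measure p mus.
  have dM : dual_measure p mus setT = 1.
    rewrite -[RHS](@probability_setT _ _ _ mus) -[RHS]mul1e -(integral_cst mus measurableT 1).
    by apply: eq_integral => x _; exact: prob_kernel.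
  have [M ME] := probability_of_measure dM.
  move=> A mA; rewrite -ME; apply: probability_eq_lipschitz => // f bf.
  have Cf := blip_Cb bf; have Bf := Cb_Bb Cf.
  rewrite (Rintegral_dual markovP Pp Bf (fun A _ => ME A)).
  apply: (@cvg_unique _ (@Rhausdorff R) ((fun n => \int[nuy x0 n]_x P f x)%R @ \oo)).
    exact: lim_Cb (A0 f Cf).
  rewrite (_ : (fun n => _) = (fun n => (\int[nuy x0 n.+1]_x f x)%R)); last first.
    by apply/funext => n; rewrite !nuyE ?iterSr//; exact: markov_Bb markovP _ Bf.
  have := lim_Cb x0 _ Cf.
  by rewrite -(cvg_shiftS (fun n => \int[nuy x0 n]_x f x)%R).
(* [L] is unbounded, so the moment bound passes to the limit on the truncations [Num.min (L x) m]
   and then by monotone convergence. *)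
have musL : \int[mus]_x (L x)%:E <= M0%:E.
  pose Lm (m : nat) x : R := Num.min (L x) m%:R.
  have CLm m : Cb (Lm m).
    split.
      move=> x; apply: (@continuous_min R X L (fun=> m%:R) x (L_continuous x)).
      exact: cst_continuous.
    apply: (@bounded_fun_le _ _ _ m%:R) => x.
    by rewrite ger0_norm ?ge_min ?lexx ?orbT// le_min L_ge0 ler0n.
  have bound m : \int[mus]_x (Lm m x)%:E <= M0%:E.
    rewrite -(EFin_Rintegral mus (Cb_Bb (CLm m))) lee_fin.
    have cL := lim_Cb x0 _ (CLm m).
    rewrite -(cvg_lim (@Rhausdorff R) cL); apply: limr_le; first exact: cvgP cL.
    apply: nearW => n; rewrite -lee_fin (EFin_Rintegral _ (Cb_Bb (CLm m))).
    apply: le_trans (nuyL x0 n); apply: ge0_le_integral => //.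
    - by move=> x _; rewrite lee_fin le_min L_ge0 ler0n.
    - by apply/measurable_EFinP; exact: (Cb_Bb (CLm m)).1.
    - by move=> x _; rewrite lee_fin ge_min lexx.
  rewrite (_ : \int[mus]_x (L x)%:E = \int[mus]_x limn (fun m => (Lm m x)%:E)); last first.
    apply: eq_integral => x _; apply/esym/cvg_lim => //.
    apply: (@cvg_near_cst _ _ _ _ _); exists (Num.truncn (L x)).+1 => // m /= mx.
    congr EFin; apply/min_idPl; apply: (@le_trans _ _ (Num.truncn (L x)).+1%:R).
      by apply/ltW/truncnS_gt.
    by rewrite ler_nat.
  have mLm m : measurable_fun [set: borel X] (fun x => (Lm m x)%:E).
    by apply/measurable_EFinP; exact: (Cb_Bb (CLm m)).1.
  have Lm0 m x : 0 <= (Lm m x)%:E by rewrite lee_fin le_min L_ge0 ler0n.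
  have Lmm x : nondecreasing_seq (fun m => (Lm m x)%:E).
    move=> m n mn; rewrite lee_fin le_min !ge_min lexx/= ler_nat mn orbT//.
  rewrite monotone_convergence//; apply: lime_le; last exact: nearW.
  apply: ereal_nondecreasing_is_cvgn => m n mn; apply: ge0_le_integral => //.
  by move=> x _; exact: Lmm.
exists mus; split => //.
- exact: le_lt_trans musL (ltry _).
- move=> mu muI; apply: probability_eq_lipschitz => f bf.
  have Cf := blip_Cb bf; have Bf := Cb_Bb Cf.
  have muP g : Bb g -> (\int[mu]_x g x = \int[mu]_x P g x)%R.
    by move=> Bg; apply: (Rintegral_dual markovP Pp Bg) => A mA; rewrite muI.
  have iterI n : (\int[mu]_x iter n P f x = \int[mu]_x f x)%R.
    by elim: n => // n IH; rewrite /= -muP//; exact: (markov_iter markovP).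
  have := attractive f mu Cf.
  rewrite (_ : (fun n => _) = cst (\int[mu]_x (f x)%:E)); last first.
    apply/funext => n; rewrite -(EFin_Rintegral mu (markov_iter markovP n Bf)) iterI.
    exact: EFin_Rintegral.
  move=> /(@cvg_lim _ (@ereal_hausdorff R) _ _ _ _); rewrite lim_cst//.
  by rewrite -(EFin_Rintegral mu Bf) -(EFin_Rintegral mus Bf) => -[].
- exists q, (C * (1 + M0))%R; split => //; first by rewrite mulr_gt0// ltr_wpDr.
  move=> mu muL n _.
  have [M [ME Mf _]] := dual_iterate markovP Pp L_ge0 L_continuous lambda_gt0 lambda_lt1
    c_gt0 A1 mu n.
  have mL0 : 0 <= \int[mu]_x (L x)%:E by apply: integral_ge0 => x _; rewrite lee_fin.
  move: muL mL0 (lexx (\int[mu]_x (L x)%:E)).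
  (* The finite moment is named [m]; the occurrence left untouched turns reflexivity into the bound
     [Lm]. *)
  case: {-3}(\int[mu]_x (L x)%:E) => // m _; rewrite lee_fin => m0 Lm.
  apply: ge_ereal_sup => _ [f [Cf f1 f2] <-].
  have Bf := Cb_Bb Cf; have Bn := markov_iter markovP n Bf.
  rewrite (eq_measure_integral M); last by move=> A mA _; exact/esym/ME.
  rewrite -(EFin_Rintegral M Bf) -(EFin_Rintegral mus Bf) Mf//.
  have iterI k : (\int[mus]_x iter k P f x = \int[mus]_x f x)%R.
    elim: k => // k IH; rewrite -[RHS]IH /=.
    apply/esym/(Rintegral_dual markovP Pp) => [|A mA]; last by rewrite musI.
    exact: (markov_iter markovP).
  rewrite -(iterI n) -EFinB abse_EFin -EFinD -EFinM lee_fin distrC.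
  have K := qn0 n.
  (* By invariance the limit is the [mus]-mean of [P^n f], so the contraction estimate is integrated
     first against [mus], then against [M] or [mu] data through [Lm]; the constants combine by
     [1 + M0 + m <= (1 + M0) (1 + m)]. *)
  have h x : (`|\int[mus]_y iter n P f y - iter n P f x| <=
      q ^+ n * C * (1 + M0) + q ^+ n * C * L x)%R.
    rewrite distrC.
    rewrite (_ : _ + _ = q ^+ n * C * (1 + L x) + q ^+ n * C * M0)%R; last by ring.
    apply: (Rintegral_dist_le (L := L)) => //; first by rewrite mulr_ge0// addr_ge0.
    by move=> y; rewrite -mulrDr; exact: lip_est.
  apply: le_trans (Rintegral_dist_le L_ge0 L_continuous Bn _ K h Lm) _.
    by rewrite mulr_ge0// addr_ge0.
  rewrite [leRHS](_ : _ = q ^+ n * C * ((1 + M0) * (1 + m)))%R; last by ring.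
  rewrite -mulrDr ler_wpM2l//; nra.
Qed.
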